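(* Let $\mathcal P$ be a finite partially ordered set on $n$ elements whose underlying comparability graph $G_{\mathcal P}$ has degeneracy $k$. Then $\dim(\mathcal P)\le 2(k+2)\lceil 2e\log n\rceil$. Moreover, there is a deterministic algorithm that, for $k\ge1$, constructs in $O(n^2k)$ time a realizer of $\mathcal P$ of size $16k(\lceil 2.42\log n\rceil+1)$.
   Context: $\log$ is the natural logarithm and $e$ its base. The comparability graph $G_{\mathcal P}$ has the elements of $\mathcal P$ as vertices, two distinct elements being adjacent iff they are comparable. The degeneracy of a graph is the least $k$ such that its vertices can be enumerated so that every vertex is succeeded by at most $k$ of its neighbors. A linear extension of $\mathcal P$ is a total order $L$ on its elements such that $x\le y$ in $\mathcal P$ implies $x\le y$ in $L$. A realizer of $\mathcal P$ is a set $\mathcal R$ of linear extensions such that for any two distinct elements $x,y$: $x\le y$ in $\mathcal P$ iff $x\le y$ in $L$ for all $L\in\mathcal R$ (for the size of the constructed realizer, repetitions of a linear extension are allowed). $\dim(\mathcal P)$ is the minimum cardinality of a realizer. Running time is measured in elementary steps of a standard (unit-cost RAM) model. *)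

(* Defs.v *)
From mathcomp Require Import all_boot all_order.

Set Implicit Arguments.
Unset Strict Implicit.
Unset Printing Implicit Defensive.

Import Order.TTheory.

Section Degeneracy.

Variables (V : finType) (e : rel V).

(* A duplicate-free #|V|-tuple over V is an enumeration of V; a vertex y
   succeeds x in it when its index is larger. *)
Definition degenerate (k : nat) : bool :=
  [exists s : #|V|.-tuple V,
     uniq s &&
     [forall x : V, #|[set y : V | e x y && (index x s < index y s)]| <= k]].

Lemma degenerate_exists : exists k, degenerate k.
Proof.
exists #|V|; apply/existsP; exists (enum_tuple V).
by rewrite enum_uniq; apply/forallP => x; apply: max_card.
Qed.

Definition degeneracy : nat := ex_minn degenerate_exists.

End Degeneracy.

Section Dimension.

Context {d : Order.disp_t} {P : finPOrderType d}.

Definition comparability : rel P :=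
  fun x y => (x != y) && (x >=< y)%O.

(* A binary relation L on P is represented by its graph, so that
   (x, y) \in L reads "x <= y in L". *)
Definition order_extension (L : {set P * P}) : bool :=
  [&& [forall x : P, (x, x) \in L],
      [forall x : P, forall y : P,
         ((x, y) \in L) && ((y, x) \in L) ==> (x == y)],
      [forall x : P, forall y : P, forall z : P,
         ((x, y) \in L) && ((y, z) \in L) ==> ((x, z) \in L)] &
      [forall x : P, forall y : P, (x <= y)%O ==> ((x, y) \in L)]].

Definition linear_extension (L : {set P * P}) : bool :=
  order_extension L &&
  [forall x : P, forall y : P, ((x, y) \in L) || ((y, x) \in L)].

(* Stated for a collective predicate so that it applies to sets as well as to
   sequences (which may contain repetitions) of relations. *)
Definition realizer (A : {pred {set P * P}}) : bool :=
  [forall L in A, linear_extension L] &&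
  [forall x : P, forall y : P,
     (x != y) ==> ((x <= y)%O == [forall L in A, (x, y) \in L])].

(* The total order listed increasingly by a sequence s enumerating P. *)
Definition listed_order (s : seq P) : {set P * P} :=
  [set p | index p.1 s <= index p.2 s].

End Dimension.

Section RealizerExists.

Context {d : Order.disp_t} (P : finPOrderType d).

Let extensionP (L : {set P * P}) : reflect
  [/\ forall x, (x, x) \in L,
      forall x y, (x, y) \in L -> (y, x) \in L -> x = y,
      forall x y z, (x, y) \in L -> (y, z) \in L -> (x, z) \in L &
      forall x y : P, (x <= y)%O -> (x, y) \in L] (order_extension L).
Proof.
apply: (iffP and4P) => -[h1 h2 h3 h4]; split.
- exact/forallP.
- by move=> x y xy yx; move/forallP/(_ x)/forallP/(_ y): h2; rewrite xy yx => /eqP.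
- move=> x y z xy yz.
  by move/forallP/(_ x)/forallP/(_ y)/forallP/(_ z): h3; rewrite xy yz.
- by move=> x y; move/forallP/(_ x)/forallP/(_ y)/implyP: h4; apply.
- exact/forallP.
- apply/forallP => x; apply/forallP => y; apply/implyP => /andP[xy yx].
  by apply/eqP/h2.
- apply/forallP => x; apply/forallP => y; apply/forallP => z.
  by apply/implyP => /andP[]; apply: h3.
- by apply/forallP => x; apply/forallP => y; apply/implyP; apply: h4.
Qed.

Let add_pair (L : {set P * P}) u v : {set P * P} :=
  [set p | (p \in L) || ((p.1, u) \in L) && ((v, p.2) \in L)].

Let extension_add L u v :
  order_extension L -> (v, u) \notin L -> order_extension (add_pair L u v).
Proof.
move=> /extensionP[r a t e] nvu; apply/extensionP; split.
- by move=> x; rewrite inE r.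
- move=> x y; rewrite !inE /=.
  move=> /orP[xy|/andP[xu vy]] /orP[yx|/andP[yu vx]].
  + exact: a.
  + by case/negP: nvu; apply: t (t _ _ _ vx xy) yu.
  + by case/negP: nvu; apply: t (t _ _ _ vy yx) xu.
  + by case/negP: nvu; apply: t vx xu.
- move=> x y z; rewrite !inE /=.
  move=> /orP[xy|/andP[xu vy]] /orP[yz|/andP[yu vz]].
  + by rewrite (t _ _ _ xy yz).
  + by rewrite (t _ _ _ xy yu) vz orbT.
  + by rewrite xu (t _ _ _ vy yz) orbT.
  + by rewrite xu vz orbT.
- by move=> x y xy; rewrite inE e.
Qed.

Lemma linear_extension_exists (u v : P) :
  ~~ (v <= u)%O -> exists2 L, linear_extension L & (v, u) \notin L.
Proof.
move=> nvu; pose L0 := [set p : P * P | (p.1 <= p.2)%O].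
have eL0 : order_extension L0.
  apply/extensionP; split=> [x|x y|x y z|x y]; rewrite !inE //=.
    by move=> xy yx; apply/le_anti; rewrite xy yx.
  exact: le_trans.
have [uv|uvV] := eqVneq u v; first by rewrite uv lexx in nvu.
pose Q L := order_extension L && ((u, v) \in L).
have QL1 : Q (add_pair L0 u v).
  by apply/andP; split; [apply: extension_add => //|]; rewrite !inE ?lexx ?orbT.
case: (arg_maxnP (fun L : {set P * P} => #|L|) QL1) => L /andP[eL uvL] maxL.
have [r a t e] := extensionP _ eL.
exists L; last by apply/negP => /(a _ _ uvL) uv; rewrite uv eqxx in uvV.
rewrite /linear_extension eL /=.
apply/forallP => x; apply/forallP => y; apply/contraT.
rewrite negb_or => /andP[nxy nyx].
have sub : L \subset add_pair L x y by apply/subsetP => p; rewrite inE => ->.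
have QL' : Q (add_pair L x y).
  by apply/andP; split; [apply: extension_add | apply: (subsetP sub)].
have pL : L \proper add_pair L x y.
  rewrite properE sub /=; apply/subsetPn; exists (x, y) => //.
  by rewrite inE /= !r orbT.
by have /= := maxL _ QL'; rewrite leqNgt (proper_card pL).
Qed.

Lemma realizer_exists : exists m,
  [exists A : {set {set P * P}}, realizer A && (#|A| == m)].
Proof.
exists #|[set L : {set P * P} | linear_extension L]|; apply/existsP.
exists [set L : {set P * P} | linear_extension L].
rewrite eqxx andbT; apply/andP; split.
  by apply/forallP => L; rewrite inE; apply/implyP.
apply/forallP => x; apply/forallP => y; apply/implyP => _; apply/eqP.
apply/idP/idP => [xy|].
  apply/forallP => L; rewrite inE; apply/implyP => /andP[/extensionP[_ _ _ e] _].
  exact: e.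
apply: contraLR => /linear_extension_exists[L lL nL].
by apply/forallPn; exists L; rewrite inE lL.
Qed.

Definition order_dim : nat := ex_minn realizer_exists.

End RealizerExists.

(* A unit-cost random access machine with the instruction set of Cook and
   Reckhow: additions, subtractions, indirect loads and stores, a conditional
   jump, sequential input and output. There is no multiplication or division,
   and every instruction costs one step. Registers hold natural numbers, and
   subtraction is truncated. The machine halts when its program counter leaves
   the program. *)

Inductive instr : Type :=
| Const of nat & nat
| Add of nat & nat & nat
| Sub of nat & nat & nat
| LoadInd of nat & nat
| StoreInd of nat & nat
| JumpPos of nat & nat
| Read of nat
| Write of nat.

Definition program := seq instr.

Record config : Type := Config {
  pc : nat;
  reg : nat -> nat;
  inp : seq nat;
  out : seq nat
}.

Definition upd (m : nat -> nat) (i v : nat) : nat -> nat :=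
  fun j => if j == i then v else m j.

Definition exec (c : config) (a : instr) : config :=
  let: Config p m s o := c in
  match a with
  | Const i v => Config p.+1 (upd m i v) s o
  | Add i j l => Config p.+1 (upd m i (m j + m l)) s o
  | Sub i j l => Config p.+1 (upd m i (m j - m l)) s o
  | LoadInd i j => Config p.+1 (upd m i (m (m j))) s o
  | StoreInd i j => Config p.+1 (upd m (m i) (m j)) s o
  | JumpPos i l => Config (if 0 < m i then l else p.+1) m s o
  | Read i => Config p.+1 (upd m i (head 0 s)) (behead s) o
  | Write i => Config p.+1 m s (rcons o (m i))
  end.

Definition halted (prog : program) (c : config) : bool := size prog <= pc c.

(* A halted machine stays in its configuration. *)
Definition step (prog : program) (c : config) : config :=
  if onth prog (pc c) is Some a then exec c a else c.

Definition init (input : seq nat) : config := Config 0 (fun=> 0) input [::].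

(* On [input], [prog] halts after at most [t] steps, having output [output]. *)
Definition computes_within (prog : program) (input : seq nat) (t : nat)
    (output : seq nat) : Prop :=
  let c := iter t (step prog) (init input) in
  halted prog c /\ out c = output.

(* Elements are numbered 0, ..., n-1 in the order of [enum P]. A poset is input
   as n followed by the n * n matrix of its order relation, row by row; a linear
   order is output as the list of its elements in increasing order. *)

Section Encoding.

Context {d : Order.disp_t} (P : finPOrderType d).

Definition encode_poset : seq nat :=
  #|P| :: [seq nat_of_bool (x <= y)%O | x <- enum P, y <- enum P].

Definition encode_orders (ss : seq (seq P)) : seq nat :=
  flatten [seq [seq nat_of_ord (enum_rank x) | x <- s] | s <- ss].

End Encoding.

(* Main.v *)
(* Enumerate the elements so that each v has a set F(v) of at most k later
   comparable elements, and colour them. For a linear extension and a colour c,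
   run through the members s of c in the enumeration and move the up-set of s to
   the top each time; do the same in the dual order and reverse the result. If v
   precedes u, the two are incomparable and no element of F(v) + {v} has the
   colour c of u, then no member of c comparable to v comes after u, so these two
   extensions order v and u both ways.

   A colour class containing each element with probability 1/(k+2) works for a
   given pair with probability at least 1/(e(k+2)), and averaging yields
   (k+2) ceil(2e log n) classes that serve all pairs, which bounds the dimension.

   The algorithm takes the enumeration from repeatedly deleting an element of
   least degree, and in each round uses 8k colours: u receives the colour least
   frequent among the earlier elements with which it conflicts. The r open pairs
   give at most (k+1)r conflicts, of which a fraction 1/(8k) is monochromatic, so
   at most r/4 pairs stay open, and ceil(2.42 log n) + 1 rounds suffice since
   4^x > n^2 for x = 2.42 log n + 1. The colouring costs O(k r) over a geometric
   series of values r <= n^2, and the output of one round costs O(nk).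

   The machine cannot compute logarithms: the number of rounds is the least m with
   e^(50 m) >= n^121, plus one. It is found by comparing integers, with e replaced
   by the partial sum of its series of length J = sqrt n + c. The comparison is
   exact because an integral of Hermite bounds e^a - N from below for integers
   a >= 4 and N <= e^a. *)

Require Import Defs.
From mathcomp Require Import all_boot all_order zify.

Set Implicit Arguments.
Unset Strict Implicit.
Unset Printing Implicit Defensive.

(** * Structured programs on the random access machine *)

(** Later comparable elements suffice because a member of colour c comparable to v and later than u
    is also later than v, hence lies in F(v), which avoids c. Members before u do no harm, since
    raising u afterwards settles the pair. The factor 8k serves 4(k + 1) <= 8k, which needs k >= 1;
    two extensions per colour make 16k.

    The size of the realizer is prescribed exactly, so the ceiling has to be computed without error;
    121/50 is 2.42. Partial sums lie below e, so no m is accepted too early. The right m could be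
    rejected only if e^(50 m) were extremely close to n^121, which is excluded once J exceeds a
    constant times (log n)^4, as sqrt n + c does. Time limits J from above: multiplication by j <= J
    is repeated addition at cost O(j), a factor of e costs O(J^2) = O(n), and O(n) candidates m are
    tried. The numbers are huge, but every addition costs one step.

    Programs are written in a small language with counted loops only, so that their semantics is a
    total function and running times follow from loop invariants; one compilation theorem transfers
    everything to the machine. *)

Inductive com : Type :=
| CConst of nat & nat
| CAdd of nat & nat & nat
| CSub of nat & nat & nat
| CLoad of nat & nat & nat
| CStore of nat & nat & nat
| CRead of nat
| CWrite of nat
| CSeq of com & com
| CIf of nat & com & com
| CFor of nat & nat & com.

Record store : Type := Store {
  va : nat -> nat;
  ar : nat -> nat -> nat;
  si : seq nat;
  so : seq nat;
  tm : nat
}.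

Definition upd2 (m : nat -> nat -> nat) (a j x : nat) : nat -> nat -> nat :=
  fun b => if b == a then upd (m a) j x else m b.

Definition tick (s : store) : store := Store (va s) (ar s) (si s) (so s) (tm s).+1.
Definition setv (s : store) (v x : nat) : store :=
  Store (upd (va s) v x) (ar s) (si s) (so s) (tm s).
Definition seta (s : store) (a j x : nat) : store :=
  Store (va s) (upd2 (ar s) a j x) (si s) (so s) (tm s).

(** The bound is read once on entry and the loop variable is reset from a separate counter at each
    turn, so the number of turns is fixed whatever the body does, and [run] can recurse on the
    syntax. *)
Definition forloop (i n : nat) (f : store -> store) (s : store) : store :=
  iteri n (fun j s' => f (setv (tick s') i j)) (tick s).

Fixpoint run (c : com) (s : store) : store :=
  match c with
  | CConst v x => setv (tick s) v x
  | CAdd v x y => setv (tick s) v (va s x + va s y)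
  | CSub v x y => setv (tick s) v (va s x - va s y)
  | CLoad v a i => setv (tick s) v (ar s a (va s i))
  | CStore a i v => seta (tick s) a (va s i) (va s v)
  | CRead v => Store (upd (va s) v (head 0 (si s))) (ar s) (behead (si s)) (so s) (tm s).+1
  | CWrite v => Store (va s) (ar s) (si s) (rcons (so s) (va s v)) (tm s).+1
  | CSeq c1 c2 => run c2 (run c1 s)
  | CIf v c1 c2 => if 0 < va s v then run c1 (tick s) else run c2 (tick s)
  | CFor i r c1 => forloop i (va s r) (run c1) s
  end.

(** Two of the residues modulo 32 are taken by variables and hidden registers, which leaves room for
    thirty arrays. *)
Fixpoint array_ids_ok (c : com) : bool :=
  match c with
  | CLoad _ a _ | CStore a _ _ => a < 30
  | CSeq c1 c2 | CIf _ c1 c2 => array_ids_ok c1 && array_ids_ok c2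
  | CFor _ _ c1 => array_ids_ok c1
  | _ => true
  end.

(* Registers congruent to 0 modulo 32 hold the variables, those congruent to 1 are
   hidden, and those congruent to a + 2 hold the array [a]; multiplying an index by
   32 takes five doublings. *)
Definition rv (v : nat) : nat := 32 * v.
Definition rh (h : nat) : nat := 32 * h + 1.

Definition addr_code (a i : nat) : seq instr :=
  [:: Add (rh 0) (rv i) (rv i); Add (rh 0) (rh 0) (rh 0); Add (rh 0) (rh 0) (rh 0);
      Add (rh 0) (rh 0) (rh 0); Add (rh 0) (rh 0) (rh 0); Const (rh 1) (a + 2);
      Add (rh 0) (rh 0) (rh 1)].

Fixpoint csize (c : com) : nat :=
  match c with
  | CLoad _ _ _ | CStore _ _ _ => 8
  | CSeq c1 c2 => csize c1 + csize c2
  | CIf _ c1 c2 => csize c2 + csize c1 + 3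
  | CFor _ _ c1 => csize c1 + 11
  | _ => 1
  end.

(** The loop depth [d] selects the two hidden registers of a loop, and [pos] is the absolute address
    of the code, as jump targets are absolute. An unconditional jump is a [JumpPos] on a register
    just set to 1. The test of a loop sits at its bottom and is jumped to on entry, so an empty
    range skips the body. *)
Fixpoint compile (d pos : nat) (c : com) : seq instr :=
  match c with
  | CConst v x => [:: Const (rv v) x]
  | CAdd v x y => [:: Add (rv v) (rv x) (rv y)]
  | CSub v x y => [:: Defs.Sub (rv v) (rv x) (rv y)]
  | CLoad v a i => rcons (addr_code a i) (LoadInd (rv v) (rh 0))
  | CStore a i v => rcons (addr_code a i) (StoreInd (rh 0) (rv v))
  | CRead v => [:: Read (rv v)]
  | CWrite v => [:: Write (rv v)]
  | CSeq c1 c2 => compile d pos c1 ++ compile d (pos + csize c1) c2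
  | CIf v c1 c2 =>
      JumpPos (rv v) (pos + csize c2 + 3) :: compile d (pos + 1) c2 ++
      [:: Const (rh 0) 1; JumpPos (rh 0) (pos + csize c2 + csize c1 + 3)] ++
      compile d (pos + csize c2 + 3) c1
  | CFor i r c1 =>
      let cnt := rh (2 * d + 2) in let idx := rh (2 * d + 3) in
      [:: Const (rh 0) 0; Add cnt (rv r) (rh 0); Const idx 0; Const (rh 0) 1;
          JumpPos (rh 0) (pos + csize c1 + 10); Const (rh 0) 0; Add (rv i) idx (rh 0)] ++
      compile d.+1 (pos + 7) c1 ++
      [:: Const (rh 0) 1; Add idx idx (rh 0); Defs.Sub cnt cnt (rh 0); JumpPos cnt (pos + 5)]
  end.

Lemma size_compile c d pos : size (compile d pos c) = csize c.
Proof.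
elim: c d pos => //= [c1 IH1 c2 IH2|v c1 IH1 c2 IH2|i r c1 IH1] d pos.
- by rewrite size_cat IH1 IH2.
- by rewrite !size_cat /= IH1 IH2; lia.
- by rewrite !size_cat /= IH1; lia.
Qed.

Definition code_at (prog code : seq instr) (pos : nat) : Prop :=
  forall i, i < size code -> onth prog (pos + i) = onth code i.

Lemma onth_cat (T : Type) (s1 s2 : seq T) i :
  onth (s1 ++ s2) i = if i < size s1 then onth s1 i else onth s2 (i - size s1).
Proof. by elim: s1 i => [|x s1 IH] [|i] //=; rewrite IH. Qed.

Lemma code_at_cat prog c1 c2 pos :
  code_at prog (c1 ++ c2) pos ->
  code_at prog c1 pos /\ code_at prog c2 (pos + size c1).
Proof.
move=> H; split=> i lt_i.
- by rewrite H ?size_cat ?onth_cat ?lt_i //; lia.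
- rewrite -addnA H ?size_cat; last by lia.
  by rewrite onth_cat ltnNge leq_addr /= addKn.
Qed.

Lemma code_at_head prog a c pos : code_at prog (a :: c) pos -> onth prog pos = Some a.
Proof. by move=> /(_ 0 isT); rewrite addn0. Qed.

Lemma code_at_behead prog a c pos : code_at prog (a :: c) pos -> code_at prog c pos.+1.
Proof. by move=> H i lt_i; rewrite addSnnS H. Qed.

Ltac fetch H I := pose proof (code_at_head H) as I; apply code_at_behead in H.

Definition related (s : store) (m : nat -> nat) : Prop :=
  (forall v, m (rv v) = va s v) /\
  (forall a j, a < 30 -> m (32 * j + (a + 2)) = ar s a j).

(* Loop counters of the enclosing loops live in the hidden registers below 2d+2. *)
Definition keeps (d : nat) (m m' : nat -> nat) : Prop :=
  forall h, 1 < h < 2 * d + 2 -> m' (rh h) = m (rh h).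

(** Sixteen machine steps are charged per unit of [tm], which covers the eight steps of an array
    access and the bookkeeping of a loop turn; the inequality is arranged to avoid truncated
    subtraction. *)
Definition simulates (prog : program) (d pos pos' : nat) (s s' : store) : Prop :=
  forall m, related s m -> exists t m',
    [/\ t + 16 * tm s <= 16 * tm s', related s' m', keeps d m m' &
        iter t (step prog) (Config pos m (si s) (so s)) =
        Config pos' m' (si s') (so s')].

Lemma step_at prog pos m i o a : onth prog pos = Some a ->
  step prog (Config pos m i o) = exec (Config pos m i o) a.
Proof. by rewrite /step /= => ->. Qed.

Lemma iter_steps prog t1 t2 c1 c2 c3 :
  iter t1 (step prog) c1 = c2 -> iter t2 (step prog) c2 = c3 ->
  iter (t2 + t1) (step prog) c1 = c3.
Proof. by move=> H1 H2; rewrite iterD H1. Qed.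

Lemma upd_same m j x : upd m j x j = x.
Proof. by rewrite /upd eqxx. Qed.

Lemma upd_other m i j x : i != j -> upd m j x i = m i.
Proof. by rewrite /upd => /negbTE->. Qed.

Lemma upd_hidden m h x j : j %% 32 != 1 -> upd m (rh h) x j = m j.
Proof. by rewrite /upd; case: (j =P rh h) => // ->; rewrite /rh; lia. Qed.

Lemma run_addr prog a i pos m inp out :
  code_at prog (addr_code a i) pos ->
  exists m', [/\ iter 7 (step prog) (Config pos m inp out) = Config (pos + 7) m' inp out,
    m' (rh 0) = 32 * m (rv i) + (a + 2) &
    forall j, j != rh 0 -> j != rh 1 -> m' j = m j].
Proof.
move=> H; eexists; split.
- fetch H H1.
  fetch H H2. fetch H H3. fetch H H4. fetch H H5. fetch H H6.
  have H7 := code_at_head H.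
  rewrite 7!iterSr (step_at _ _ _ H1) /exec (step_at _ _ _ H2) /exec (step_at _ _ _ H3) /exec.
  rewrite (step_at _ _ _ H4) /exec (step_at _ _ _ H5) /exec (step_at _ _ _ H6) /exec.
  rewrite (step_at _ _ _ H7) /exec; have -> : pos + 7 = pos.+3.+4 by lia.
  reflexivity.
- rewrite /upd /rh /rv /=; lia.
- by move=> j /negbTE h0 /negbTE h1; rewrite /upd h0 h1.
Qed.

Lemma simulates_trans prog d p1 p2 p3 s1 s2 s3 :
  simulates prog d p1 p2 s1 s2 -> simulates prog d p2 p3 s2 s3 ->
  simulates prog d p1 p3 s1 s3.
Proof.
move=> H12 H23 m /H12[t [m2 [tle rel2 k2 e2]]].
have [t' [m3 [tle' rel3 k3 e3]]] := H23 _ rel2.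
exists (t' + t), m3; split=> //; first by lia.
- by move=> h hh; rewrite k3 // k2.
- exact: iter_steps e2 e3.
Qed.

Lemma simulates_prim prog d pos a s s' :
  onth prog pos = Some a -> tm s < tm s' ->
  (forall m, related s m -> exists m',
    [/\ exec (Config pos m (si s) (so s)) a = Config pos.+1 m' (si s') (so s'),
        related s' m' & keeps d m m']) ->
  simulates prog d pos (pos + 1) s s'.
Proof.
move=> Ha lt_tm H m /H[m' [e rel' k]]; exists 1, m'; split=> //; first by lia.
by rewrite /= (step_at _ _ _ Ha) e addn1.
Qed.

Lemma related_setv s m v x : related s m -> related (setv (tick s) v x) (upd m (rv v) x).
Proof.
move=> [rv_ ra]; split=> [w|a j lt_a] /=.
- by rewrite /upd -rv_ /rv eqn_mul2l.
- by rewrite -ra // /upd; case: eqP => // E; move: E; rewrite /rv; lia.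
Qed.

Lemma keeps_updv d m v x : keeps d m (upd m (rv v) x).
Proof. by move=> h hh; rewrite /upd; case: eqP => // E; move: E; rewrite /rv /rh; lia. Qed.

Lemma related_hidden s m m' :
  (forall j, j %% 32 != 1 -> m' j = m j) -> related s m -> related s m'.
Proof.
move=> H [rv_ ra]; split=> [w|a j lt_a].
- by rewrite H // /rv; lia.
- by rewrite H ?ra //; lia.
Qed.

Ltac at_pc H := rewrite -H; congr (onth _ _); rewrite /=; lia.

Lemma compileP prog c d pos s :
  array_ids_ok c -> code_at prog (compile d pos c) pos ->
  simulates prog d pos (pos + csize c) s (run c s).
Proof.
elim: c d pos s => [v x|v x y|v x y|v a i|a i v|v|v|c1 IH1 c2 IH2|v c1 IH1 c2 IH2|i r c IH]
  d pos s /= ok Hc.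
- apply: simulates_prim (code_at_head Hc) _ _ => // m rel.
  exists (upd m (rv v) x); split=> //; [exact: related_setv | exact: keeps_updv].
- apply: simulates_prim (code_at_head Hc) _ _ => // m rel.
  exists (upd m (rv v) (va s x + va s y)); split=> //=.
  + by rewrite !rel.1.
  + exact: related_setv.
  + exact: keeps_updv.
- apply: simulates_prim (code_at_head Hc) _ _ => // m rel.
  exists (upd m (rv v) (va s x - va s y)); split=> //=.
  + by rewrite !rel.1.
  + exact: related_setv.
  + exact: keeps_updv.
- move=> m rel; have /code_at_cat[H7 /code_at_head H1] :
    code_at prog (addr_code a i ++ [:: LoadInd (rv v) (rh 0)]) pos by [].
  have [m1 [e1 h1 fr]] := run_addr m (si s) (so s) H7.
  have rel1 : related s m1.
    by apply: related_hidden rel => j hj; apply: fr; apply: contraNneq hj => ->; rewrite /rh; lia.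
  exists 8, (upd m1 (rv v) (ar s a (va s i))); split=> //=.
  + lia.
  + exact: related_setv.
  + move=> h hh; rewrite (@keeps_updv d) //.
    by apply: fr; rewrite /rh; lia.
  + apply: (iter_steps (t2 := 1) e1); rewrite /= (step_at _ _ _ H1) /=.
    by rewrite h1 rel.1 rel1.2 //; congr Config; lia.
- move=> m rel; have /code_at_cat[H7 /code_at_head H1] :
    code_at prog (addr_code a i ++ [:: StoreInd (rh 0) (rv v)]) pos by [].
  have [m1 [e1 h1 fr]] := run_addr m (si s) (so s) H7.
  have rel1 : related s m1.
    by apply: related_hidden rel => j hj; apply: fr; apply: contraNneq hj => ->; rewrite /rh; lia.
  exists 8, (upd m1 (32 * va s i + (a + 2)) (va s v)); split=> //=.
  + lia.
  + split=> [w|b j lt_b] /=.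
    * rewrite -(rel1.1 w) /upd; case: eqP => // E; move: E; rewrite /rv; lia.
    * rewrite /upd2 /upd; case: eqP => [E|NE].
        have [-> ->] : b = a /\ j = va s i by lia.
        by rewrite !eqxx.
      case: (b =P a) => [E|_]; last exact: rel1.2.
      rewrite rel1.2 // E; case: eqP => // E'.
      by exfalso; apply: NE; rewrite E E'.
  + move=> h hh; rewrite /upd; case: eqP => [E|_]; first by move: E; rewrite /rh; lia.
    by apply: fr; rewrite /rh; lia.
  + apply: (iter_steps (t2 := 1) e1); rewrite /= (step_at _ _ _ H1) /=.
    by rewrite h1 rel.1 rel1.1 //; congr Config; lia.
- apply: simulates_prim (code_at_head Hc) _ _ => // m rel.
  exists (upd m (rv v) (head 0 (si s))); split=> //; [|exact: keeps_updv].
  by have := related_setv v (head 0 (si s)) rel.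
- apply: simulates_prim (code_at_head Hc) _ _ => // m rel.
  by exists m; split=> //=; rewrite rel.1.
- case/andP: ok => ok1 ok2; have [H1 H2] := code_at_cat Hc.
  rewrite size_compile in H2; rewrite addnA.
  exact: simulates_trans (IH1 _ _ _ ok1 H1) (IH2 _ _ _ ok2 H2).
- case/andP: ok => ok1 ok2.
  fetch Hc HJ.
  have [H2 {}Hc] := code_at_cat Hc.
  fetch Hc HC. fetch Hc HJ'.
  rewrite size_compile in HC HJ' Hc.
  have jump : simulates prog d pos (if 0 < va s v then pos + csize c2 + 3 else pos + 1) s (tick s).
    move=> m rel; exists 1, m; split=> //=; first by lia.
    by rewrite (step_at _ _ _ HJ) /= rel.1 addn1.
  case: ifP jump => v0 jump.
  + have -> : pos + (csize c2 + csize c1 + 3) = pos + csize c2 + 3 + csize c1 by lia.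
    apply: simulates_trans jump _; apply: IH1 => //.
    have E3 : (pos.+1 + csize c2).+2 = pos + csize c2 + 3 by lia.
    by rewrite E3 in Hc.
  + move=> m rel; have rel0 : related (tick s) m by [].
    rewrite addn1 in H2.
    have [t [m1 [tle rel1 k1 e1]]] := IH2 d pos.+1 (tick s) ok2 H2 m rel0.
    exists (2 + (t + 1)), (upd m1 (rh 0) 1); split=> //=.
    * by move: tle => /=; lia.
    * by apply: related_hidden rel1 => j; apply: upd_hidden.
    * move=> h hh; rewrite /upd; case: eqP => [E|_]; last exact: k1.
      by move: E; rewrite /rh; lia.
    * apply: (iter_steps (t2 := 2)).
        apply: (iter_steps (t1 := 1)); last exact: e1.
        by rewrite /= (step_at _ _ _ HJ) /= rel.1 v0.
      rewrite 2!iterSr (step_at _ _ _ HC) /exec.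
      rewrite (@step_at _ _ _ _ _ (JumpPos (rh 0) (pos + csize c2 + csize c1 + 3))); last by rewrite -HJ'.
      by rewrite /exec upd_same; congr Config; lia.
- have [Hpre {}Hc] := @code_at_cat _ [:: Const (rh 0) 0; Add (rh (2 * d + 2)) (rv r) (rh 0);
     Const (rh (2 * d + 3)) 0; Const (rh 0) 1; JumpPos (rh 0) (pos + csize c + 10);
     Const (rh 0) 0; Add (rv i) (rh (2 * d + 3)) (rh 0)] _ _ Hc.
  have [Hbody Hpost] := code_at_cat Hc; rewrite size_compile in Hpost.
  move=> {Hc} m rel; rewrite /forloop.
  set N := va s r; set f := (fun j s' => run c (setv (tick s') i j)).
  fetch Hpre H0. fetch Hpre H1. fetch Hpre H2. fetch Hpre H3. fetch Hpre H4. fetch Hpre H5.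
  have H6 := code_at_head Hpre.
  fetch Hpost G0. fetch Hpost G1. fetch Hpost G2.
  have G3 := code_at_head Hpost.
  have {}Hbody : code_at prog (compile d.+1 (pos + 7) c) (pos + 7) := Hbody.
  (* The state described is the one in front of the bottom test, with the counter equal to the
     number of turns still to do. The surplus 10 is left over from the tick on entry and pays for
     the last, failing test. *)
  have loop j : j <= N -> exists t m',
    [/\ t + 16 * tm s + 10 <= 16 * tm (iteri j f (tick s)), related (iteri j f (tick s)) m',
        keeps d m m' /\ (m' (rh (2 * d + 2)) = N - j /\ m' (rh (2 * d + 3)) = j) &
        iter t (step prog) (Config pos m (si s) (so s)) =
        Config (pos + csize c + 10) m' (si (iteri j f (tick s))) (so (iteri j f (tick s)))].
    elim: j => [|j IHj] jN.
      exists 5; eexists; split; last first.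
      - rewrite 5!iterSr (step_at _ _ _ H0) /exec (step_at _ _ _ H1) /exec.
        rewrite (step_at _ _ _ H2) /exec (step_at _ _ _ H3) /exec (step_at _ _ _ H4) /exec.
        by rewrite upd_same /=; reflexivity.
      - split=> [h hh|].
          by rewrite !upd_other //; apply/eqP; rewrite /rh; lia.
        split; last first.
          rewrite upd_other; last by apply/eqP; rewrite /rh; lia.
          by rewrite upd_same.
        rewrite upd_other; last by apply/eqP; rewrite /rh; lia.
        rewrite upd_other; last by apply/eqP; rewrite /rh; lia.
        rewrite !upd_same upd_other; last by apply/eqP; rewrite /rh /rv; lia.
        by rewrite rel.1 addn0 subn0.
      - by apply: (related_hidden (m := m)) => // q hq; rewrite !upd_hidden.
      - by rewrite /=; lia.
    have [t [m1 [tle rel1 [k1 [ec ei]] e1]]] := IHj (ltnW jN).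
    set sj := iteri j f (tick s) in tle rel1 e1 *.
    pose m2 := upd (upd m1 (rh 0) 0) (rv i) j.
    have rel2 : related (setv (tick sj) i j) m2.
      by apply: related_setv; apply: (related_hidden (m := m1)) => // q; apply: upd_hidden.
    have [t' [m3 [tle' rel3 k3 e3]]] := IH d.+1 (pos + 7) _ ok Hbody _ rel2.
    rewrite -/(f j sj) in tle' rel3 e3.
    have jump0 : step prog (Config (pos + csize c + 10) m1 (si sj) (so sj)) =
                 Config (pos + 5) m1 (si sj) (so sj).
      rewrite (@step_at _ _ _ _ _ (JumpPos (rh (2 * d + 2)) (pos + 5))) /= ?ec ?subn_gt0 ?jN //.
      by at_pc G3.
    have entry : iter 3 (step prog) (Config (pos + csize c + 10) m1 (si sj) (so sj)) =
                 Config (pos + 7) m2 (si sj) (so sj).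
      rewrite 3!iterSr jump0 /= (@step_at _ _ _ _ _ (Const (rh 0) 0)); last by at_pc H5.
      rewrite /exec (@step_at _ _ _ _ _ (Add (rv i) (rh (2 * d + 3)) (rh 0))); last first.
        by at_pc H6.
      rewrite /exec upd_same upd_other ?ei ?addn0; last by apply/eqP; rewrite /rh; lia.
      by congr Config; lia.
    have k13 h : 1 < h < 2 * d.+1 + 2 -> m3 (rh h) = m1 (rh h).
      move=> hh; rewrite k3 // /m2 /upd; case: eqP => [E|_]; first by move: E; rewrite /rh /rv; lia.
      by case: eqP => [E|_] //; move: E; rewrite /rh; lia.
    have c3 : m3 (rh (2 * d + 2)) = N - j by rewrite k13 ?ec //; lia.
    have i3 : m3 (rh (2 * d + 3)) = j by rewrite k13 ?ei //; lia.
    have [hneq1 hneq2] : (rh (2 * d + 3) != rh 0) /\ (rh (2 * d + 2) != rh 0).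
      by split; apply/eqP; rewrite /rh; lia.
    have hneq3 : rh (2 * d + 2) != rh (2 * d + 3) by apply/eqP; rewrite /rh; lia.
    exists (3 + (t' + (3 + t))).
    exists (upd (upd (upd m3 (rh 0) 1) (rh (2 * d + 3)) j.+1) (rh (2 * d + 2)) (N - j.+1)).
    split; last first.
    - apply: iter_steps; first by apply: iter_steps e3; apply: iter_steps e1 entry.
      rewrite 3!iterSr (@step_at _ _ _ _ _ (Const (rh 0) 1)); last by at_pc G0.
      rewrite /exec (@step_at _ _ _ _ _ (Add (rh (2 * d + 3)) (rh (2 * d + 3)) (rh 0))); last first.
        by at_pc G1.
      rewrite /exec upd_same (upd_other _ _ hneq1) i3 addn1.
      rewrite (@step_at _ _ _ _ _ (Defs.Sub (rh (2 * d + 2)) (rh (2 * d + 2)) (rh 0))); last first.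
        by at_pc G2.
      rewrite /exec !(upd_other _ _ hneq3) (upd_other _ _ hneq2) c3 upd_other ?upd_same; last by rewrite eq_sym.
      by congr Config; [lia | congr (upd _ _ _); lia].
    - split; [|split].
      + move=> h hh; rewrite /upd; case: eqP => [E|_]; first by move: E; rewrite /rh; lia.
        case: eqP => [E|_]; first by move: E; rewrite /rh; lia.
        case: eqP => [E|_]; first by move: E; rewrite /rh; lia.
        by rewrite k13 ?k1 //; lia.
      + by rewrite /upd eqxx.
      + by rewrite /upd eqxx eq_sym (negbTE hneq3).
    - by apply: (related_hidden (m := m3)) => // q hq; rewrite !upd_hidden.
    - by move: tle tle'; rewrite /= -/sj; lia.
  have [t [m' [tle rel' [k' [ec _]] e']]] := loop N (leqnn N).
  exists (1 + t), m'; split=> //; first by lia.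
  apply: (iter_steps (t2 := 1) e').
  rewrite /= (@step_at _ _ _ _ _ (JumpPos (rh (2 * d + 2)) (pos + 5))); last by at_pc G3.
  by rewrite /exec ec subnn; congr Config; lia.
Qed.

Lemma compile_computes c input b :
  array_ids_ok c ->
  let s := run c (Store (fun=> 0) (fun _ _ => 0) input [::] 0) in
  16 * tm s <= b -> computes_within (compile 0 0 c) input b (so s).
Proof.
move=> ok s le_b.
have Hc : code_at (compile 0 0 c) (compile 0 0 c) 0 by move=> i _.
have rel0 : related (Store (fun=> 0) (fun _ _ => 0) input [::] 0) (fun=> 0) by [].
have [t [m [tle _ _ e]]] := compileP ok Hc rel0.
rewrite -/s /= add0n in tle e.
have -> : b = (b - t) + t by rewrite subnK //; lia.
rewrite /computes_within iterD /init e.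
have stay q : iter q (step (compile 0 0 c)) (Config (csize c) m (si s) (so s)) =
    Config (csize c) m (si s) (so s).
  elim: q => //= q ->; rewrite /step /= onth_default ?size_compile //.
by rewrite stay /halted /= size_compile.
Qed.

(** * Symbolic execution, frame rules and the loop rule *)

Arguments run : simpl never.
Arguments setv : simpl never.
Arguments seta : simpl never.
Arguments tick : simpl never.
Arguments upd : simpl never.

Definition pop (s : store) : store := Store (va s) (ar s) (behead (si s)) (so s) (tm s).
Definition emit (s : store) (x : nat) : store :=
  Store (va s) (ar s) (si s) (rcons (so s) x) (tm s).
Arguments pop : simpl never.
Arguments emit : simpl never.

Lemma run_const v x s : run (CConst v x) s = setv (tick s) v x. Proof. by []. Qed.
Lemma run_add v x y s : run (CAdd v x y) s = setv (tick s) v (va s x + va s y). Proof. by []. Qed.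
Lemma run_sub v x y s : run (CSub v x y) s = setv (tick s) v (va s x - va s y). Proof. by []. Qed.
Lemma run_load v a i s : run (CLoad v a i) s = setv (tick s) v (ar s a (va s i)). Proof. by []. Qed.
Lemma run_store a i v s : run (CStore a i v) s = seta (tick s) a (va s i) (va s v). Proof. by []. Qed.
Lemma run_read v s : run (CRead v) s = setv (pop (tick s)) v (head 0 (si s)). Proof. by []. Qed.
Lemma run_write v s : run (CWrite v) s = emit (tick s) (va s v). Proof. by []. Qed.
Lemma run_seq c1 c2 s : run (CSeq c1 c2) s = run c2 (run c1 s). Proof. by []. Qed.
Lemma run_if v c1 c2 s :
  run (CIf v c1 c2) s = if 0 < va s v then run c1 (tick s) else run c2 (tick s).
Proof. by []. Qed.

Lemma va_setv s v x w : va (setv s v x) w = if w == v then x else va s w. Proof. by []. Qed.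
Lemma va_seta s a j x w : va (seta s a j x) w = va s w. Proof. by []. Qed.
Lemma va_tick s w : va (tick s) w = va s w. Proof. by []. Qed.
Lemma va_pop s w : va (pop s) w = va s w. Proof. by []. Qed.
Lemma va_emit s x w : va (emit s x) w = va s w. Proof. by []. Qed.
Lemma ar_setv s v x b : ar (setv s v x) b = ar s b. Proof. by []. Qed.
Lemma ar_seta s a j x b : ar (seta s a j x) b = if b == a then upd (ar s a) j x else ar s b.
Proof. by []. Qed.
Lemma ar_tick s b : ar (tick s) b = ar s b. Proof. by []. Qed.
Lemma ar_pop s b : ar (pop s) b = ar s b. Proof. by []. Qed.
Lemma ar_emit s x b : ar (emit s x) b = ar s b. Proof. by []. Qed.
Lemma si_setv s v x : si (setv s v x) = si s. Proof. by []. Qed.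
Lemma si_seta s a j x : si (seta s a j x) = si s. Proof. by []. Qed.
Lemma si_tick s : si (tick s) = si s. Proof. by []. Qed.
Lemma si_pop s : si (pop s) = behead (si s). Proof. by []. Qed.
Lemma si_emit s x : si (emit s x) = si s. Proof. by []. Qed.
Lemma so_setv s v x : so (setv s v x) = so s. Proof. by []. Qed.
Lemma so_seta s a j x : so (seta s a j x) = so s. Proof. by []. Qed.
Lemma so_tick s : so (tick s) = so s. Proof. by []. Qed.
Lemma so_pop s : so (pop s) = so s. Proof. by []. Qed.
Lemma so_emit s x : so (emit s x) = rcons (so s) x. Proof. by []. Qed.
Lemma tm_setv s v x : tm (setv s v x) = tm s. Proof. by []. Qed.
Lemma tm_seta s a j x : tm (seta s a j x) = tm s. Proof. by []. Qed.
Lemma tm_tick s : tm (tick s) = (tm s).+1. Proof. by []. Qed.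
Lemma tm_pop s : tm (pop s) = tm s. Proof. by []. Qed.
Lemma tm_emit s x : tm (emit s x) = tm s. Proof. by []. Qed.

Definition runE := (run_const, run_add, run_sub, run_load, run_store, run_read, run_write, run_seq).
Definition stE := (va_setv, va_seta, va_tick, va_pop, va_emit, ar_setv, ar_seta, ar_tick, ar_pop,
  ar_emit, si_setv, si_seta, si_tick, si_pop, si_emit, so_setv, so_seta, so_tick, so_pop, so_emit,
  tm_setv, tm_seta, tm_tick, tm_pop, tm_emit).

(** The variables, and in [ma] the arrays, that a command may modify. Both are computed from the
    syntax, so that what is left untouched can be decided by evaluation. *)
Fixpoint mv (c : com) : seq nat :=
  match c with
  | CConst v _ | CAdd v _ _ | CSub v _ _ | CLoad v _ _ | CRead v => [:: v]
  | CStore _ _ _ | CWrite _ => [::]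
  | CSeq c1 c2 | CIf _ c1 c2 => mv c1 ++ mv c2
  | CFor i _ c1 => i :: mv c1
  end.

Fixpoint ma (c : com) : seq nat :=
  match c with
  | CStore a _ _ => [:: a]
  | CSeq c1 c2 | CIf _ c1 c2 => ma c1 ++ ma c2
  | CFor _ _ c1 => ma c1
  | _ => [::]
  end.

Fixpoint reads (c : com) : bool :=
  match c with
  | CRead _ => true
  | CSeq c1 c2 | CIf _ c1 c2 => reads c1 || reads c2
  | CFor _ _ c1 => reads c1
  | _ => false
  end.

Fixpoint writes (c : com) : bool :=
  match c with
  | CWrite _ => true
  | CSeq c1 c2 | CIf _ c1 c2 => writes c1 || writes c2
  | CFor _ _ c1 => writes c1
  | _ => false
  end.

Lemma forloop_ind (I : nat -> store -> Prop) i n f s :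
  I 0 (tick s) -> (forall j s1, j < n -> I j s1 -> I j.+1 (f (setv (tick s1) i j))) ->
  I n (forloop i n f s).
Proof.
move=> I0 IS; rewrite /forloop; elim: {-2}n (leqnn n) => //= j IH lt_j.
by apply: IS => //; apply: IH; apply: ltnW.
Qed.

Lemma frame_va c v s : v \notin mv c -> va (run c s) v = va s v.
Proof.
elim: c s => [w x|w x y|w x y|w a i|a i w|w|w|c1 IH1 c2 IH2|w c1 IH1 c2 IH2|i r c IH] s //=;
  rewrite ?inE ?mem_cat ?negb_or ?orbF; try exact: upd_other.
- by case/andP=> h1 h2; rewrite !runE IH2 // IH1.
- by case/andP=> h1 h2; rewrite run_if; case: ifP => _; rewrite ?IH1 ?IH2 ?stE.
- case/andP=> h1 h2; change (va (forloop i (va s r) (run c) s) v = va s v).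
  apply: (@forloop_ind (fun _ s' => va s' v = va s v)); first by rewrite stE.
  by move=> j s1 _ E; rewrite IH // !stE (negbTE h1).
Qed.

Lemma frame_ar c a s : a \notin ma c -> ar (run c s) a = ar s a.
Proof.
elim: c s => [w x|w x y|w x y|w b i|b i w|w|w|c1 IH1 c2 IH2|w c1 IH1 c2 IH2|i r c IH] s //=;
  rewrite ?inE ?mem_cat ?negb_or ?orbF.
- by rewrite /upd2 => /negbTE->.
- by case/andP=> h1 h2; rewrite !runE IH2 // IH1.
- by case/andP=> h1 h2; rewrite run_if; case: ifP => _; rewrite ?IH1 ?IH2 ?stE.
- move=> h2; change (ar (forloop i (va s r) (run c) s) a = ar s a).
  apply: (@forloop_ind (fun _ s' => ar s' a = ar s a)); first by rewrite stE.
  by move=> j s1 _ E; rewrite IH // !stE.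
Qed.

Lemma frame_si c s : ~~ reads c -> si (run c s) = si s.
Proof.
elim: c s => [w x|w x y|w x y|w b i|b i w|w|w|c1 IH1 c2 IH2|w c1 IH1 c2 IH2|i r c IH] s //=;
  rewrite ?negb_or.
- by case/andP=> h1 h2; rewrite !runE IH2 // IH1.
- by case/andP=> h1 h2; rewrite run_if; case: ifP => _; rewrite ?IH1 ?IH2 ?stE.
- move=> h2; change (si (forloop i (va s r) (run c) s) = si s).
  apply: (@forloop_ind (fun _ s' => si s' = si s)); first by rewrite stE.
  by move=> j s1 _ E; rewrite IH // !stE.
Qed.

Lemma frame_so c s : ~~ writes c -> so (run c s) = so s.
Proof.
elim: c s => [w x|w x y|w x y|w b i|b i w|w|w|c1 IH1 c2 IH2|w c1 IH1 c2 IH2|i r c IH] s //=;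
  rewrite ?negb_or.
- by case/andP=> h1 h2; rewrite !runE IH2 // IH1.
- by case/andP=> h1 h2; rewrite run_if; case: ifP => _; rewrite ?IH1 ?IH2 ?stE.
- move=> h2; change (so (forloop i (va s r) (run c) s) = so s).
  apply: (@forloop_ind (fun _ s' => so s' = so s)); first by rewrite stE.
  by move=> j s1 _ E; rewrite IH // !stE.
Qed.

Lemma va_same s v x : va (setv s v x) v = x.
Proof. by rewrite va_setv eqxx. Qed.
(** The test by [eqn] is closed by [erefl], and the free right-hand side [r] lets such facts be
    chained into one proof term that walks through the store. *)
Lemma va_other s v x w r : eqn w v = false -> va s w = r -> va (setv s v x) w = r.
Proof. by rewrite va_setv eqnE => ->. Qed.
Lemma va_skip_tick s w r : va s w = r -> va (tick s) w = r. Proof. by []. Qed.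
Lemma va_skip_seta s a j x w r : va s w = r -> va (seta s a j x) w = r. Proof. by []. Qed.
Lemma va_skip_pop s w r : va s w = r -> va (pop s) w = r. Proof. by []. Qed.
Lemma va_skip_emit s x w r : va s w = r -> va (emit s x) w = r. Proof. by []. Qed.
Lemma ar_same s a j x r : ar s a = r -> ar (seta s a j x) a = upd r j x.
Proof. by rewrite ar_seta eqxx => ->. Qed.
Lemma ar_other s a j x b r : eqn b a = false -> ar s b = r -> ar (seta s a j x) b = r.
Proof. by rewrite ar_seta eqnE => ->. Qed.
Lemma ar_skip_tick s b r : ar s b = r -> ar (tick s) b = r. Proof. by []. Qed.
Lemma ar_skip_setv s v x b r : ar s b = r -> ar (setv s v x) b = r. Proof. by []. Qed.
Lemma ar_skip_pop s b r : ar s b = r -> ar (pop s) b = r. Proof. by []. Qed.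
Lemma ar_skip_emit s x b r : ar s b = r -> ar (emit s x) b = r. Proof. by []. Qed.
Lemma run_add_to v x y s p q : va s x = p -> va s y = q ->
  run (CAdd v x y) s = setv (tick s) v (p + q).
Proof. by rewrite run_add => -> ->. Qed.
Lemma run_sub_to v x y s p q : va s x = p -> va s y = q ->
  run (CSub v x y) s = setv (tick s) v (p - q).
Proof. by rewrite run_sub => -> ->. Qed.
Lemma run_load_to v a i s p q : ar s a = p -> va s i = q ->
  run (CLoad v a i) s = setv (tick s) v (p q).
Proof. by rewrite run_load => -> ->. Qed.
Lemma run_store_to a i v s p q : va s i = p -> va s v = q ->
  run (CStore a i v) s = seta (tick s) a p q.
Proof. by rewrite run_store => -> ->. Qed.
Lemma run_write_to v s p : va s v = p -> run (CWrite v) s = emit (tick s) p.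
Proof. by rewrite run_write => ->. Qed.

Lemma va_frame c s v r : (v \in mv c) = false -> va s v = r -> va (run c s) v = r.
Proof. by move=> h <-; apply: frame_va; rewrite h. Qed.
Lemma ar_frame c s a r : (a \in ma c) = false -> ar s a = r -> ar (run c s) a = r.
Proof. by move=> h <-; apply: frame_ar; rewrite h. Qed.

Lemma rewrite_goal (A : Type) (P : A -> Prop) x y : x = y -> P y -> P x.
Proof. by move=> ->. Qed.

(* Symbolic execution, innermost instruction first: every value is normalised
   to an expression over the initial store before the next instruction, which
   keeps the terms linear in the length of the code. *)
Ltac look_va s x :=
  lazymatch s with
  | setv ?s' ?v ?e =>
      let b := eval vm_compute in (eqn x v) in
      lazymatch b with
      | true => constr:(va_same s' v e)
      | false => let p := look_va s' x in constr:(@va_other s' v e x _ (erefl false) p)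
      end
  | tick ?s' => let p := look_va s' x in constr:(@va_skip_tick s' x _ p)
  | seta ?s' ?a ?j ?e => let p := look_va s' x in constr:(@va_skip_seta s' a j e x _ p)
  | pop ?s' => let p := look_va s' x in constr:(@va_skip_pop s' x _ p)
  | emit ?s' ?e => let p := look_va s' x in constr:(@va_skip_emit s' e x _ p)
  | run ?c ?s' =>
      let b := eval vm_compute in (x \in mv c) in
      lazymatch b with
      | true => constr:(erefl (va s x))
      | false => let p := look_va s' x in constr:(@va_frame c s' x _ (erefl false) p)
      end
  | _ => constr:(erefl (va s x))
  end.

Ltac look_ar s a :=
  lazymatch s with
  | seta ?s' ?b ?j ?e =>
      let t := eval vm_compute in (eqn a b) in
      let p := look_ar s' a in
      lazymatch t with
      | true => constr:(@ar_same s' b j e _ p)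
      | false => constr:(@ar_other s' b j e a _ (erefl false) p)
      end
  | setv ?s' ?v ?e => let p := look_ar s' a in constr:(@ar_skip_setv s' v e a _ p)
  | tick ?s' => let p := look_ar s' a in constr:(@ar_skip_tick s' a _ p)
  | pop ?s' => let p := look_ar s' a in constr:(@ar_skip_pop s' a _ p)
  | emit ?s' ?e => let p := look_ar s' a in constr:(@ar_skip_emit s' e a _ p)
  | run ?c ?s' =>
      let b := eval vm_compute in (a \in ma c) in
      lazymatch b with
      | true => constr:(erefl (ar s a))
      | false => let p := look_ar s' a in constr:(@ar_frame c s' a _ (erefl false) p)
      end
  | _ => constr:(erefl (ar s a))
  end.

(* Purely syntactic rewriting: unification would unfold the stores. *)
Ltac rw e :=
  lazymatch type of e with ?x = ?y =>
    pattern x; refine (@rewrite_goal _ _ x y e _); cbv beta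
  end.

Ltac not_step s :=
  lazymatch s with
  | run ?c _ =>
      lazymatch c with
      | CSeq _ _ => fail | CConst _ _ => fail | CAdd _ _ _ => fail | CSub _ _ _ => fail
      | CLoad _ _ _ => fail | CStore _ _ _ => fail | CRead _ => fail | CWrite _ => fail
      | _ => idtac
      end
  | _ => idtac
  end.

Ltac sx_step :=
  match goal with
  | |- context [run ?c ?s] =>
      not_step s;
      lazymatch c with
      | CSeq ?a ?b => rw constr:(run_seq a b s)
      | CConst ?v ?x => rw constr:(run_const v x s)
      | CAdd ?v ?x ?y =>
          let p := look_va s x in let q := look_va s y in
          rw constr:(@run_add_to v x y s _ _ p q)
      | CSub ?v ?x ?y =>
          let p := look_va s x in let q := look_va s y in
          rw constr:(@run_sub_to v x y s _ _ p q)
      | CLoad ?v ?a ?i =>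
          let p := look_ar s a in let q := look_va s i in
          rw constr:(@run_load_to v a i s _ _ p q)
      | CStore ?a ?i ?v =>
          let p := look_va s i in let q := look_va s v in
          rw constr:(@run_store_to a i v s _ _ p q)
      | CRead ?v => rw constr:(run_read v s)
      | CWrite ?v => let p := look_va s v in rw constr:(@run_write_to v s _ p)
      end
  end.

Ltac st_head s :=
  lazymatch s with
  | setv _ _ _ => idtac | tick _ => idtac | seta _ _ _ _ => idtac | pop _ => idtac
  | emit _ _ => idtac | run _ _ => idtac
  end.

Ltac rewrite_step e :=
  lazymatch type of e with ?x = ?x => fail | _ => rw e end.

Ltac sx_look :=
  match goal with
  | |- context [va ?s ?x] => st_head s; let e := look_va s x in rewrite_step e
  | |- context [ar ?s ?x] => st_head s; let e := look_ar s x in rewrite_step e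
  | |- context [si ?s] =>
      lazymatch s with
      | setv ?s' ?v ?x => rw constr:(si_setv s' v x)
      | tick ?s' => rw constr:(si_tick s')
      | seta ?s' ?a ?k ?x => rw constr:(si_seta s' a k x)
      | pop ?s' => rw constr:(si_pop s')
      | emit ?s' ?x => rw constr:(si_emit s' x)
      | run ?c ?s' => rw constr:(@frame_si c s' isT)
      end
  | |- context [so ?s] =>
      lazymatch s with
      | setv ?s' ?v ?x => rw constr:(so_setv s' v x)
      | tick ?s' => rw constr:(so_tick s')
      | seta ?s' ?a ?k ?x => rw constr:(so_seta s' a k x)
      | pop ?s' => rw constr:(so_pop s')
      | emit ?s' ?x => rw constr:(so_emit s' x)
      | run ?c ?s' => rw constr:(@frame_so c s' isT)
      end
  | |- context [tm ?s] =>
      lazymatch s with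
      | setv ?s' ?v ?x => rw constr:(tm_setv s' v x)
      | tick ?s' => rw constr:(tm_tick s')
      | seta ?s' ?a ?k ?x => rw constr:(tm_seta s' a k x)
      | pop ?s' => rw constr:(tm_pop s')
      | emit ?s' ?x => rw constr:(tm_emit s' x)
      end
  end.

Ltac sx := repeat sx_step; repeat sx_look.

(** The loop rule supplies this relation between the initial and the current store at every turn, so
    that an invariant only has to mention what the loop changes. *)
Definition agree (c : com) (s s1 : store) : Prop :=
  [/\ forall v, v \notin mv c -> va s1 v = va s v,
      forall a, a \notin ma c -> ar s1 a = ar s a,
      ~~ reads c -> si s1 = si s & ~~ writes c -> so s1 = so s].

Lemma for_rule (I : nat -> store -> Prop) n i r c s : va s r = n ->
  I 0 (tick s) ->
  (forall j s1, j < n -> agree (CFor i r c) s s1 -> I j s1 ->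
     I j.+1 (run c (setv (tick s1) i j))) ->
  I n (run (CFor i r c) s).
Proof.
move=> <- I0 IS; change (I (va s r) (forloop i (va s r) (run c) s)).
suff [] : agree (CFor i r c) s (forloop i (va s r) (run c) s) /\
  I (va s r) (forloop i (va s r) (run c) s) by [].
apply: (@forloop_ind (fun j s' => agree (CFor i r c) s s' /\ I j s')); first by split.
move=> j s1 lt_j [A Ij]; split; last exact: IS.
have [A1 A2 A3 A4] := A; split=> [v hv|a ha|hr|hw] /=.
- move: (hv); rewrite inE negb_or => /andP[/negbTE hi hc].
  by rewrite frame_va // !stE hi A1.
- by rewrite frame_ar // !stE A2.
- by rewrite frame_si // !stE A3.
- by rewrite frame_so // !stE A4.
Qed.

Notation "c1 ;; c2" := (CSeq c1 c2) (at level 92, right associativity,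
  format "'[v' c1 ;; '/' c2 ']'").

Lemma upd_at m i j x : upd m i x j = if j == i then x else m j.
Proof. by []. Qed.

Lemma mkseq_upd f q x : mkseq (upd f q x) q.+1 = rcons (mkseq f q) x.
Proof.
rewrite /mkseq -addn1 iotaD map_cat /= add0n -cats1 upd_at eqxx; congr (_ ++ _).
by apply/eq_in_map => i; rewrite mem_iota upd_at => h; rewrite ifF //; lia.
Qed.

Lemma mkseq_upd_ge f q i x : q <= i -> mkseq (upd f i x) q = mkseq f q.
Proof.
move=> le_qi; apply/eq_in_map => j; rewrite mem_iota upd_at => h; rewrite ifF //; lia.
Qed.

Ltac spec frag L H :=
  lazymatch goal with |- context [run frag ?s] => pose proof (L s) as H; cbv zeta in H end.

Arguments va : simpl never.
Arguments ar : simpl never.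
Arguments si : simpl never.
Arguments so : simpl never.
Arguments tm : simpl never.

(** * Elimination order *)

(* [vKK] holds the degeneracy plus one, [vK8] the number of colours, [vT] the number
   of rounds and [vRN] the number of open pairs, which are kept in [aRV] and [aRU];
   [aORD] is the elimination order and [aLE] the input matrix with row starts [aRS]. *)
Notation vN := 0 (only parsing).
Notation vONE := 1 (only parsing).
Notation vZERO := 2 (only parsing).
Notation vNN := 3 (only parsing).
Notation vJ := 4 (only parsing).
Notation vS := 5 (only parsing).
Notation vX := 6 (only parsing).
Notation vY := 7 (only parsing).
Notation vM := 8 (only parsing).
Notation vT := 9 (only parsing).
Notation vKK := 10 (only parsing).
Notation vK8 := 11 (only parsing).
Notation vRN := 12 (only parsing).
Notation vN1 := 13 (only parsing).
Notation aLE := 0 (only parsing).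
Notation aRS := 1 (only parsing).
Notation aDG := 2 (only parsing).
Notation aDD := 3 (only parsing).
Notation aORD := 4 (only parsing).
Notation aDC := 5 (only parsing).
Notation aL0 := 6 (only parsing).
Notation aLR := 7 (only parsing).
Notation aUP := 8 (only parsing).
Notation aUL := 9 (only parsing).
Notation aDN := 10 (only parsing).
Notation aDL := 11 (only parsing).
Notation aF := 12 (only parsing).
Notation aFL := 13 (only parsing).
Notation aRV := 14 (only parsing).
Notation aRU := 15 (only parsing).
Notation aCL := 16 (only parsing).
Notation aNX := 17 (only parsing).
Notation aCF := 18 (only parsing).
Notation aCN := 19 (only parsing).
Notation aCOL := 20 (only parsing).
Notation aMK := 21 (only parsing).
Notation aBUF := 22 (only parsing).

Definition row_starts : com := CFor 20 vN (CStore aRS 20 vNN;; CAdd vNN vNN vN).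
Definition read_matrix : com := CFor 20 vNN (CRead 21;; CStore aLE 20 21).
Definition read_input : com :=
  CConst vONE 1;; CRead vN;; CConst vNN 0;; row_starts;; read_matrix.

Lemma row_startsP s n : va s vN = n -> va s vNN = 0 -> let s' := run row_starts s in
  [/\ va s' vNN = n * n, forall i, i < n -> ar s' aRS i = i * n & tm s' <= tm s + 3 * n + 1].
Proof.
move=> En E0.
pose I j s' := [/\ va s' vNN = j * n, forall i, i < j -> ar s' aRS i = i * n &
  tm s' <= tm s + 3 * j + 1].
apply: (@for_rule I) => //.
  by rewrite /I; sx; rewrite E0; split=> //; lia.
move=> j s2 _ [A _ _ _] [h1 h2 h3].
have A0 : va s2 vN = n by rewrite A.
rewrite /I; sx; split; [lia | | lia].
by move=> i hi; rewrite upd_at; case: eqP => [->//|ne]; apply: h2; lia.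
Qed.

Lemma read_matrixP s m l : va s vNN = m -> si s = l -> let s' := run read_matrix s in
  (forall i, i < m -> ar s' aLE i = nth 0 l i) /\ tm s' <= tm s + 3 * m + 1.
Proof.
move=> Em El.
pose I j s' := [/\ si s' = drop j l, forall i, i < j -> ar s' aLE i = nth 0 l i &
    tm s' <= tm s + 3 * j + 1].
suff [_ h2 h3] : I m (run read_matrix s) by [].
apply: (@for_rule I) => //.
  by rewrite /I; sx; rewrite drop0; split=> //; lia.
move=> j s3 _ _ [h1 h2 h3]; rewrite /I; sx; split; last lia.
  by rewrite h1 -drop1 drop_drop.
move=> i hi; rewrite upd_at h1 -nth0 nth_drop addn0; case: eqP => [->//|ne].
by apply: h2; lia.
Qed.

Lemma read_inputP s n l : si s = n :: l ->
  let s' := run read_input s in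
  [/\ va s' vN = n, va s' vONE = 1, forall i, i < n -> ar s' aRS i = i * n,
      forall i, i < n * n -> ar s' aLE i = nth 0 l i &
      tm s' <= tm s + 3 * (n * n) + 3 * n + 5].
Proof.
move=> sin s'; rewrite /s' /read_input; sx; rewrite sin /=.
set s1 := setv _ vNN 0.
have [H1 H2 H3] : let s' := run row_starts s1 in
  [/\ va s' vNN = n * n, forall i, i < n -> ar s' aRS i = i * n & tm s' <= tm s1 + 3 * n + 1].
  by apply: row_startsP; rewrite /s1; sx.
set s2 := run row_starts s1 in H1 H2 H3 *.
have [|h1 h2] := @read_matrixP s2 (n * n) l H1.
  by rewrite /s2; rewrite /s1; sx; rewrite sin.
move: H3; rewrite /s1; sx => H3.
by split=> //; rewrite ?/s2 ?/s1; sx => //; rewrite -/s1 -/s2; lia.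
Qed.

Section Elimination.

Variables (n : nat) (le : rel nat).

Definition base (s : store) : Prop :=
  [/\ va s vN = n, va s vONE = 1, va s vZERO = 0, forall i, i < n -> ar s aRS i = i * n &
      forall i j, i < n -> j < n -> ar s aLE (i * n + j) = le i j].

Lemma base_ext s s' : base s -> va s' vN = va s vN -> va s' vONE = va s vONE ->
  va s' vZERO = va s vZERO -> ar s' aRS = ar s aRS -> ar s' aLE = ar s aLE -> base s'.
Proof. by move=> [b1 b2 b3 b4 b5] e1 e2 e3 e4 e5; rewrite /base e1 e2 e3 e4 e5. Qed.

Lemma base_agree c s s' : base s -> agree c s s' ->
  all (fun v => v \notin mv c) [:: vN; vONE; vZERO] ->
  all (fun a => a \notin ma c) [:: aRS; aLE] -> base s'.
Proof.
move=> b [A1 A2 _ _] /and4P[h1 h2 h3 _] /and3P[h4 h5 _].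
by apply: base_ext b _ _ _ _ _; rewrite ?A1 ?A2.
Qed.

Definition cmp_rel (x y : nat) : bool := le x y || le y x.

(** When [le] is reflexive, an element still present counts itself, so the value is its residual
    degree plus one; this is why [vKK] holds the degeneracy plus one. *)
Definition residual_degree (os : seq nat) (x : nat) : nat :=
  count (fun y => (y \notin os) && cmp_rel x y) (iota 0 n).

Lemma count_iotaS (p : pred nat) j : count p (iota 0 j.+1) = count p (iota 0 j) + p j.
Proof. by rewrite -addn1 iotaD count_cat; congr (_ + _); exact: addn0. Qed.

Definition cmp_test (t x y : nat) : com :=
  CLoad 40 aRS x;; CAdd 40 40 y;; CLoad 40 aLE 40;;
  CLoad 41 aRS y;; CAdd 41 41 x;; CLoad 41 aLE 41;; CAdd t 40 41.

(** The language has no empty command: a write to a scratch variable, here [CConst 24 0], fills a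
    branch with nothing to do. *)
Definition deg_row : com :=
  CFor 21 vN (cmp_test 22 20 21;; CIf 22 (CAdd 23 23 vONE) (CConst 24 0)).
Definition degrees : com := CFor 20 vN (CConst 23 0;; deg_row;; CStore aDG 20 23).

Lemma deg_rowP s x : base s -> x < n -> va s 20 = x -> va s 23 = 0 ->
  let s' := run deg_row s in
  va s' 23 = count (cmp_rel x) (iota 0 n) /\ tm s' <= tm s + 10 * n + 1.
Proof.
move=> b xn E20 E23.
pose I j s' := va s' 23 = count (cmp_rel x) (iota 0 j) /\ tm s' <= tm s + 10 * j + 1.
apply: (@for_rule I); first by case: b.
  by rewrite /I; sx; rewrite E23; split=> //; lia.
move=> j s2 jn A [h1 h2].
have [b1 b2 b3 b4 b5] := base_agree b A isT isT.
have E : va s2 20 = x by have [A1 _ _ _] := A; rewrite A1.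
rewrite /I /cmp_test; sx; rewrite run_if; sx.
rewrite E !b4 // !b5 // count_iotaS addn_gt0 !lt0b -/(cmp_rel x j).
by case: (cmp_rel x j); sx; rewrite h1 ?b2; split=> //; lia.
Qed.

Lemma degreesP s : base s -> let s' := run degrees s in
  (forall x, x < n -> ar s' aDG x = residual_degree [::] x) /\
  tm s' <= tm s + 10 * (n * n) + 4 * n + 1.
Proof.
move=> b.
pose I j s' := (forall x, x < j -> ar s' aDG x = residual_degree [::] x) /\
  tm s' <= tm s + j * (10 * n + 4) + 1.
suff [h1 h2] : I n (run degrees s) by split=> //; lia.
apply: (@for_rule I); first by case: b.
  by rewrite /I; sx; split=> //; lia.
move=> j s2 jn A [h1 h2]; have b2 := base_agree b A isT isT.
rewrite /I; sx; spec deg_row (fun s => @deg_rowP s j) H.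
move: H; sx; case=> // g1 g2.
split; last lia.
by move=> x xj; rewrite upd_at g1; case: eqP => [->//|ne]; apply: h1; lia.
Qed.

Definition scan_min : com :=
  CFor 21 vN (CLoad 22 aDD 21;; CIf 22 (CConst 24 0)
    (CLoad 22 aDG 21;; CSub 24 25 22;;
     CIf 24 (CAdd 25 22 vZERO;; CAdd 26 21 vZERO) (CConst 24 0))).

Lemma scan_minP s (dead : pred nat) : base s -> va s 25 = n.+1 ->
  (forall x, x < n -> ar s aDD x = dead x) ->
  (forall x, x < n -> ~~ dead x -> ar s aDG x <= n) ->
  (exists2 x, x < n & ~~ dead x) ->
  let s' := run scan_min s in
  [/\ va s' 26 < n, ~~ dead (va s' 26), va s' 25 = ar s aDG (va s' 26),
      forall x, x < n -> ~~ dead x -> va s' 25 <= ar s aDG x & tm s' <= tm s + 8 * n + 1].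
Proof.
move=> b E25 Hd Hn [x0 x0n x0d].
(* The starting value n + 1 exceeds the degree of every element still present, so the first such
   element is always taken. *)
pose I j s' := [/\ (va s' 25 = n.+1 /\ forall x, x < j -> dead x) \/
  [/\ va s' 26 < j, ~~ dead (va s' 26) & va s' 25 = ar s aDG (va s' 26)],
  forall x, x < j -> ~~ dead x -> va s' 25 <= ar s aDG x & tm s' <= tm s + 8 * j + 1].
suff : I n (run scan_min s).
  case=> [[[_ h]|[h1 h2 h3]] h4 h5]; last by split.
  by move: x0d; rewrite h.
apply: (@for_rule I); first by case: b.
  rewrite /I; sx; split; [|by []|lia]; by left; rewrite E25.
move=> j s2 jn A [h1 h2 h3].
have [b1 b2 b3 b4 b5] := base_agree b A isT isT.
have [_ A2 _ _] := A; rewrite /I; sx; rewrite run_if; sx.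
rewrite !A2 // Hd //; case Hdj: (dead j) => /=.
  sx; split; last lia.
    case: h1 => [[e h]|[p1 p2 p3]]; [left|right]; split=> //; last by lia.
    by move=> x; rewrite ltnS leq_eqVlt => /orP[/eqP->|] //; apply: h.
  move=> x; rewrite ltnS leq_eqVlt => /orP[/eqP->|]; last exact: h2.
  by rewrite Hdj.
rewrite run_if; sx; rewrite ?A2 // subn_gt0; case: ifP => cmpj; sx; rewrite ?b3 ?A2 // ?addn0.
  split; last lia.
    by right; split=> //; rewrite Hdj.
  move=> x; rewrite ltnS leq_eqVlt => /orP[/eqP->|] // xj xd.
  by apply: leq_trans (h2 _ xj xd); apply: ltnW.
split; last lia.
  right; case: h1 => [[e h]|[p1 p2 p3]]; last by split=> //; lia.
  have := Hn j jn; rewrite Hdj => /(_ isT) g; move: cmpj; rewrite e; lia.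
move=> x; rewrite ltnS leq_eqVlt => /orP[/eqP->|]; last exact: h2.
by move=> _; rewrite leqNgt cmpj.
Qed.

(** Elements already removed are decremented as well, which does no harm: the invariant of the
    elimination says nothing about their degrees. *)
Definition decrement : com :=
  CFor 21 vN (cmp_test 22 26 21;;
    CIf 22 (CLoad 22 aDG 21;; CSub 22 22 vONE;; CStore aDG 21 22) (CConst 24 0)).

Lemma decrementP s b : base s -> b < n -> va s 26 = b -> let s' := run decrement s in
  (forall x, x < n -> ar s' aDG x = ar s aDG x - cmp_rel b x) /\ tm s' <= tm s + 12 * n + 1.
Proof.
move=> bs bn E26.
pose I j s' := [/\ forall x, x < j -> ar s' aDG x = ar s aDG x - cmp_rel b x,
   forall x, j <= x -> ar s' aDG x = ar s aDG x & tm s' <= tm s + 12 * j + 1].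
suff [] : I n (run decrement s) by [].
apply: (@for_rule I); first by case: bs.
  by rewrite /I; sx; split=> //; lia.
move=> j s2 jn A [h1 h2 h3].
have [b1 b2 b3 b4 b5] := base_agree bs A isT isT.
have E : va s2 26 = b by have [A1 _ _ _] := A; rewrite A1.
rewrite /I /cmp_test; sx; rewrite run_if; sx; rewrite E !b4 // !b5 // addn_gt0 !lt0b -/(cmp_rel b j).
case C: (cmp_rel b j); sx; split; try lia.
- move=> x; rewrite ltnS leq_eqVlt upd_at => /orP[/eqP->|xj].
    by rewrite eqxx b2 h2 // C.
  by rewrite ifF ?h1 //; lia.
- by move=> x jx; rewrite upd_at ifF ?h2 //; lia.
- move=> x; rewrite ltnS leq_eqVlt => /orP[/eqP->|xj]; last exact: h1.
  by rewrite h2 // C subn0.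
- by move=> x jx; rewrite h2 //; lia.
Qed.

End Elimination.

Section EliminationLoop.

Variables (n : nat) (le : rel nat).
Notation base := (base n le).
Notation rd := (residual_degree n le).
Notation cmp := (cmp_rel le).

Lemma cmpC x y : cmp x y = cmp y x.
Proof. by rewrite /cmp_rel orbC. Qed.

Lemma residual_degree_rcons os b x : b < n -> b \notin os ->
  rd os x = rd (rcons os b) x + cmp x b.
Proof.
move=> bn bos; rewrite /residual_degree -!sum1_count (bigID (pred1 b)) /= addnC; congr (_ + _).
  apply: eq_bigl => y; rewrite mem_rcons inE negb_or.
  by case: (y == b); rewrite ?andbT ?andbF.
rewrite (eq_bigl (fun y => (y == b) && cmp x b)); last first.
  by move=> y; case: eqP => [->|]; rewrite ?andbF // bos andbT.
case: (cmp x b); last by rewrite big_pred0 // => y; rewrite andbF.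
rewrite (eq_bigl (pred1 b)) => [|y]; last by rewrite andbT.
by rewrite sum1_count count_uniq_mem ?iota_uniq // mem_iota bn.
Qed.

Lemma residual_degree_le os x : rd os x <= n.
Proof. by rewrite -{2}(size_iota 0 n); apply: count_size. Qed.

Lemma alive_exists os : uniq os -> size os < n -> exists2 x, x < n & x \notin os.
Proof.
move=> uos lt_n; have [/hasP[x]|/hasPn h] := boolP (has (fun x => x \notin os) (iota 0 n)).
  by rewrite mem_iota => xn xos; exists x.
have : size (iota 0 n) <= size os.
  by apply: uniq_leq_size; rewrite ?iota_uniq // => x /h; rewrite negbK.
by rewrite size_iota leqNgt lt_n.
Qed.

(** With truncated subtraction, K + (x - K) is the maximum of K and x; in this way [vKK] accumulates
    the largest of the minimal degrees. *)
Definition elim_loop : com :=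
  CFor 20 vN (CAdd 25 vN vONE;; scan_min;; CStore aDD 26 vONE;; CStore aORD 20 26;;
    CSub 24 25 vKK;; CAdd vKK vKK 24;; decrement).

(** The third clause makes [f] a witness for the upper bound on the degeneracy. The last one gives
    the lower bound: at some stage every element still present has residual degree at least [K]. The
    alternative [K = 0] covers the empty prefix. *)
Definition elimination (f : nat -> nat) (m K : nat) : Prop :=
  [/\ uniq (mkseq f m), forall i, i < m -> f i < n,
      forall i, i < m -> rd (mkseq f i) (f i) <= K &
      K = 0 \/ exists2 i, i < m & forall x, x < n -> x \notin mkseq f i -> K <= rd (mkseq f i) x].

Lemma elim_loopP s : base s -> va s vKK = 0 -> (forall x, x < n -> ar s aDD x = 0) ->
  (forall x, x < n -> ar s aDG x = rd [::] x) ->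
  let s' := run elim_loop s in
  elimination (ar s' aORD) n (va s' vKK) /\ tm s' <= tm s + n * (20 * n + 8) + 1.
Proof.
move=> b EK ED EG.
pose I j s' := let f := ar s' aORD in
  [/\ elimination f j (va s' vKK), forall x, x < n -> ar s' aDD x = (x \in mkseq f j),
    forall x, x < n -> x \notin mkseq f j -> ar s' aDG x = rd (mkseq f j) x &
    tm s' <= tm s + j * (20 * n + 8) + 1].
suff [h1 _ _ h2] : I n (run elim_loop s) by [].
apply: (@for_rule I); first by case: b.
  rewrite /I; sx; split; [by split=> //; left | exact: ED | by move=> x xn _; rewrite EG | lia].
move=> j s2 jn A [[u lt_n leK exK] h2 h3 h4].
have b2 := base_agree b A isT isT; have [b3 b4 b5 _ _] := b2.
rewrite /I; sx; set f := ar s2 aORD in u lt_n leK exK h2 h3 *.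
spec scan_min (fun s => @scan_minP n le s (fun x => x \in mkseq f j)) H.
move: H; sx; case.
- by apply: (base_ext b2); sx.
- by rewrite b3 b4 addn1.
- exact: h2.
- by move=> x xn xos; rewrite h3 //; apply: residual_degree_le.
- by apply: alive_exists; rewrite ?size_mkseq.
set s3 := run scan_min _; set x0 := va s3 26; set best := va s3 25.
move=> x0n x0os Ebest best_min t3.
spec decrement (fun s => @decrementP n le s x0) H.
move: H; sx; rewrite -/s3 -/x0 -/best; case=> //.
  by apply: (base_ext b2); rewrite /s3; sx.
set s4 := run decrement _ => EG4 t4.
have E2 : ar s3 aDG = ar s2 aDG by rewrite /s3; sx.
have best_rd : best = rd (mkseq f j) x0 by rewrite Ebest h3.
have f_lt i : i <= j -> mkseq (upd f j x0) i = mkseq f i by apply: mkseq_upd_ge.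
have f_nth i : i < j -> upd f j x0 i = f i by move=> ij; rewrite upd_at ifF //; lia.
split.
- split.
  + by rewrite mkseq_upd rcons_uniq u x0os.
  + by move=> i; rewrite ltnS leq_eqVlt upd_at => /orP[/eqP->|ij];
      [rewrite eqxx | case: eqP => // _; apply: lt_n].
  + move=> i; rewrite ltnS leq_eqVlt => /orP[/eqP->|ij].
      by rewrite f_lt // upd_at eqxx -best_rd; lia.
    by rewrite f_lt ?f_nth //; [have := leK i ij; lia | apply: ltnW].
  + case: (leqP best (va s2 vKK)) => hb.
      have -> : best - va s2 vKK = 0 by lia.
      rewrite addn0; case: exK => [->|[i ij hi]]; [by left | right].
      by exists i => [|x]; [apply: ltnW | rewrite f_lt; [apply: hi | apply: ltnW]].
    right; exists j => //; rewrite f_lt // => x xn xos.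
    by have := best_min x xn xos; rewrite h3 //; lia.
- move=> x xn; rewrite upd_at mkseq_upd mem_rcons inE b4.
  by case: eqP => //= _; apply: h2.
- move=> x xn; rewrite mkseq_upd mem_rcons inE negb_or => /andP[xx0 xos].
  by rewrite EG4 // E2 h3 // (@residual_degree_rcons _ x0) // (cmpC x) addnK.
- by move: t3 t4; rewrite ?b3 ?b4; lia.
Qed.

End EliminationLoop.

(** * Preprocessing *)

Section Lists.

Variables (n : nat) (lep : rel nat).
Notation cmp := (cmp_rel lep).

(* [lep] is the order relation on positions of the elimination order. *)
Definition pbase (s : store) : Prop :=
  [/\ va s vN = n, va s vONE = 1, va s vZERO = 0 &
      forall i j, i < n -> j < n ->
        ar s aLE (ar s aRS (ar s aORD i) + ar s aORD j) = lep i j].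

Lemma pbase_ext s s' : pbase s -> va s' vN = va s vN -> va s' vONE = va s vONE ->
  va s' vZERO = va s vZERO -> ar s' aRS = ar s aRS -> ar s' aLE = ar s aLE ->
  ar s' aORD = ar s aORD -> pbase s'.
Proof. by move=> [b1 b2 b3 b4] e1 e2 e3 e4 e5 e6; rewrite /pbase e1 e2 e3 e4 e5 e6. Qed.

Lemma pbase_run c s : pbase s ->
  all (fun v => v \notin mv c) [:: vN; vONE; vZERO] ->
  all (fun a => a \notin ma c) [:: aRS; aLE; aORD] -> pbase (run c s).
Proof.
move=> b /and4P[h1 h2 h3 _] /and4P[h4 h5 h6 _].
by apply: (pbase_ext b); rewrite ?frame_va ?frame_ar.
Qed.

Lemma pbase_agree c s s' : pbase s -> agree c s s' ->
  all (fun v => v \notin mv c) [:: vN; vONE; vZERO] ->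
  all (fun a => a \notin ma c) [:: aRS; aLE; aORD] -> pbase s'.
Proof.
move=> b [A1 A2 _ _] /and4P[h1 h2 h3 _] /and4P[h4 h5 h6 _].
by apply: (pbase_ext b); rewrite ?A1 ?A2.
Qed.

Definition leq_test (t x y : nat) : com :=
  CLoad 40 aORD x;; CLoad 40 aRS 40;; CLoad 41 aORD y;; CAdd 40 40 41;; CLoad t aLE 40.

Definition down_count (y : nat) : nat := count (fun x => lep x y) (iota 0 n).

Definition down_count_row : com := CFor 21 vN (leq_test 22 21 20;; CAdd 23 23 22).
Definition down_counts : com := CFor 20 vN (CConst 23 0;; down_count_row;; CStore aDC 20 23).

Lemma down_count_rowP s y : pbase s -> y < n -> va s 20 = y -> va s 23 = 0 ->
  let s' := run down_count_row s in
  va s' 23 = down_count y /\ tm s' <= tm s + 7 * n + 1.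
Proof.
move=> b yn E20 E23.
pose I j s' := va s' 23 = count (fun x => lep x y) (iota 0 j) /\ tm s' <= tm s + 7 * j + 1.
apply: (@for_rule I); first by case: b.
  by rewrite /I; sx; rewrite E23; split=> //; lia.
move=> j s2 jn A [h1 h2].
have [b1 b2 b3 b4] := pbase_agree b A isT isT.
have E : va s2 20 = y by have [A1 _ _ _] := A; rewrite A1.
rewrite /I /leq_test; sx; rewrite E b4 // count_iotaS h1; split=> //; lia.
Qed.

Lemma down_countsP s : pbase s -> let s' := run down_counts s in
  (forall y, y < n -> ar s' aDC y = down_count y) /\ tm s' <= tm s + n * (7 * n + 4) + 1.
Proof.
move=> b.
pose I j s' := (forall x, x < j -> ar s' aDC x = down_count x) /\
  tm s' <= tm s + j * (7 * n + 4) + 1.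
apply: (@for_rule I); first by case: b.
  by rewrite /I; sx; split=> //; lia.
move=> j s2 jn A [h1 h2]; have b2 := pbase_agree b A isT isT.
rewrite /I; sx; spec down_count_row (fun s => @down_count_rowP s j) H.
move: H; sx; case=> // g1 g2.
split; last lia.
by move=> x xj; rewrite upd_at g1; case: eqP => [->//|ne]; apply: h1; lia.
Qed.

(** A counting sort by the size of the down-set. For a partial order [lep], a smaller element has a
    smaller down-set, so this is a linear extension; all emitted orders are derived from it. *)
Definition by_down_count : seq nat :=
  flatten [seq [seq y <- iota 0 n | down_count y == h] | h <- iota 0 n.+1].

(** Equality is tested by adding the two truncated differences: the sum vanishes exactly when the
    numbers agree. The same test recurs for colours. *)
Definition sort_row : com :=
  CFor 21 vN (CLoad 22 aDC 21;; CSub 24 22 20;; CSub 22 20 22;; CAdd 22 22 24;;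
    CIf 22 (CConst 24 0) (CStore aL0 23 21;; CAdd 23 23 vONE)).
Definition sort_loop : com := CFor 20 25 sort_row.

Lemma filter_iotaS (p : pred nat) j :
  [seq x <- iota 0 j.+1 | p x] = [seq x <- iota 0 j | p x] ++ (if p j then [:: j] else [::]).
Proof. by rewrite -addn1 iotaD filter_cat. Qed.

Lemma sort_rowP s h l : pbase s -> va s 20 = h ->
  (forall y, y < n -> ar s aDC y = down_count y) -> mkseq (ar s aL0) (va s 23) = l ->
  let s' := run sort_row s in
  mkseq (ar s' aL0) (va s' 23) = l ++ [seq y <- iota 0 n | down_count y == h] /\
  tm s' <= tm s + 8 * n + 1.
Proof.
move=> b E20 Edc El.
pose I j s' := mkseq (ar s' aL0) (va s' 23) = l ++ [seq y <- iota 0 j | down_count y == h] /\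
  tm s' <= tm s + 8 * j + 1.
apply: (@for_rule I); first by case: b.
  by rewrite /I; sx; rewrite El cats0; split=> //; lia.
move=> j s2 jn A [h1 h2].
have [b1 b2 b3 b4] := pbase_agree b A isT isT.
have [A1 A2 _ _] := A.
have E : va s2 20 = h by rewrite A1.
have Ed : ar s2 aDC j = down_count j by rewrite A2 // Edc.
rewrite /I; sx; rewrite run_if; sx; rewrite E Ed filter_iotaS.
case: eqP => [e|ne].
  rewrite e subnn addn0 ltnn; sx; rewrite b2 addn1 mkseq_upd h1 cats1 -rcons_cat; split=> //; lia.
have -> : 0 < h - down_count j + (down_count j - h) by lia.
by sx; rewrite h1 cats0; split=> //; lia.
Qed.

Lemma sort_loopP s : pbase s -> va s 23 = 0 -> va s 25 = n.+1 ->
  (forall y, y < n -> ar s aDC y = down_count y) ->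
  let s' := run sort_loop s in
  mkseq (ar s' aL0) (va s' 23) = by_down_count /\ tm s' <= tm s + n.+1 * (8 * n + 2) + 1.
Proof.
move=> b E23 E25 Edc.
pose I j s' := mkseq (ar s' aL0) (va s' 23) =
  flatten [seq [seq y <- iota 0 n | down_count y == h] | h <- iota 0 j] /\
  tm s' <= tm s + j * (8 * n + 2) + 1.
apply: (@for_rule I); first by [].
  by rewrite /I; sx; rewrite E23; split=> //; lia.
move=> j s2 jn A [h1 h2]; have b2 := pbase_agree b A isT isT.
have [_ A2 _ _] := A.
rewrite /I; sx; spec sort_row (fun s => @sort_rowP s j) H.
have [||-> h3] := H _ _ erefl _ h1.
- by apply: (pbase_ext b2).
- by move=> y yn; sx; rewrite A2 // Edc.
split; last by move: h3; sx; lia.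
by rewrite -addn1 iotaD map_cat flatten_cat /= cats0.
Qed.

Definition reverse_loop : com :=
  CFor 20 vN (CSub 22 25 20;; CLoad 22 aL0 22;; CStore aLR 20 22).

Lemma reverse_loopP s : pbase s -> va s 25 = n.-1 ->
  let s' := run reverse_loop s in
  mkseq (ar s' aLR) n = rev (mkseq (ar s aL0) n) /\ tm s' <= tm s + 4 * n + 1.
Proof.
move=> b E25.
pose I j s' := (forall i, i < j -> ar s' aLR i = ar s aL0 (n.-1 - i)) /\
  tm s' <= tm s + 4 * j + 1.
suff [h1 h2] : I n (run reverse_loop s).
  split=> //; apply: (@eq_from_nth _ 0); first by rewrite size_rev !size_mkseq.
  move=> i; rewrite size_mkseq => hi.
  rewrite nth_mkseq // nth_rev size_mkseq // nth_mkseq ?h1 //; last lia.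
  by congr (ar s _ _); lia.
apply: (@for_rule I); first by case: b.
  by rewrite /I; sx; split=> //; lia.
move=> j s2 jn A [h1 h2]; have [A1 A2 _ _] := A.
rewrite /I; sx; split; last lia.
by move=> i hi; rewrite upd_at A1 // A2 // E25; case: eqP => [->//|ne]; apply: h1; lia.
Qed.

(* The list attached to [x] is stored in the cells congruent to [x] modulo [n]. *)
Definition column (m : nat -> nat) (x len : nat) : seq nat := mkseq (fun i => m (x + n * i)) len.

Lemma column_push m x q y : 0 < n ->
  column (upd m (x + n * q) y) x q.+1 = rcons (column m x q) y.
Proof.
move=> n0; rewrite -(mkseq_upd (fun i => m (x + n * i))); apply: eq_map => i.
by rewrite /upd eqn_add2l eqn_pmul2l.
Qed.

Lemma column_cell_inj x y q i : x < n -> y < n -> x + n * q = y + n * i -> x = y.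
Proof.
move=> xn yn /(congr1 (fun t => t %% n)).
by rewrite ![_ + n * _]addnC ![n * _]mulnC !modnMDl !modn_small.
Qed.

Lemma column_other m x y q z len : x < n -> y < n -> x != y ->
  column (upd m (x + n * q) z) y len = column m y len.
Proof.
move=> xn yn /eqP ne; apply: eq_map => i; rewrite upd_at; case: eqP => // e.
by case: ne; rewrite (column_cell_inj yn xn e).
Qed.

(** The kinds 0, 1 and 2 collect up-sets, down-sets and later comparable positions. For kind 2 the
    value is lep x y + lep y x - 2 (x - y) in truncated arithmetic: for x > y at least 2 is
    subtracted and 0 remains. *)
Definition lists_test (k : nat) : com :=
  match k with
  | 0 => leq_test 22 20 26
  | 1 => leq_test 22 26 20
  | _ => leq_test 22 20 26;; leq_test 27 26 20;; CAdd 22 22 27;; CSub 27 20 26;;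
         CAdd 27 27 27;; CSub 22 22 27
  end.

Definition lists_rel (k x y : nat) : bool :=
  match k with 0 => lep x y | 1 => lep y x | _ => (x <= y) && cmp x y end.

(** Up-sets are kept in the reversed base order because the orders that use them are produced from
    the top downwards. *)
Definition lists_src (k : nat) : nat := match k with 0 => aLR | 1 => aL0 | _ => aL0 end.
Definition lists_dst (k : nat) : nat := match k with 0 => aUP | 1 => aDN | _ => aF end.
Definition lists_len (k : nat) : nat := match k with 0 => aUL | 1 => aDL | _ => aFL end.

Definition list_row (k : nat) : com :=
  CFor 21 vN (CLoad 26 (lists_src k) 21;; lists_test k;;
    CIf 22 (CStore (lists_dst k) 25 26;; CAdd 25 25 vN;; CAdd 23 23 vONE) (CConst 24 0)).
Definition lists_loop (k : nat) : com :=
  CFor 20 vN (CConst 23 0;; CAdd 25 20 vZERO;; list_row k;; CStore (lists_len k) 20 23).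

Lemma lists_testP k s x y : pbase s -> x < n -> y < n -> va s 20 = x -> va s 26 = y ->
  let s' := run (lists_test k) s in
  [/\ (0 < va s' 22) = lists_rel k x y, ar s' = ar s,
      forall v, v \in [:: vN; vONE; vZERO; 20; 21; 23; 25; 26] -> va s' v = va s v &
      tm s' <= tm s + 14].
Proof.
move=> [b1 b2 b3 b4] xn yn E20 E26.
case: k => [|[|k]]; rewrite /lists_test /leq_test /=; split.
- by sx; rewrite E20 E26 b4 // lt0b.
- by sx.
- by move=> v; rewrite !inE; do 7 (case/orP=> [/eqP->|]; first by sx); move/eqP->; sx.
- by sx; lia.
- by sx; rewrite E20 E26 b4 // lt0b.
- by sx.
- by move=> v; rewrite !inE; do 7 (case/orP=> [/eqP->|]; first by sx); move/eqP->; sx.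
- by sx; lia.
- sx; rewrite E20 E26 !b4 // /cmp_rel; case: (leqP x y) => h /=.
    have -> : x - y = 0 by lia.
    by rewrite !subn0 addn_gt0 !lt0b.
  by case: (lep x y); case: (lep y x); lia.
- by sx.
- by move=> v; rewrite !inE; do 7 (case/orP=> [/eqP->|]; first by sx); move/eqP->; sx.
- by sx; lia.
Qed.

Lemma list_rowP k s x L : pbase s -> x < n -> va s 20 = x -> va s 23 = 0 ->
  va s 25 = x -> mkseq (ar s (lists_src k)) n = L -> all (gtn n) L ->
  let s' := run (list_row k) s in
  [/\ column (ar s' (lists_dst k)) x (va s' 23) = [seq y <- L | lists_rel k x y],
    forall z, z < n -> x != z -> forall l, column (ar s' (lists_dst k)) z l =
                                       column (ar s (lists_dst k)) z l &
    tm s' <= tm s + 20 * n + 1].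
Proof.
move=> b xn E20 E23 E25 EL ltL.
pose I j s' := [/\ pbase s' /\ va s' 20 = x, ar s' (lists_src k) = ar s (lists_src k),
  va s' 25 = x + n * va s' 23 /\ column (ar s' (lists_dst k)) x (va s' 23) =
    [seq y <- mkseq (ar s (lists_src k)) j | lists_rel k x y],
  forall z, z < n -> x != z -> forall l, column (ar s' (lists_dst k)) z l =
                                       column (ar s (lists_dst k)) z l &
  tm s' <= tm s + 20 * j + 1].
suff [_ _ [_ h1] h2 h3] : I n (run (list_row k) s) by rewrite -EL.
have srcn j : j < n -> ar s (lists_src k) j < n.
  by move=> jn; apply: (allP ltL); rewrite -EL; apply: map_f; rewrite mem_iota.
have n0 : 0 < n by apply: leq_ltn_trans xn.
have src_dst : (lists_src k == lists_dst k) = false by case: (k) => [|[|]].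
have dst_base a : a \in [:: aRS; aLE; aORD] -> (a == lists_dst k) = false.
  by rewrite !inE => /or3P[] /eqP->; case: (k) => [|[|]].
apply: (@for_rule I); first by case: b.
  rewrite /I; sx; rewrite E23 E25 muln0 addn0; split=> //; last lia.
move=> j s2 jn _ [[b2 E] Es [h1 h2] h3 h4].
have yn := srcn j jn; have [b3 b4 b5 b6] := b2.
rewrite run_seq; sx; rewrite Es.
set s3 := setv _ 26 _.
have [|||||t1 t2 t3 t4] := @lists_testP k s3 x (ar s (lists_src k) j); rewrite /s3; sx => //.
move: t1 t2 t3 t4; rewrite -/s3; set s4 := run (lists_test k) s3; rewrite /s3 => t1 t2 t3; sx => t4.
have e0 := t3 vN isT; have e1 := t3 vONE isT; have e2 := t3 vZERO isT.
have e20 := t3 20 isT; have e23 := t3 23 isT; have e25 := t3 25 isT; have e26 := t3 26 isT.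
move: t2 e0 e1 e2 e20 e23 e25 e26; sx => t2 e0 e1 e2 e20 e23 e25 e26.
rewrite run_if t1 /I.
have -> : mkseq (ar s (lists_src k)) j.+1 = rcons (mkseq (ar s (lists_src k)) j) (ar s (lists_src k) j).
  by rewrite /mkseq -addn1 iotaD map_cat cats1.
rewrite filter_rcons; case: (lists_rel k x _).
  sx; rewrite !ar_seta eqxx src_dst e23 e25 e0 e1 e20 e26 t2 b3 b4 addn1 h1; split=> //.
  - split=> //; apply: (pbase_ext b2); sx; rewrite ?e0 ?e1 ?e2 ?ar_seta ?dst_base ?t2 //.
  - by split; [lia | rewrite column_push // h2].
  - by move=> z zn xz l; rewrite column_other //; apply: h3.
  - lia.
sx; rewrite e23 e25 e20 t2; split=> //; last lia.
by split=> //; apply: (pbase_ext b2); sx; rewrite ?e0 ?e1 ?e2 ?t2.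
Qed.

Lemma lists_loopP k s L : pbase s -> mkseq (ar s (lists_src k)) n = L -> all (gtn n) L ->
  let s' := run (lists_loop k) s in
  (forall x, x < n -> column (ar s' (lists_dst k)) x (ar s' (lists_len k) x) =
                    [seq y <- L | lists_rel k x y]) /\
  tm s' <= tm s + n * (20 * n + 5) + 1.
Proof.
move=> b EL ltL.
pose I j s' := [/\ pbase s', mkseq (ar s' (lists_src k)) n = L,
  forall x, x < j -> column (ar s' (lists_dst k)) x (ar s' (lists_len k) x) =
                    [seq y <- L | lists_rel k x y] &
  tm s' <= tm s + j * (20 * n + 5) + 1].
suff [] : I n (run (lists_loop k) s) by [].
apply: (@for_rule I); first by case: b.
  by rewrite /I; split=> //; sx; lia.
move=> j s2 jn A [b2 h1 h2 h3]; have [b3 b4 b5 b6] := b2.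
rewrite run_seq; sx; rewrite b5 addn0.
set s3 := setv _ 25 _.
have [|||||||g1 g2 g3] := @list_rowP k s3 j L; rewrite /s3; sx => //.
move: g1 g2 g3; rewrite -/s3.
have base3 : pbase (run (list_row k) s3).
  by apply: pbase_run; [apply: (pbase_ext b2) | | ]; case: (k) => [|[|]].
have E20 : va (run (list_row k) s3) 20 = j by rewrite frame_va //; case: (k) => [|[|]].
have [Esrc Elen] : ar (run (list_row k) s3) (lists_src k) = ar s2 (lists_src k) /\
    ar (run (list_row k) s3) (lists_len k) = ar s2 (lists_len k).
  by split; rewrite frame_ar //; case: (k) => [|[|]].
set s4 := run (list_row k) s3 in base3 E20 Esrc Elen *; rewrite /s3; sx => g1 g2 g3.
have ne a : a \in [:: aRS; aLE; aORD; lists_src k; lists_dst k] -> (a == lists_len k) = false.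
  by rewrite !inE => /or4P[/eqP->|/eqP->|/eqP->|/orP[/eqP->|/eqP->]]; case: (k) => [|[|]].
rewrite /I; sx; rewrite !ar_seta eqxx !ne ?inE ?eqxx ?orbT // ?ar_tick E20 Esrc; split=> //; last lia.
- by apply: (pbase_ext base3); sx; rewrite ?ar_seta ?ne.
- move=> x xj; rewrite upd_at; case: eqP => [->//|/eqP nx].
  by rewrite Elen g2 1?eq_sym //; [apply: h2; lia | lia].
Qed.

End Lists.

(** * Colouring rounds *)

Section Pairs.

Variables (n : nat) (lep : rel nat).
Notation cmp := (cmp_rel lep).
Notation pbase := (pbase n lep).

Definition pair_list (s : store) (m : nat) : seq (nat * nat) :=
  mkseq (fun i => (ar s aRV i, ar s aRU i)) m.

Definition open_pair (v u : nat) : bool := (v < u) && ~~ cmp v u.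
Definition open_pairs_from (v m : nat) : seq (nat * nat) :=
  [seq (v, u) | u <- [seq u <- iota 0 m | open_pair v u]].
Definition open_pairs : seq (nat * nat) := flatten [seq open_pairs_from v n | v <- iota 0 n].

Lemma mkseq_pair_upd (f g : nat -> nat) q x y :
  mkseq (fun i => (upd f q x i, upd g q y i)) q.+1 = rcons (mkseq (fun i => (f i, g i)) q) (x, y).
Proof.
rewrite /mkseq -addn1 iotaD map_cat /= add0n -cats1 !upd_at eqxx; congr (_ ++ _).
by apply/eq_in_map => i; rewrite mem_iota !upd_at => h; rewrite !ifF //; lia.
Qed.

Definition pairs_row : com :=
  CFor 21 vN (leq_test 22 20 21;; leq_test 27 21 20;; CAdd 22 22 27;;
    CIf 22 (CConst 24 0) (CSub 27 21 20;;
      CIf 27 (CStore aRV vRN 20;; CStore aRU vRN 21;; CAdd vRN vRN vONE) (CConst 24 0))).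
Definition pairs_loop : com := CFor 20 vN pairs_row.

Lemma pairs_rowP s v l : pbase s -> v < n -> va s 20 = v -> pair_list s (va s vRN) = l ->
  let s' := run pairs_row s in
  pair_list s' (va s' vRN) = l ++ open_pairs_from v n /\ tm s' <= tm s + 18 * n + 1.
Proof.
move=> b vn E20 El.
pose I j s' := pair_list s' (va s' vRN) = l ++ open_pairs_from v j /\ tm s' <= tm s + 18 * j + 1.
apply: (@for_rule I); first by case: b.
  by rewrite /I /pair_list; sx; rewrite -El cats0; split=> //; lia.
move=> j s2 jn A [h1 h2].
have [b1 b2 b3 b4] := pbase_agree b A isT isT.
have [A1 A2 _ _] := A.
have E : va s2 20 = v by rewrite A1.
rewrite /I /leq_test; sx; rewrite run_if; sx; rewrite E !b4 // addn_gt0 !lt0b -/(cmp v j).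
have -> : open_pairs_from v j.+1 =
    open_pairs_from v j ++ (if open_pair v j then [:: (v, j)] else [::]).
  by rewrite /open_pairs_from filter_iotaS map_cat; case: (open_pair v j).
rewrite /open_pair /pair_list; case: (cmp v j); rewrite ?andbF ?andbT.
  by sx; rewrite cats0; split=> //; lia.
rewrite run_if; sx; rewrite subn_gt0; case: ifP => _.
  by sx; rewrite E b2 addn1 mkseq_pair_upd -/(pair_list _ _) h1 cats1 -rcons_cat; split=> //; lia.
by sx; rewrite cats0; split=> //; lia.
Qed.

Lemma pairs_loopP s : pbase s -> va s vRN = 0 -> let s' := run pairs_loop s in
  pair_list s' (va s' vRN) = open_pairs /\ tm s' <= tm s + n * (18 * n + 2) + 1.
Proof.
move=> b E0.
pose I j s' := pair_list s' (va s' vRN) = flatten [seq open_pairs_from v n | v <- iota 0 j] /\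
  tm s' <= tm s + j * (18 * n + 2) + 1.
apply: (@for_rule I); first by case: b.
  by rewrite /I /pair_list; sx; rewrite E0; split=> //; lia.
move=> j s2 jn A [h1 h2]; have b2 := pbase_agree b A isT isT.
rewrite /I; sx; spec pairs_row (fun s => @pairs_rowP s j) H.
have [-> h3] := H _ b2 jn erefl h1.
split; last by move: h3; sx; lia.
by rewrite -addn1 iotaD map_cat flatten_cat /= cats0.
Qed.

End Pairs.

Section Rounds.

Variables (n : nat) (lep : rel nat) (l0 : seq nat) (ord : nat -> nat) (K8 : nat).
Notation cmp := (cmp_rel lep).

(** The set F(v) + {v} as a list: for reflexive [lep] the position [v] itself belongs to it, hence
    the length bound k + 1 rather than k. *)
Definition fwd (v : nat) : seq nat := [seq w <- l0 | lists_rel lep 2 v w].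

Definition static (s : store) : Prop :=
  [/\ [/\ va s vN = n, va s vONE = 1, va s vZERO = 0, va s vN1 = n.-1 & va s vK8 = K8],
      forall k x, x < n -> column n (ar s (lists_dst k)) x (ar s (lists_len k) x) =
        [seq y <- if k == 0 then rev l0 else l0 | lists_rel lep k x y],
      mkseq (ar s aL0) n = l0, mkseq (ar s aLR) n = rev l0 &
      forall i, i < n -> ar s aORD i = ord i].

Definition static_vars := [:: vN; vONE; vZERO; vN1; vK8].
Definition static_arrays := [:: aUP; aUL; aDN; aDL; aF; aFL; aL0; aLR; aORD].

Lemma static_ext s s' : static s -> (forall v, v \in static_vars -> va s' v = va s v) ->
  (forall a, a \in static_arrays -> ar s' a = ar s a) -> static s'.
Proof.
move=> [[b1 b2 b3 b4 b5] h1 h2 h3 h4] ev ea; split.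
- by rewrite !ev.
- by move=> k x xn; rewrite -h1 // !ea //; case: k => [|[|k]].
- by rewrite ea.
- by rewrite ea.
- by move=> i /h4 <-; rewrite ea.
Qed.

Definition static_ok (c : com) : bool :=
  all (fun v => v \notin mv c) static_vars && all (fun a => a \notin ma c) static_arrays.

Lemma static_run c s : static_ok c -> static s -> static (run c s).
Proof.
case/andP=> /allP hv /allP ha b; apply: (static_ext b) => [v /hv|a /ha].
  exact: frame_va.
exact: frame_ar.
Qed.

Lemma static_agree c s s' : static s -> agree c s s' -> static_ok c -> static s'.
Proof.
move=> b [A1 A2 _ _] /andP[/allP hv /allP ha].
by apply: (static_ext b) => [v /hv|a /ha]; [exact: A1 | exact: A2].
Qed.

Lemma static_fwd s v : static s -> v < n -> column n (ar s aF) v (ar s aFL v) = fwd v.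
Proof. by move=> [_ h _ _ _] vn; rewrite (h 2 v vn). Qed.

Definition conflict_list (E : seq (nat * nat)) (x : nat) : seq nat :=
  [seq e.2 | e <- E & e.1 == x].

Definition conflict_state (s : store) (E : seq (nat * nat)) : Prop := forall x, x < n ->
  column n (ar s aCF) x (ar s aCL x) = conflict_list E x /\ ar s aNX x = x + n * ar s aCL x.

Definition clear_conflicts : com := CFor 20 vN (CStore aCL 20 vZERO;; CStore aNX 20 20).

Lemma clear_conflictsP s : static s -> let s' := run clear_conflicts s in
  conflict_state s' [::] /\ tm s' <= tm s + 3 * n + 1.
Proof.
move=> b; pose I j s' := (forall x, x < j -> ar s' aCL x = 0 /\ ar s' aNX x = x) /\
  tm s' <= tm s + 3 * j + 1.
suff [h1 h2] : I n (run clear_conflicts s).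
  by split=> // x xn; have [-> ->] := h1 x xn; rewrite muln0 addn0.
apply: (@for_rule I); first by case: b => -[].
  by rewrite /I; sx; split=> //; lia.
move=> j s2 jn A [h1 h2]; have [[_ _ E0 _ _] _ _ _ _] := static_agree b A isT.
rewrite /I; sx; split; last lia.
by move=> x xj; rewrite !upd_at E0; case: eqP => [->//|ne]; apply: h1; lia.
Qed.

(** A conflict is recorded at its later end: when positions are coloured in increasing order, the
    colour at the earlier end is then already final. *)
Definition edge (u w : nat) : nat * nat := (maxn u w, minn u w).
Definition edges (p : nat * nat) : seq (nat * nat) := [seq edge p.2 w | w <- fwd p.1].

Definition push_conflict : com :=
  CLoad 22 aNX 23;; CStore aCF 22 24;; CAdd 22 22 vN;; CStore aNX 23 22;;
  CLoad 22 aCL 23;; CAdd 22 22 vONE;; CStore aCL 23 22.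

Lemma push_conflictP s E : static s -> conflict_state s E -> va s 23 < n ->
  conflict_state (run push_conflict s) (rcons E (va s 23, va s 24)) /\
  tm (run push_conflict s) = tm s + 7.
Proof.
move=> [[b1 b2 _ _ _] _ _ _ _] cs hn; rewrite /push_conflict; split; last by sx; lia.
move=> x xn; have [h1 h2] := cs _ hn; have [g1 g2] := cs _ xn.
sx; rewrite b1 b2 h2 !upd_at /conflict_list filter_rcons /=.
case: (x =P va s 23) => [e|ne].
  rewrite e eqxx map_rcons addn1 column_push ?h1; last by apply: leq_ltn_trans hn.
  by split=> //; lia.
rewrite ifF; last by apply/eqP => e; case: ne.
by rewrite column_other //; apply/eqP => e; case: ne.
Qed.

Definition conflict_pair : com :=
  CFor 21 30 (CLoad 26 aF 25;; CAdd 25 25 vN;; CSub 22 28 26;;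
    CIf 22 (CAdd 23 28 vZERO;; CAdd 24 26 vZERO) (CAdd 23 26 vZERO;; CAdd 24 28 vZERO);;
    push_conflict).

Lemma conflict_pairP s v u E : static s -> all (gtn n) l0 -> conflict_state s E ->
  v < n -> u < n -> va s 28 = u -> va s 25 = v -> va s 30 = ar s aFL v ->
  let s' := run conflict_pair s in
  conflict_state s' (E ++ edges (v, u)) /\ tm s' <= tm s + 15 * size (fwd v) + 1.
Proof.
move=> b ltL cs vn un E28 E25 E30.
have Ef := static_fwd b vn; have sz : size (fwd v) = ar s aFL v by rewrite -Ef size_mkseq.
pose I j s' := [/\ va s' 25 = v + n * j,
  conflict_state s' (E ++ [seq edge u w | w <- take j (fwd v)]) & tm s' <= tm s + 15 * j + 1].
suff [_] : I (size (fwd v)) (run conflict_pair s) by rewrite take_size.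
apply: (@for_rule I); first by rewrite E30.
  by rewrite /I; sx; rewrite E25 take0 cats0 muln0 addn0; split=> //; lia.
move=> j s2 jn A [h1 h2 h3].
have b2 := static_agree b A isT; have [[b3 b4 b5 _ _] _ _ _ _] := b2.
have [A1 A2 _ _] := A.
have Ew : ar s2 aF (v + n * j) = nth 0 (fwd v) j.
  by rewrite A2 // -Ef nth_mkseq // -sz.
set w := nth 0 (fwd v) j in Ew.
have wn : w < n.
  have : w \in fwd v by apply: mem_nth.
  by rewrite mem_filter => /andP[_ /(allP ltL)].
rewrite /I (take_nth 0) // map_rcons -rcons_cat -/w; sx; rewrite run_if; sx.
have -> : va s2 28 = u by rewrite A1.
rewrite h1 Ew b3 subn_gt0.
have [lt_wu|le_uw] := ltnP w u; set s3 := setv _ 24 _.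
  have [|||h4 h5] := @push_conflictP s3 (E ++ [seq edge u w | w <- take j (fwd v)]).
  - by apply: (static_ext b2) => a; rewrite !inE; do ?(case/orP=> [/eqP->|] //); move/eqP->.
  - exact: h2.
  - by rewrite /s3; sx; rewrite b5 addn0.
  move: h4 h5; rewrite /s3; sx => h4 h5; rewrite h5; split; [lia| |lia].
  by move: h4; rewrite b5 !addn0 /edge (maxn_idPl _) 1?ltnW // (minn_idPr _) // ltnW.
have [|||h4 h5] := @push_conflictP s3 (E ++ [seq edge u w | w <- take j (fwd v)]).
- by apply: (static_ext b2) => a; rewrite !inE; do ?(case/orP=> [/eqP->|] //); move/eqP->.
- exact: h2.
- by rewrite /s3; sx; rewrite b5 addn0.
move: h4 h5; rewrite /s3; sx => h4 h5; rewrite h5; split; [lia| |lia].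
by move: h4; rewrite b5 !addn0 /edge (maxn_idPr _) // (minn_idPl _).
Qed.

Definition conflict_loop : com :=
  CFor 20 vRN (CLoad 27 aRV 20;; CLoad 28 aRU 20;; CLoad 30 aFL 27;; CAdd 25 27 vZERO;;
    conflict_pair).

Definition all_edges (R : seq (nat * nat)) : seq (nat * nat) := flatten [seq edges p | p <- R].

Lemma conflict_loopP s R d : static s -> all (gtn n) l0 -> conflict_state s [::] ->
  pair_list s (va s vRN) = R -> (forall p, p \in R -> p.1 < n /\ p.2 < n) ->
  (forall v, v < n -> size (fwd v) <= d) ->
  let s' := run conflict_loop s in
  conflict_state s' (all_edges R) /\ tm s' <= tm s + size R * (15 * d + 6) + 1.
Proof.
move=> b ltL cs ER ltR led.
pose I j s' := conflict_state s' (all_edges (take j R)) /\ tm s' <= tm s + j * (15 * d + 6) + 1.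
have szR : size R = va s vRN by rewrite -ER size_mkseq.
suff [] : I (size R) (run conflict_loop s) by rewrite take_size.
apply: (@for_rule I); first by [].
  by rewrite /I; sx; rewrite take0; split=> //; lia.
move=> j s2 jR A [h1 h2].
have b2 := static_agree b A isT; have [[b3 b4 b5 _ _] _ _ _ _] := b2.
have [A1 A2 _ _] := A.
have Ep : (ar s2 aRV j, ar s2 aRU j) = nth (0, 0) R j by rewrite !A2 // -ER nth_mkseq // -szR.
have [p1n p2n] := ltR _ (mem_nth (0, 0) jR); rewrite -Ep /= in p1n p2n.
rewrite /I (take_nth (0, 0)) // -Ep /all_edges map_rcons flatten_rcons -/(all_edges _).
sx; rewrite b5 addn0.
spec conflict_pair (fun s => @conflict_pairP s (ar s2 aRV j) (ar s2 aRU j) (all_edges (take j R))) H.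
have [h3 h4] := H b2 ltL h1 p1n p2n erefl erefl erefl.
split=> //; move: h4; sx; have := led _ p1n; nia.
Qed.

Definition clear_counts : com := CFor 21 vK8 (CStore aCN 21 vZERO).

Lemma clear_countsP s : static s -> let s' := run clear_counts s in
  (forall c, c < K8 -> ar s' aCN c = 0) /\ tm s' <= tm s + 2 * K8 + 1.
Proof.
move=> b; pose I j s' := (forall x, x < j -> ar s' aCN x = 0) /\ tm s' <= tm s + 2 * j + 1.
suff [h1 h2] : I K8 (run clear_counts s) by [].
apply: (@for_rule I); first by case: b => -[].
  by rewrite /I; sx; split=> //; lia.
move=> j s2 jn A [h1 h2]; have [[_ _ E0 _ _] _ _ _ _] := static_agree b A isT.
rewrite /I; sx; split; last lia.
by move=> x xj; rewrite !upd_at E0; case: eqP => // ne; apply: h1; lia.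
Qed.

Definition count_colors : com :=
  CFor 21 30 (CLoad 22 aCF 25;; CAdd 25 25 vN;; CLoad 22 aCOL 22;; CLoad 24 aCN 22;;
    CAdd 24 24 vONE;; CStore aCN 22 24).

Lemma count_colorsP s x l : static s -> va s 25 = x ->
  column n (ar s aCF) x (va s 30) = l -> (forall c, c < K8 -> ar s aCN c = 0) ->
  let s' := run count_colors s in
  (forall c, c < K8 -> ar s' aCN c = count (fun y => ar s aCOL y == c) l) /\
  tm s' <= tm s + 7 * size l + 1.
Proof.
move=> b E25 El Ecn.
have szl : size l = va s 30 by rewrite -El size_mkseq.
pose I j s' := [/\ va s' 25 = x + n * j,
  forall c, c < K8 -> ar s' aCN c = count (fun y => ar s aCOL y == c) (take j l) &
  tm s' <= tm s + 7 * j + 1].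
suff [_] : I (size l) (run count_colors s) by rewrite take_size.
apply: (@for_rule I); first by [].
  by rewrite /I; sx; rewrite E25 take0 muln0 addn0; split=> //; lia.
move=> j s2 jl A [h1 h2 h3].
have [[b3 b4 b5 _ _] _ _ _ _] := static_agree b A isT.
have [A1 A2 _ _] := A.
have Ey : ar s2 aCF (x + n * j) = nth 0 l j by rewrite A2 // -El nth_mkseq // -szl.
have Ecol : ar s2 aCOL = ar s aCOL by rewrite A2.
rewrite /I (take_nth 0) //; sx; rewrite h1 Ey b3 b4 Ecol; split; [lia| |lia].
move=> c cK; rewrite upd_at -cats1 count_cat -h2 // /count /= addn0 [_ == c]eq_sym.
by case: eqP => [<-|] //; rewrite addn0.
Qed.

Definition best_color : com :=
  CFor 21 vK8 (CLoad 22 aCN 21;; CSub 26 24 22;;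
    CIf 26 (CAdd 24 22 vZERO;; CAdd 23 21 vZERO) (CConst 27 0)).

Lemma best_colorP s : static s -> 0 < K8 -> va s 23 = 0 -> va s 24 = ar s aCN 0 ->
  let s' := run best_color s in
  [/\ va s' 23 < K8, forall c, c < K8 -> ar s aCN (va s' 23) <= ar s aCN c &
      tm s' <= tm s + 6 * K8 + 1].
Proof.
move=> b K0 E23 E24.
pose I j s' := [/\ va s' 23 < K8, va s' 24 = ar s aCN (va s' 23),
  forall c, c < j -> va s' 24 <= ar s aCN c & tm s' <= tm s + 6 * j + 1].
suff [h1 e h2 h3] : I K8 (run best_color s) by split=> // c cK; rewrite -e; apply: h2.
apply: (@for_rule I); first by case: b => -[].
  by rewrite /I; sx; rewrite E23; split=> //; lia.
move=> j s2 jK A [h1 h2 h3 h4].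
have [[b3 b4 b5 _ _] _ _ _ _] := static_agree b A isT.
have [A1 A2 _ _] := A; have Ecn : ar s2 aCN = ar s aCN by rewrite A2.
rewrite /I; sx; rewrite run_if; sx; rewrite Ecn subn_gt0; case: ifP => hc; sx.
  rewrite b5 !addn0; split=> //; last lia.
  move=> c; rewrite ltnS leq_eqVlt => /orP[/eqP->|/h3] //.
  by apply: leq_trans; apply: ltnW.
split=> //; last lia.
move=> c; rewrite ltnS leq_eqVlt => /orP[/eqP->|/h3] //.
by rewrite leqNgt hc.
Qed.

Definition color_loop : com :=
  CFor 20 vN (clear_counts;; CLoad 30 aCL 20;; CAdd 25 20 vZERO;; count_colors;;
    CConst 23 0;; CLoad 24 aCN 23;; best_color;; CStore aCOL 20 23).

Definition greedy (E : seq (nat * nat)) (col : nat -> nat) (m : nat) : Prop :=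
  forall x, x < m -> col x < K8 /\ forall c, c < K8 ->
    count (fun y => col y == col x) (conflict_list E x) <=
    count (fun y => col y == c) (conflict_list E x).

Lemma color_loopP s E : static s -> 0 < K8 -> conflict_state s E ->
  (forall e, e \in E -> e.2 < e.1) ->
  let s' := run color_loop s in
  greedy E (ar s' aCOL) n /\
  tm s' <= tm s + n * (8 * K8 + 9) + 7 * \sum_(0 <= x < n) size (conflict_list E x) + 1.
Proof.
move=> b K0 cs ltE.
pose I j s' := greedy E (ar s' aCOL) j /\
  tm s' <= tm s + j * (8 * K8 + 9) + 7 * \sum_(0 <= x < j) size (conflict_list E x) + 1.
suff [] : I n (run color_loop s) by [].
apply: (@for_rule I); first by case: b => -[].
  by rewrite /I; sx; split=> //; lia.
move=> j s2 jn A [h1 h2].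
have b2 := static_agree b A isT; have [[b3 b4 b5 _ _] _ _ _ _] := b2.
have [A1 A2 _ _] := A; have [cj _] := cs _ jn.
rewrite /I big_nat_recr //=; sx; rewrite b5 addn0.
spec clear_counts (fun s => @clear_countsP s) H; have [g1 g2] := H b2; move: g2; sx => g2.
have b6 : static (run clear_counts (setv (tick s2) 20 j)).
  by apply: static_run; [| exact: b2].
spec count_colors (fun s => @count_colorsP s j (conflict_list E j)) H1.
have [|g3 g4] := H1 b6 erefl _ g1; first by sx; rewrite A2 // A2.
move: g3 g4; sx => g3 g4.
set s3 := run count_colors _ in g3 g4 *.
have b7 : static s3 by apply: static_run; [| exact: b6].
spec best_color (fun s => @best_colorP s) H2.
have [g5 g6 g7] := H2 b7 K0 erefl erefl.
move: g5 g6 g7; sx; set s4 := run best_color _ => g5 g6 g7.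
split; last by move: g7 g4 g2; lia.
(* Conflicts recorded at [x] point to positions below [x], so giving a colour to [j >= x] changes no
   count at [x]. *)
have upd_count x c : x <= j ->
    count (fun y => upd (ar s2 aCOL) j (va s4 23) y == c) (conflict_list E x) =
    count (fun y => ar s2 aCOL y == c) (conflict_list E x).
  move=> xj; apply: eq_in_count => y /mapP[e]; rewrite mem_filter => /andP[/eqP e1 /ltE e2] ->.
  rewrite upd_at ifF //; apply/eqP => e3; move: e2; rewrite e3 e1.
  by rewrite ltnNge xj.
move=> x; rewrite ltnS leq_eqVlt => /orP[/eqP->|xj].
  rewrite upd_at eqxx; split=> // c cK; rewrite !upd_count //.
  by have := g6 c cK; rewrite !g3.
rewrite [upd _ _ _ x]upd_at ifF; last lia.
have [k1 k2] := h1 x xj; split=> // c cK.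
by rewrite !upd_count ?(ltnW xj) //; apply: k2.
Qed.

Definition bad_pair (col : nat -> nat) (p : nat * nat) : bool :=
  has (fun w => col w == col p.2) (fwd p.1).

Definition bad_test : com :=
  CFor 21 30 (CLoad 26 aF 25;; CAdd 25 25 vN;; CLoad 26 aCOL 26;; CSub 22 26 29;;
    CSub 26 29 26;; CAdd 22 22 26;; CIf 22 (CConst 24 0) (CConst 23 1)).

Lemma bad_testP s v u : static s -> v < n -> va s 25 = v -> va s 30 = ar s aFL v ->
  va s 29 = ar s aCOL u -> va s 23 = 0 ->
  let s' := run bad_test s in
  va s' 23 = bad_pair (ar s aCOL) (v, u) /\ tm s' <= tm s + 9 * size (fwd v) + 1.
Proof.
move=> b vn E25 E30 E29 E23.
have Ef := static_fwd b vn; have sz : size (fwd v) = ar s aFL v by rewrite -Ef size_mkseq.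
pose I j s' := [/\ va s' 25 = v + n * j,
  va s' 23 = has (fun w => ar s aCOL w == ar s aCOL u) (take j (fwd v)) &
  tm s' <= tm s + 9 * j + 1].
suff [_] : I (size (fwd v)) (run bad_test s) by rewrite take_size.
apply: (@for_rule I); first by rewrite E30.
  by rewrite /I; sx; rewrite E25 take0 E23 muln0 addn0; split=> //; lia.
move=> j s2 jn A [h1 h2 h3].
have [[b3 b4 b5 _ _] _ _ _ _] := static_agree b A isT.
have [A1 A2 _ _] := A.
have Ew : ar s2 aF (v + n * j) = nth 0 (fwd v) j by rewrite A2 // -Ef nth_mkseq // -sz.
have Ecol : ar s2 aCOL = ar s aCOL by rewrite A2.
have E29' : va s2 29 = ar s aCOL u by rewrite A1.
rewrite /I (take_nth 0) // -cats1 has_cat; sx; rewrite run_if; sx.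
rewrite h1 Ew Ecol E29' b3 /= orbF.
case: eqP => [->|ne].
  by rewrite subnn addn0 ltnn; sx; rewrite orbT; split=> //; lia.
rewrite ifT; last lia.
by sx; rewrite ?h1 ?h2 ?b3 ?orbF; split=> //; lia.
Qed.

Definition filter_body : com :=
  CLoad 27 aRV 20;; CLoad 28 aRU 20;; CLoad 30 aFL 27;; CAdd 25 27 vZERO;; CLoad 29 aCOL 28;;
  CConst 23 0;; bad_test;;
  CIf 23 (CStore aRV 31 27;; CStore aRU 31 28;; CAdd 31 31 vONE) (CConst 24 0).
Definition filter_loop : com := CFor 20 vRN filter_body.

Lemma filter_loopP s R d : static s -> va s 31 = 0 ->
  pair_list s (va s vRN) = R -> (forall p, p \in R -> p.1 < n /\ p.2 < n) ->
  (forall v, v < n -> size (fwd v) <= d) ->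
  let s' := run filter_loop s in
  pair_list s' (va s' 31) = [seq p <- R | bad_pair (ar s aCOL) p] /\
  tm s' <= tm s + size R * (9 * d + 13) + 1.
Proof.
move=> b E31 ER ltR led.
(* The list is compacted in place. The write index 31 never passes the read index, so the pairs not
   yet read are still the original ones. *)
pose I j s' := [/\ pair_list s' (va s' 31) = [seq p <- take j R | bad_pair (ar s aCOL) p],
   va s' 31 <= j, forall i, j <= i -> ar s' aRV i = ar s aRV i /\ ar s' aRU i = ar s aRU i &
   tm s' <= tm s + j * (9 * d + 13) + 1].
have szR : size R = va s vRN by rewrite -ER size_mkseq.
suff [h1 _ _ h2] : I (size R) (run filter_loop s) by rewrite take_size in h1.
apply: (@for_rule I); first by [].
  by rewrite /I /pair_list; sx; rewrite E31 take0; split=> //; lia.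
move=> j s2 jR A [h1 h2 h3 h4].
have b2 := static_agree b A isT; have [[b3 b4 b5 _ _] _ _ _ _] := b2.
have [A1 A2 _ _] := A; have [hv hu] := h3 j (leqnn j).
have Ep : (ar s2 aRV j, ar s2 aRU j) = nth (0, 0) R j by rewrite hv hu -ER nth_mkseq // -szR.
have [p1n p2n] := ltR _ (mem_nth (0, 0) jR); rewrite -Ep /= in p1n p2n.
rewrite /I (take_nth (0, 0)) // -Ep filter_rcons /filter_body; sx; rewrite b5 addn0.
spec bad_test (fun s => @bad_testP s (ar s2 aRV j) (ar s2 aRU j)) H.
have [g1 g2] := H b2 p1n erefl erefl erefl erefl.
move: g1 g2; sx => g1 g2.
have Ecol : ar s2 aCOL = ar s aCOL by rewrite A2.
rewrite run_if g1 lt0b Ecol.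
have := led _ p1n => hd.
have hm : (9 * size (fwd (ar s2 aRV j)) <= 9 * d) by rewrite leq_mul2l hd.
case: (bad_pair _ _); rewrite /pair_list; sx.
  rewrite b4 addn1 mkseq_pair_upd -/(pair_list s2 _) h1; split; [by [] | lia | | ].
    by move=> i ji; rewrite !upd_at !ifF; [apply: h3; lia | lia | lia].
  by move: g2 h4 hm; rewrite Ecol; lia.
split; [exact: h1 | lia | | ].
  by move=> i ji; apply: h3; lia.
by move: g2 h4 hm; rewrite Ecol; lia.
Qed.

End Rounds.

(** * Writing out the two orders of a colour class *)

Definition undup_first (T : eqType) (l : seq T) : seq T := rev (undup (rev l)).

(** First occurrences survive here, whereas [undup] keeps the last ones; this is what a pass with a
    marking array produces. *)
Lemma undup_first_rcons (T : eqType) (l : seq T) x :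
  undup_first (rcons l x) = if x \in l then undup_first l else rcons (undup_first l) x.
Proof. by rewrite /undup_first rev_rcons /= mem_rev; case: ifP => // _; rewrite rev_cons. Qed.

Section Emission.

Variables (n : nat) (lep : rel nat) (l0 : seq nat) (ord : nat -> nat) (K8 : nat).
Notation static := (static n lep l0 ord K8).

Definition visited (s : store) (l : seq nat) : Prop :=
  (forall y, y < n -> ar s aMK y = (y \in l)) /\ mkseq (ar s aBUF) (va s 23) = undup_first l.

Definition visit : com :=
  CLoad 22 aMK 26;; CIf 22 (CConst 24 0)
    (CStore aMK 26 vONE;; CStore aBUF 23 26;; CAdd 23 23 vONE).

Lemma visitP s l : static s -> visited s l -> va s 26 < n ->
  visited (run visit s) (rcons l (va s 26)) /\ tm (run visit s) <= tm s + 5.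
Proof.
move=> [[b1 b2 _ _ _] _ _ _ _] [h1 h2] yn; rewrite /visit /visited; sx.
rewrite run_if; sx; rewrite h1 // lt0b undup_first_rcons.
case hy: (va s 26 \in l); sx.
  split; [split=> // z zn | lia].
  by rewrite h1 // mem_rcons inE; case: eqP => // ->; rewrite hy.
split; [split=> [z zn|] | lia].
  by rewrite upd_at b2 mem_rcons inE h1 //; case: eqP.
by rewrite b2 addn1 mkseq_upd h2.
Qed.

Definition clear_marks : com := CFor 20 vN (CStore aMK 20 vZERO).

Lemma clear_marksP s : static s -> va s 23 = 0 -> let s' := run clear_marks s in
  visited s' [::] /\ tm s' <= tm s + 2 * n + 1.
Proof.
move=> b E23; pose I j s' := (forall x, x < j -> ar s' aMK x = 0) /\ tm s' <= tm s + 2 * j + 1.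
suff [h1 h2] : I n (run clear_marks s).
  by split=> //; split=> [y /h1|] //; sx; rewrite E23.
apply: (@for_rule I); first by case: b => -[].
  by rewrite /I; sx; split=> //; lia.
move=> j s2 jn A [h1 h2]; have [[_ _ E0 _ _] _ _ _ _] := static_agree b A isT.
rewrite /I; sx; split; last lia.
by move=> x xj; rewrite !upd_at E0; case: eqP => // ne; apply: h1; lia.
Qed.

Definition src (k : nat) : seq nat := if k == 0 then rev l0 else l0.
Definition related_list (k x : nat) : seq nat := [seq y <- src k | lists_rel lep k x y].

Lemma all_src k (p : pred nat) : all p l0 -> all p (src k).
Proof. by rewrite /src; case: ifP => // _; rewrite all_rev. Qed.

Lemma all_related k x (p : pred nat) : all p l0 -> all p (related_list k x).
Proof. by move=> /(all_src k) /allP h; apply/allP => y; rewrite mem_filter => /andP[_ /h]. Qed.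

Definition visit_list (k : nat) : com :=
  CFor 21 30 (CLoad 26 (lists_dst k) 25;; CAdd 25 25 vN;; visit).

Lemma visit_listP k s x l : static s -> all (gtn n) l0 -> x < n -> visited s l ->
  va s 25 = x -> va s 30 = ar s (lists_len k) x ->
  let s' := run (visit_list k) s in
  visited s' (l ++ related_list k x) /\ tm s' <= tm s + 8 * size (related_list k x) + 1.
Proof.
move=> b ltL xn vs E25 E30.
have Ef : column n (ar s (lists_dst k)) x (ar s (lists_len k) x) = related_list k x.
  by have [_ h _ _ _] := b; rewrite h.
have sz : size (related_list k x) = ar s (lists_len k) x by rewrite -Ef size_mkseq.
pose I j s' := [/\ va s' 25 = x + n * j, visited s' (l ++ take j (related_list k x)) &
  tm s' <= tm s + 8 * j + 1].
suff [_] : I (size (related_list k x)) (run (visit_list k) s) by rewrite take_size.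
apply: (@for_rule I); first by rewrite E30.
  by rewrite /I; sx; rewrite E25 take0 cats0 muln0 addn0; split=> //; lia.
move=> j s2 jn A [h1 h2 h3].
have b2 := static_agree b A isT; have [[b3 b4 b5 _ _] _ _ _ _] := b2.
have [A1 A2 _ _] := A.
have Ew : ar s2 (lists_dst k) (x + n * j) = nth 0 (related_list k x) j.
  by rewrite A2 ?inE; [rewrite -Ef nth_mkseq // -sz | case: (k) => [|[|]]].
have wn : nth 0 (related_list k x) j < n.
  exact: (allP (all_related k x ltL) _ (mem_nth 0 jn)).
rewrite /I (take_nth 0) // -rcons_cat; do 4 sx_step; rewrite h1 Ew b3.
set s3 := setv _ 25 _.
have [|||h4 h5] := @visitP s3 (l ++ take j (related_list k x)).
- exact: b2.
- exact: h2.
- exact: wn.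
move: h5; rewrite {2}/s3; sx => h5.
split; [by rewrite /s3; sx; lia | exact: h4 | by move: h5; lia].
Qed.

Definition lists_of_class (k : nat) (col : nat -> nat) (c : nat) (xs : seq nat) : seq nat :=
  flatten [seq related_list k x | x <- xs & col x == c].

Definition descending (j : nat) : seq nat := [seq n.-1 - i | i <- iota 0 j].

Definition visit_class_body (k : nat) : com :=
  CSub 25 vN1 20;; CLoad 22 aCOL 25;; CSub 24 22 33;; CSub 22 33 22;; CAdd 22 22 24;;
  CIf 22 (CConst 24 0) (CLoad 30 (lists_len k) 25;; visit_list k).
Definition visit_class (k : nat) : com := CFor 20 vN (visit_class_body k).

Lemma visit_classP k s c : static s -> all (gtn n) l0 -> va s 33 = c -> visited s [::] ->
  let s' := run (visit_class k) s in
  visited s' (lists_of_class k (ar s aCOL) c (descending n)) /\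
  tm s' <= tm s + 9 * n + 8 * size (lists_of_class k (ar s aCOL) c (descending n)) + 1.
Proof.
move=> b ltL E33 vs.
pose I j s' := visited s' (lists_of_class k (ar s aCOL) c (descending j)) /\
  tm s' <= tm s + 9 * j + 8 * size (lists_of_class k (ar s aCOL) c (descending j)) + 1.
apply: (@for_rule I); first by case: b => -[].
  by rewrite /I; sx; split=> //; lia.
move=> j s2 jn A [h1 h2].
have b2 := static_agree b A isT; have [[b3 b4 b5 b6 _] _ _ _ _] := b2.
have [A1 A2 _ _] := A.
have E : va s2 33 = c by rewrite A1.
have Ecol : ar s2 aCOL = ar s aCOL by rewrite A2.
rewrite /I; have -> : lists_of_class k (ar s aCOL) c (descending j.+1) =
    lists_of_class k (ar s aCOL) c (descending j) ++
    (if ar s aCOL (n.-1 - j) == c then related_list k (n.-1 - j) else [::]).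
  rewrite /lists_of_class /descending -[j.+1]addn1 iotaD map_cat filter_cat map_cat flatten_cat /= add0n.
  by case: ifP => _ //=; rewrite cats0.
rewrite /visit_class_body; sx; rewrite run_if; sx; rewrite b6 E Ecol size_cat.
case: eqP => [->|ne].
  rewrite subnn addn0 ltnn.
  set s3 := setv _ 30 _.
  have [||||h3 h4] := @visit_listP k s3 (n.-1 - j) _ _ ltL _ h1.
  - exact: b2.
  - lia.
  - by rewrite /s3; sx.
  - by rewrite /s3; sx.
  split; first exact: h3.
  by move: h4; rewrite /s3; sx; lia.
rewrite ifT; last lia.
sx; rewrite cats0; split; [exact: h1 | rewrite /=; lia].
Qed.

Definition visit_rest (k : nat) : com := CFor 21 vN (CLoad 26 (lists_src k) 21;; visit).

Lemma visit_restP k s l : k < 2 -> static s -> all (gtn n) l0 -> visited s l ->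
  let s' := run (visit_rest k) s in
  visited s' (l ++ src k) /\ tm s' <= tm s + 7 * n + 1.
Proof.
move=> k2 b ltL vs.
have Esrc : mkseq (ar s (lists_src k)) n = src k.
  by have [_ _ e1 e2 _] := b; case: k k2 => [|[|]].
have szs : size (src k) = n by rewrite -Esrc size_mkseq.
pose I j s' := visited s' (l ++ take j (src k)) /\ tm s' <= tm s + 7 * j + 1.
suff : I n (run (visit_rest k) s) by rewrite /I take_oversize // szs.
apply: (@for_rule I); first by case: b => -[].
  by rewrite /I; sx; rewrite take0 cats0; split=> //; lia.
move=> j s2 jn A [h1 h2].
have b2 := static_agree b A isT; have [[b3 b4 b5 _ _] _ _ _ _] := b2.
have [A1 A2 _ _] := A.
have Ew : ar s2 (lists_src k) j = nth 0 (src k) j.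
  by rewrite A2 ?inE; [rewrite -Esrc nth_mkseq | case: (k) => [|[|]]].
have wn : nth 0 (src k) j < n.
  by apply: (allP (all_src k ltL)); apply: mem_nth; rewrite szs.
rewrite /I (take_nth 0) ?szs // -rcons_cat; do 2 sx_step; rewrite Ew.
set s3 := setv _ 26 _.
have [|||h4 h5] := @visitP s3 (l ++ take j (src k)).
- exact: b2.
- exact: h1.
- exact: wn.
by move: h5; rewrite {2}/s3; sx => h5; split; [exact: h4 | lia].
Qed.

Definition output_list (k : nat) : com :=
  CFor 20 vN ((if k == 0 then CSub 25 vN1 20 else CAdd 25 20 vZERO);; CLoad 26 aBUF 25;;
    CLoad 26 aORD 26;; CWrite 26).

Lemma output_listP k s : static s -> all (gtn n) (mkseq (ar s aBUF) n) ->
  let s' := run (output_list k) s in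
  so s' = so s ++ [seq ord y | y <- if k == 0 then rev (mkseq (ar s aBUF) n)
                                    else mkseq (ar s aBUF) n] /\
  tm s' <= tm s + 5 * n + 1.
Proof.
move=> b ltB; set l := if _ then _ else _.
have szl : size l = n by rewrite /l; case: ifP => _; rewrite ?size_rev size_mkseq.
have ltl : all (gtn n) l.
  by rewrite /l; case: ifP => // _; apply/allP => y; rewrite mem_rev => /(allP ltB).
pose I j s' := so s' = so s ++ [seq ord y | y <- take j l] /\ tm s' <= tm s + 5 * j + 1.
suff : I n (run (output_list k) s) by rewrite /I take_oversize // szl.
apply: (@for_rule I); first by case: b => -[].
  by rewrite /I; sx; rewrite take0 cats0; split=> //; lia.
move=> j s2 jn A [h1 h2].
have b2 : static s2 by move: A; rewrite /output_list; case: (k == 0) => A; apply: (static_agree b A).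
have [[b3 b4 b5 b6 _] _ _ _ h4] := b2.
have EB : ar s2 aBUF = ar s aBUF.
  by move: A => [_ A2 _ _]; rewrite A2 //; case: (k == 0).
have En : nth 0 l j = ar s aBUF (if k == 0 then n.-1 - j else j).
  rewrite /l; case: ifP => _; last by rewrite nth_mkseq.
  rewrite nth_rev size_mkseq // nth_mkseq; last lia.
  by congr (ar s _ _); lia.
have ln : nth 0 l j < n by apply: (allP ltl); apply: mem_nth; rewrite szl.
rewrite /I (take_nth 0) ?szl // map_rcons -rcons_cat -h1; move: En.
case: (k == 0) => En; sx; rewrite ?b5 ?b6 EB ?addn0 -En h4 //; split=> //; lia.
Qed.

Definition emit_order (k : nat) : com :=
  CConst 23 0;; clear_marks;; visit_class k;; visit_rest k;; output_list k.

(** Read from the top, the result of successive raisings shows the up-set of the last raised member,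
    then what is new in the up-set of the member before it, and so on, and finally the rest.
    Visiting the lists backwards and keeping first visits therefore replaces the raisings, at the
    cost of the total length of the lists plus O(n). For [k = 1] the dual order is treated in the
    same way and is read from the bottom. *)
Definition visit_order (k : nat) (col : nat -> nat) (c : nat) : seq nat :=
  lists_of_class k col c (descending n) ++ src k.

Definition emitted (k : nat) (col : nat -> nat) (c : nat) : seq nat :=
  if k == 0 then rev (undup_first (visit_order k col c)) else undup_first (visit_order k col c).

Lemma perm_undup_visit k col c : perm_eq l0 (iota 0 n) ->
  perm_eq (undup_first (visit_order k col c)) (iota 0 n).
Proof.
move=> pL; apply: uniq_perm; rewrite ?iota_uniq ?rev_uniq ?undup_uniq // => y.
rewrite /undup_first mem_rev mem_undup mem_rev mem_cat -(perm_mem pL).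
have -> : (y \in src k) = (y \in l0) by rewrite /src; case: ifP; rewrite ?mem_rev.
case: (boolP (y \in l0)) => [|yl]; rewrite ?orbT // orbF.
apply/flattenP => -[l /mapP[x _ ->]]; rewrite mem_filter => /andP[_].
by rewrite /src; case: ifP; rewrite ?mem_rev (negbTE yl).
Qed.

Lemma emit_orderP k s c : k < 2 -> static s -> perm_eq l0 (iota 0 n) -> va s 33 = c ->
  let s' := run (emit_order k) s in
  so s' = so s ++ [seq ord y | y <- emitted k (ar s aCOL) c] /\
  tm s' <= tm s + 23 * n + 8 * size (lists_of_class k (ar s aCOL) c (descending n)) + 5.
Proof.
move=> k2 b pL E33.
have ltL : all (gtn n) l0.
  by apply/allP => y; rewrite (perm_mem pL) mem_iota add0n.
rewrite /emit_order; do 2 sx_step.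
have [g1 g2] := @clear_marksP (setv (tick s) 23 0) b erefl.
move: g1 g2; set s1 := run clear_marks _ => g1 g2.
have b1 : static s1 by apply: static_run.
sx_step.
have [|g3 g4] := @visit_classP k s1 c b1 ltL _ g1; first by rewrite /s1; sx.
move: g3 g4; have -> : ar s1 aCOL = ar s aCOL by rewrite /s1; sx.
set s2 := run (visit_class k) s1 => g3 g4.
have b2 : static s2 by apply: static_run.
sx_step.
have [g5 g6] := @visit_restP k s2 _ k2 b2 ltL g3.
move: g5 g6; set s3 := run (visit_rest k) s2 => g5 g6.
have b3 : static s3 by apply: static_run.
have [_ EB] := g5; rewrite -/(visit_order k (ar s aCOL) c) in EB.
have pV := perm_undup_visit k (ar s aCOL) c pL.
have E23 : va s3 23 = n by rewrite -(size_iota 0 n) -(perm_size pV) -EB size_mkseq.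
rewrite E23 in EB.
have [|g7 g8] := @output_listP k s3 b3.
  by rewrite EB; apply/allP => y; rewrite (perm_mem pV) mem_iota add0n.
move: g7 g8; rewrite EB -/(emitted k (ar s aCOL) c) => -> g8; split.
  by congr (_ ++ _); rewrite /s3 /s2 /s1; sx.
by move: g2 g4 g6 g8; sx; rewrite -/s1 -/s2 -/s3; lia.
Qed.

End Emission.

(** * Decrease of the number of open pairs in a round *)

Section Shrinking.

Variables (n : nat) (lep : rel nat) (l0 : seq nat) (K : nat).
Notation fwd := (fwd lep l0).

Lemma sum_indicator (K' c : nat) : \sum_(0 <= i < K') (c == i) <= 1.
Proof.
elim: K' => [|K' IH]; first by rewrite big_nil.
rewrite big_nat_recr //=; case: eqP => [e|_]; last by rewrite addn0.
rewrite big_nat_cond big1 // => i /andP[/andP[_ hi] _].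
by rewrite e; case: eqP => // e'; move: hi; rewrite e' ltnn.
Qed.

Lemma sum_count_color (f : nat -> nat) (l : seq nat) :
  \sum_(0 <= c < K) count (fun y => f y == c) l <= size l.
Proof.
elim: l => [|y l IH]; first by rewrite big1.
rewrite (eq_bigr (fun c => (f y == c) + count (fun y => f y == c) l)) //.
by rewrite big_split /= -add1n leq_add // sum_indicator.
Qed.

Lemma sum_conflict (a : nat -> pred nat) (E : seq (nat * nat)) :
  (forall e, e \in E -> e.1 < n) ->
  \sum_(0 <= x < n) count (a x) (conflict_list E x) = count (fun e => a e.1 e.2) E.
Proof.
elim: E => [|e E IH] ltE; first by rewrite big1.
rewrite /= -IH; last by move=> e' he; apply: ltE; rewrite inE he orbT.
have en : e.1 < n by apply: ltE; rewrite mem_head.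
rewrite (eq_bigr (fun x => (if x == e.1 then a e.1 e.2 : nat else 0) +
    count (a x) (conflict_list E x))); last first.
  move=> x _; rewrite /conflict_list /= [x == _]eq_sym.
  by case: eqP => [->|] //=.
rewrite big_split /=; congr (_ + _).
by rewrite -big_mkcond big_mkord (big_pred1 (Ordinal en)).
Qed.

(** At each position the least of the [K] colour counts is at most their average, and the counts add
    up to at most the number of conflicts recorded there. *)
Lemma greedy_monochromatic (E : seq (nat * nat)) (col : nat -> nat) :
  (forall e, e \in E -> e.1 < n) -> greedy K E col n ->
  count (fun e => col e.2 == col e.1) E * K <= size E.
Proof.
move=> ltE gr.
rewrite -(sum_conflict (fun x y => col y == col x)) // -[size E]count_predT.
rewrite -(@sum_conflict (fun _ => predT) E) // big_distrl /=.
rewrite big_nat_cond [X in _ <= X]big_nat_cond; apply: leq_sum => x /andP[/andP[_ xn] _].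
rewrite count_predT; apply: leq_trans (sum_count_color col _).
have [_ h] := gr x xn.
rewrite mulnC -{1}[K]subn0 -sum_nat_const_nat big_nat_cond [X in _ <= X]big_nat_cond.
by apply: leq_sum => c /andP[/andP[_ cK] _]; apply: h.
Qed.

(** Edges are listed pair by pair and with repetitions, so each bad pair has a monochromatic edge of
    its own. *)
Lemma size_bad_pairs (R : seq (nat * nat)) (col : nat -> nat) :
  size [seq p <- R | bad_pair lep l0 col p] <=
  count (fun e => col e.2 == col e.1) (all_edges lep l0 R).
Proof.
rewrite size_filter /all_edges; elim: R => //= p R IH.
rewrite count_cat leq_add // /edges count_map; case: (boolP (bad_pair _ _ _ _)) => //.
rewrite /bad_pair has_count => h; apply: leq_trans h _; apply: sub_count => w /= /eqP e.
by rewrite /edge /=; case: (leqP p.2 w) => _; rewrite ?e.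
Qed.

Lemma size_all_edges (R : seq (nat * nat)) d :
  (forall p, p \in R -> size (fwd p.1) <= d) -> size (all_edges lep l0 R) <= size R * d.
Proof.
elim: R => // p R IH h; rewrite /all_edges /= size_cat size_map mulSn leq_add ?h ?mem_head //.
by apply: IH => q hq; apply: h; rewrite inE hq orbT.
Qed.

(** Keeping [p.2] out of the list of [p.1] excludes loops, so that every edge has an earlier and a
    later end. *)
Definition valid_pairs (R : seq (nat * nat)) : Prop :=
  forall p, p \in R -> [/\ p.1 < n, p.2 < n & p.2 \notin fwd p.1].

Lemma all_edges_lt R e : all (gtn n) l0 -> valid_pairs R -> e \in all_edges lep l0 R ->
  e.2 < e.1 /\ e.1 < n.
Proof.
move=> /allP ltL vR /flattenP[_ /mapP[p /vR[p1 p2 p3] ->] /mapP[w hw ->]].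
have wn : w < n by move: hw; rewrite mem_filter => /andP[_ /ltL].
have ne : p.2 != w by apply: contraNneq p3 => ->.
by move: ne; rewrite /edge /=; case: (ltngtP p.2 w).
Qed.

(** With B bad pairs, 4 d B <= K B is at most the number of edges, which is at most d |R|; then d
    cancels. *)
Lemma greedy_shrinks R col d : all (gtn n) l0 -> valid_pairs R -> 0 < d -> 4 * d <= K ->
  (forall v, v < n -> size (fwd v) <= d) -> greedy K (all_edges lep l0 R) col n ->
  4 * size [seq p <- R | bad_pair lep l0 col p] <= size R.
Proof.
move=> ltL vR d0 dK led gr.
have h1 := size_bad_pairs R col.
have h2 : size (all_edges lep l0 R) <= size R * d.
  by apply: size_all_edges => p /vR[p1 _ _]; apply: led.
have h3 : count (fun e => col e.2 == col e.1) (all_edges lep l0 R) * K <=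
    size (all_edges lep l0 R).
  by apply: greedy_monochromatic gr => e /(all_edges_lt ltL vR)[].
rewrite -(leq_pmul2r d0); apply: leq_trans h2; apply: leq_trans h3.
by rewrite mulnAC mulnC leq_mul.
Qed.

End Shrinking.

(** * Iterated rounds and their total cost *)

Section RoundsLoop.

Variables (n : nat) (lep : rel nat) (l0 : seq nat) (ord : nat -> nat) (K8 d D : nat).
Notation static := (static n lep l0 ord K8).
Notation bad := (bad_pair lep l0).
Notation fwd := (fwd lep l0).
Notation emitted := (emitted n lep l0).
Notation class_lists := (lists_of_class lep l0).

Definition class_output (col : nat -> nat) (c : nat) : seq (seq nat) :=
  [:: [seq ord y | y <- emitted 0 col c]; [seq ord y | y <- emitted 1 col c]].
Definition round_output (col : nat -> nat) : seq (seq nat) :=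
  flatten [seq class_output col c | c <- iota 0 K8].

Definition emit_classes : com := CFor 33 vK8 (emit_order 0;; emit_order 1).

(** A position lies in at most one colour class, so all classes of a round together visit each list
    at most once. *)
Lemma sum_class_lists k col (xs : seq nat) :
  \sum_(0 <= c < K8) size (class_lists k col c xs) <=
  size (flatten [seq related_list lep l0 k x | x <- xs]).
Proof.
elim: xs => [|x xs IH]; first by rewrite big1.
rewrite (eq_bigr (fun c => (col x == c) * size (related_list lep l0 k x) +
  size (class_lists k col c xs))); last first.
  move=> c _; rewrite /lists_of_class /=; case: eqP => _ //=.
  by rewrite size_cat mul1n.
rewrite big_split /= size_cat leq_add // -big_distrl /=.
by rewrite -[X in _ <= X]mul1n leq_mul // sum_indicator.
Qed.

Hypothesis pL : perm_eq l0 (iota 0 n).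
Hypothesis leD : forall k, k < 2 ->
  size (flatten [seq related_list lep l0 k x | x <- descending n n]) <= D.

Lemma emit_classesP s : static s -> let s' := run emit_classes s in
  so s' = so s ++ flatten (round_output (ar s aCOL)) /\
  tm s' <= tm s + K8 * (46 * n + 11) + 16 * D + 1.
Proof.
move=> b.
pose lists j k := \sum_(0 <= c < j) size (class_lists k (ar s aCOL) c (descending n n)).
pose I j s' := so s' = so s ++
    flatten (flatten [seq class_output (ar s aCOL) c | c <- iota 0 j]) /\
  tm s' <= tm s + j * (46 * n + 11) + 8 * (lists j 0 + lists j 1) + 1.
suff [h1 h2] : I K8 (run emit_classes s).
  split=> //; apply: leq_trans h2 _.
  have g0 := leq_trans (@sum_class_lists 0 (ar s aCOL) _) (@leD 0 isT).
  have g1 := leq_trans (@sum_class_lists 1 (ar s aCOL) _) (@leD 1 isT).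
  by rewrite /lists; lia.
apply: (@for_rule I); first by case: b => -[].
  by rewrite /I; sx; rewrite cats0; split=> //; lia.
move=> j s2 jn A [h1 h2].
have b2 := static_agree b A isT.
have [A1 A2 _ _] := A; have Ecol : ar s2 aCOL = ar s aCOL by rewrite A2.
have Ei : iota 0 j.+1 = iota 0 j ++ [:: j] by rewrite -addn1 iotaD.
rewrite /I Ei map_cat !flatten_cat /lists !big_nat_recr //= -/(lists j 0) -/(lists j 1).
sx_step.
have [g1 g2] := @emit_orderP _ _ _ _ _ 0 (setv (tick s2) 33 j) j isT b2 pL erefl.
have b3 : static (run (emit_order 0) (setv (tick s2) 33 j)) by apply: static_run.
have E33 : va (run (emit_order 0) (setv (tick s2) 33 j)) 33 = j by sx.
have [g3 g4] := @emit_orderP _ _ _ _ _ 1 _ j isT b3 pL E33.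
move: g3 g4; set s3 := run _ (run _ _) => g3 g4.
move: g1 g2 g3 g4; sx; rewrite Ecol => g1 g2 g3 g4; split.
  by rewrite g3 g1 h1 -!catA ?cats0.
by move: g2 g4; lia.
Qed.

Definition round : com :=
  clear_conflicts;; conflict_loop;; color_loop;; CConst 31 0;; filter_loop;;
  CAdd vRN 31 vZERO;; emit_classes.

Hypothesis d_gt0 : 0 < d.
Hypothesis dK : 4 * d <= K8.
Hypothesis led : forall v, v < n -> size (fwd v) <= d.

Lemma roundP s R : 0 < n -> static s -> valid_pairs n lep l0 R -> pair_list s (va s vRN) = R ->
  let s' := run round s in exists2 col, greedy K8 (all_edges lep l0 R) col n &
  [/\ pair_list s' (va s' vRN) = [seq p <- R | bad col p],
      so s' = so s ++ flatten (round_output col) &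
      tm s' <= tm s + 50 * (d * size R) + 100 * (n * K8) + 16 * D].
Proof.
move=> n0 b vR ER; rewrite /round.
have ltL : all (gtn n) l0 by apply/allP => y; rewrite (perm_mem pL) mem_iota add0n.
have vR2 p : p \in R -> p.1 < n /\ p.2 < n by case/vR.
have K0 : 0 < K8 by lia.
sx_step; have [g1 g2] := @clear_conflictsP _ _ _ _ _ _ b.
move: g1 g2; set s1 := run clear_conflicts s => g1 g2.
have b1 : static s1 by apply: static_run.
have ER1 : pair_list s1 (va s1 vRN) = R by rewrite -ER /pair_list /s1; sx.
sx_step; have [g3 g4] := conflict_loopP b1 ltL g1 ER1 vR2 led.
move: g3 g4; set s2 := run conflict_loop s1 => g3 g4.
have b2 : static s2 by apply: static_run.
have ltE e : e \in all_edges lep l0 R -> e.2 < e.1 by case/(all_edges_lt ltL vR).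
sx_step; have [g5 g6] := color_loopP b2 K0 g3 ltE.
move: g5 g6; set s3 := run color_loop s2 => g5 g6.
have b3 : static s3 by apply: static_run.
have ER3 : pair_list s3 (va s3 vRN) = R by rewrite -ER /pair_list /s3 /s2 /s1; sx.
do 3 sx_step; have [g7 g8] := @filter_loopP _ _ _ _ _ (setv (tick s3) 31 0) R d b3 erefl ER3 vR2 led.
move: g7 g8; set s4 := run filter_loop _ => g7 g8.
have b4 : static s4 by apply: static_run.
sx_step.
have E0 : va s4 vZERO = 0 by case: b4 => -[].
set s5 := run (CAdd _ _ _) s4.
have b5 : static s5 by apply: static_run.
have [g9 g10] := emit_classesP b5.
exists (ar s3 aCOL) => //; split.
- have -> : pair_list (run emit_classes s5) (va (run emit_classes s5) vRN) =
    pair_list s4 (va s4 31) by rewrite /pair_list /s5; sx; rewrite E0 addn0.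
  exact: g7.
- rewrite g9; congr (_ ++ flatten (round_output _)); first by rewrite /s5 /s4 /s3 /s2 /s1; sx.
  by rewrite /s5 /s4; sx.
have hs : \sum_(0 <= x < n) size (conflict_list (all_edges lep l0 R) x) <= size R * d.
  rewrite (eq_bigr (fun x => count predT (conflict_list (all_edges lep l0 R) x))); last first.
    by move=> x _; rewrite count_predT.
  rewrite (@sum_conflict n (fun _ => predT)) ?count_predT.
    by apply: size_all_edges => p /vR2[p1 _]; apply: led.
  by move=> e /(all_edges_lt ltL vR)[].
have t5 : tm s5 = (tm s4).+1 by rewrite /s5; sx.
have hd : size R <= d * size R by rewrite leq_pmull.
have hn : n <= n * K8 by rewrite leq_pmulr.
have hK : K8 <= n * K8 by rewrite leq_pmull.
by move: g2 g4 g6 g8 g10 hs; rewrite t5; sx; rewrite -/s4; lia.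
Qed.

Definition rounds : com := CFor 34 vT round.

Lemma roundsP s R T : 0 < n -> static s -> valid_pairs n lep l0 R ->
  pair_list s (va s vRN) = R -> va s vT = T ->
  let s' := run rounds s in exists cols : seq (nat -> nat),
  [/\ size cols = T, forall i x, i < T -> x < n -> nth id cols i x < K8,
      4 ^ T * size [seq p <- R | all (fun col => bad col p) cols] <= size R,
      so s' = so s ++ flatten (flatten [seq round_output col | col <- cols]) &
      tm s' <= tm s + 100 * (d * size R) + T * (100 * (n * K8) + 16 * D + 1) + 1].
Proof.
move=> n0 b vR ER ET.
(* The term 100 d |R'| is a potential. Apart from a fixed amount a round costs 50 d |R'|, and the
   drop of |R'| to at most a quarter releases at least 75 d |R'|. *)
pose I j s' := exists cols : seq (nat -> nat), let R' := [seq p <- R | all (fun col => bad col p) cols] in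
  [/\ size cols = j, forall i x, i < j -> x < n -> nth id cols i x < K8,
      4 ^ j * size R' <= size R,
      so s' = so s ++ flatten (flatten [seq round_output col | col <- cols]) &
      pair_list s' (va s' vRN) = R' /\
      tm s' + 100 * (d * size R') <=
        tm s + 100 * (d * size R) + j * (100 * (n * K8) + 16 * D + 1) + 1].
suff [cols [h1 h2 h3 h4 [_ h5]]] : I T (run rounds s).
  by exists cols; split=> //; apply: leq_trans h5; apply: leq_addr.
apply: (@for_rule I) => //.
  exists [::]; have -> : [seq p <- R | all (fun col => bad col p) [::]] = R by apply/all_filterP/allP.
  sx; rewrite cats0; split=> //; [by rewrite expn0 mul1n | by split=> //; lia].
move=> j s2 jT A [cols [h1 h2 h3 h4 [h5 h6]]].
have b2 := static_agree b A isT.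
set R' := [seq p <- R | _] in h3 h5 h6.
have vR' : valid_pairs n lep l0 R' by move=> p; rewrite mem_filter => /andP[_ /vR].
have [col gr [g1 g2 g3]] := @roundP (setv (tick s2) 34 j) R' n0 b2 vR' h5.
have ltL : all (gtn n) l0 by apply/allP => y; rewrite (perm_mem pL) mem_iota add0n.
have sh := greedy_shrinks ltL vR' d_gt0 dK led gr.
have ER' : [seq p <- R | all (fun col0 => bad col0 p) (rcons cols col)] = [seq p <- R' | bad col p].
  by rewrite /R' -filter_predI; apply: eq_filter => p /=; rewrite all_rcons.
exists (rcons cols col); rewrite ER'; split.
- by rewrite size_rcons h1.
- move=> i x; rewrite ltnS nth_rcons h1 => ij xn; case: (ltnP i j) => hij; first exact: h2.
  have -> : i == j by rewrite eqn_leq ij hij.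
  by have [] := gr x xn.
- apply: leq_trans h3; rewrite expnSr -mulnA leq_mul2l sh orbT //.
- by rewrite g2 map_rcons flatten_rcons flatten_cat catA -h4.
- split=> //; move: g3; sx => g3.
  have hd : d * (4 * size [seq p <- R' | bad col p]) <= d * size R' by rewrite leq_mul2l sh orbT.
  by move: h6 g3 hd; rewrite mulnCA; lia.
Qed.

End RoundsLoop.

(** * Number of rounds *)

(* [exp_num j / j`!] is the [j]-th partial sum of the exponential series at 1. *)
Fixpoint exp_num (j : nat) : nat := if j is j'.+1 then j'.+1 * exp_num j' + 1 else 1.

Section LogPhase.

Variables (c ea eb : nat).

(** Without multiplication, squares are advanced by (J + 1)^2 = J^2 + J + J + 1. *)
Definition sqrt_loop : com :=
  CFor 20 vN (CAdd 21 vS vJ;; CAdd 21 21 vJ;; CAdd 21 21 vONE;; CSub 22 21 vN;;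
    CIf 22 (CConst 22 0) (CAdd vJ vJ vONE;; CAdd vS 21 vZERO)).

Lemma sqrt_loopP s n : va s vN = n -> va s vONE = 1 -> va s vZERO = 0 ->
  va s vJ = 0 -> va s vS = 0 -> let s' := run sqrt_loop s in
  [/\ va s' vJ * va s' vJ <= n, n < (va s' vJ).+1 * (va s' vJ).+1 & tm s' <= tm s + 8 * n + 1].
Proof.
move=> En E1 E0 EJ ES.
pose I j s' := [/\ va s' vS = va s' vJ * va s' vJ, va s' vJ * va s' vJ <= n,
  va s' vJ = j \/ n < (va s' vJ).+1 * (va s' vJ).+1 & tm s' <= tm s + 8 * j + 1].
suff [h1 h2 h3 h4] : I n (run sqrt_loop s) by split=> //; case: h3 => [->|//]; lia.
apply: (@for_rule I) => //.
  by rewrite /I; sx; rewrite EJ ES; split=> //; [left | lia].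
move=> j s2 jn [A1 A2 _ _] [h1 h2 h3 h4].
have b0 : va s2 vN = n by rewrite A1.
have b1 : va s2 vONE = 1 by rewrite A1.
have b2 : va s2 vZERO = 0 by rewrite A1.
rewrite /I; sx; rewrite run_if; sx; rewrite b0 b1 b2 subn_gt0.
set J := va s2 vJ in h1 h2 h3 *; rewrite h1.
have -> : J * J + J + J + 1 = J.+1 * J.+1 by lia.
case: ltnP => hj; sx; rewrite ?b1 ?b2 -/J ?addn0 ?addn1.
  by split=> //; [right | lia].
split=> //; last lia.
by case: h3 => [->|h3]; [left | move: (leq_ltn_trans hj h3); rewrite ltnn].
Qed.

Definition times_loop : com := CFor 21 25 (CAdd 26 26 24).

Lemma times_loopP s : let s' := run times_loop s in
  va s' 26 = va s 26 + va s 25 * va s 24 /\ tm s' = tm s + 2 * va s 25 + 1.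
Proof.
pose I j s' := va s' 26 = va s 26 + j * va s 24 /\ tm s' = tm s + 2 * j + 1.
apply: (@for_rule I) => //; first by rewrite /I; sx; split; lia.
move=> j s2 jn [A1 _ _ _] [h1 h2]; have e : va s2 24 = va s 24 by rewrite A1.
by rewrite /I; sx; rewrite h1 h2 e; split; lia.
Qed.

(** The recursion of [exp_num] is run with [X] in place of 1: the step a := (j + 1) a + X turns X
    exp_num j into X exp_num (j + 1). Each product has a factor at most J, so repeated addition
    suffices and the total cost is O(J^2). *)
Definition mul_num : com :=
  CAdd 24 vX vZERO;;
  CFor 20 vJ (CAdd 25 20 vONE;; CAdd 26 vX vZERO;; times_loop;; CAdd 24 26 vZERO);;
  CAdd vX 24 vZERO.

Definition mul_fact : com :=
  CAdd 24 vY vZERO;;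
  CFor 20 vJ (CAdd 25 20 vONE;; CConst 26 0;; times_loop;; CAdd 24 26 vZERO);;
  CAdd vY 24 vZERO.

Lemma mul_numP s J : va s vONE = 1 -> va s vZERO = 0 -> va s vJ = J ->
  let s' := run mul_num s in
  va s' vX = va s vX * exp_num J /\ tm s' <= tm s + 10 * (J.+1 * J.+1).
Proof.
move=> E1 E0 EJ; rewrite /mul_num; do 3 sx_step; rewrite E0 addn0.
set s1 := setv _ 24 _.
pose I j s' := va s' 24 = va s vX * exp_num j /\ tm s' <= tm s1 + j * (2 * J + 6) + 1.
have : I J (run (CFor 20 vJ (CAdd 25 20 vONE;; CAdd 26 vX vZERO;; times_loop;;
    CAdd 24 26 vZERO)) s1).
  apply: (@for_rule I) => //; first by rewrite /I /s1; sx; split=> /=; lia.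
  move=> j s2 jn [A1 _ _ _] [h1 h2].
  have b1 : va s2 vONE = 1 by rewrite A1.
  have b2 : va s2 vZERO = 0 by rewrite A1.
  have b3 : va s2 vX = va s vX by rewrite A1.
  rewrite /I; sx; rewrite b1 b2 b3 addn0.
  spec times_loop (fun s => times_loopP s) H; move: H; sx => -[-> ->].
  rewrite h1; split; first by rewrite /= addn0; nia.
  move: h2; rewrite /s1; sx; nia.
have E0' : va s1 vZERO = 0 by rewrite /s1; sx.
have Et : tm s1 = (tm s).+1 by rewrite /s1; sx.
by rewrite /I Et; case=> h1 h2; sx; rewrite h1 E0' addn0; split=> //; nia.
Qed.

Lemma mul_factP s J : va s vONE = 1 -> va s vZERO = 0 -> va s vJ = J ->
  let s' := run mul_fact s in
  va s' vY = va s vY * J`! /\ tm s' <= tm s + 10 * (J.+1 * J.+1).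
Proof.
move=> E1 E0 EJ; rewrite /mul_fact; do 3 sx_step; rewrite E0 addn0.
set s1 := setv _ 24 _.
pose I j s' := va s' 24 = va s vY * j`! /\ tm s' <= tm s1 + j * (2 * J + 6) + 1.
have : I J (run (CFor 20 vJ (CAdd 25 20 vONE;; CConst 26 0;; times_loop;;
    CAdd 24 26 vZERO)) s1).
  apply: (@for_rule I) => //; first by rewrite /I /s1; sx; rewrite muln1; split=> /=; lia.
  move=> j s2 jn [A1 _ _ _] [h1 h2].
  have b1 : va s2 vONE = 1 by rewrite A1.
  have b2 : va s2 vZERO = 0 by rewrite A1.
  rewrite /I; sx; rewrite b1 b2 addn0.
  spec times_loop (fun s => times_loopP s) H; move: H; sx => -[-> ->].
  rewrite h1 factS; split; first by nia.
  move: h2; rewrite /s1; sx; nia.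
have E0' : va s1 vZERO = 0 by rewrite /s1; sx.
have Et : tm s1 = (tm s).+1 by rewrite /s1; sx.
by rewrite /I Et; case=> h1 h2; sx; rewrite h1 E0' addn0; split=> //; nia.
Qed.

Definition pow_body : com := CConst 26 0;; CAdd 25 vN vZERO;; CAdd 24 vY vZERO;; times_loop;;
  CAdd vY 26 vZERO.
Definition pow_loop : com := CFor 20 23 pow_body.

Lemma pow_loopP s n e : va s vN = n -> va s vZERO = 0 -> va s vY = 1 -> va s 23 = e ->
  let s' := run pow_loop s in va s' vY = n ^ e /\ tm s' <= tm s + e * (2 * n + 6) + 1.
Proof.
move=> En E0 EY E23.
pose I j s' := va s' vY = n ^ j /\ tm s' <= tm s + j * (2 * n + 6) + 1.
apply: (@for_rule I) => //; first by rewrite /I; sx; split=> //; lia.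
move=> j s2 jn [A1 _ _ _] [h1 h2].
have b1 : va s2 vN = n by rewrite A1.
have b2 : va s2 vZERO = 0 by rewrite A1.
rewrite /I /pow_body; sx; rewrite b1 b2 addn0.
spec times_loop (fun s => times_loopP s) H; move: H; sx => -[-> ->].
by rewrite h1 expnS; split; lia.
Qed.

Definition power_loop : com := CFor 33 30 (mul_num;; mul_fact).

Lemma power_loopP s J e : va s vONE = 1 -> va s vZERO = 0 -> va s vJ = J -> va s 30 = e ->
  let s' := run power_loop s in
  [/\ va s' vX = va s vX * exp_num J ^ e, va s' vY = va s vY * J`! ^ e &
      tm s' <= tm s + e * (20 * (J.+1 * J.+1) + 1) + 1].
Proof.
move=> E1 E0 EJ E30.
pose I j s' := [/\ va s' vX = va s vX * exp_num J ^ j, va s' vY = va s vY * J`! ^ j &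
      tm s' <= tm s + j * (20 * (J.+1 * J.+1) + 1) + 1].
apply: (@for_rule I) => //; first by rewrite /I; sx; rewrite !muln1; split=> //; lia.
move=> j s2 jn [A1 _ _ _] [h1 h2 h3].
have b1 : va s2 vONE = 1 by rewrite A1.
have b2 : va s2 vZERO = 0 by rewrite A1.
have b3 : va s2 vJ = J by rewrite A1.
rewrite /I; sx_step.
have [g1 g2] := @mul_numP (setv (tick s2) 33 j) J b1 b2 b3.
have [|||g3 g4] := @mul_factP (run mul_num (setv (tick s2) 33 j)) J; try by sx.
move: g1 g2 g3 g4; sx => g1 g2 g3 g4; rewrite g1 g3 h1 h2 !expnSr !mulnA.
split=> //; move: g2 g4 h3; nia.
Qed.

Definition search_body : com :=
  CSub 22 vY vX;; CIf 22 (CAdd vM vM vONE;; power_loop) (CConst 22 0).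
Definition search_loop : com := CFor 32 31 search_body.

(** The test N <= (exp_num J / J!)^(eb m) is cleared of its denominator, and both sides of the
    resulting comparison are kept up to date by [eb] further factors per turn. *)
Lemma search_loopP s J N b m : va s vONE = 1 -> va s vZERO = 0 -> va s vJ = J ->
  va s 30 = eb -> va s 31 = b -> va s vX = 1 -> va s vY = N -> va s vM = 0 ->
  m <= b -> N * J`! ^ (eb * m) <= exp_num J ^ (eb * m) ->
  (forall i, i < m -> exp_num J ^ (eb * i) < N * J`! ^ (eb * i)) ->
  let s' := run search_loop s in
  va s' vM = m /\ tm s' <= tm s + b * (eb * (20 * (J.+1 * J.+1) + 1) + 5) + 1.
Proof.
move=> E1 E0 EJ E30 E31 EX EY EM mb le_m lt_m.
pose X i := exp_num J ^ (eb * i); pose Y i := N * J`! ^ (eb * i).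
pose I j s' := [/\ va s' vX = X (va s' vM), va s' vY = Y (va s' vM), va s' vM <= m,
   va s' vM = j \/ va s' vM = m &
   tm s' <= tm s + j * (eb * (20 * (J.+1 * J.+1) + 1) + 5) + 1].
suff [h1 h2 h3 h4 h5] : I b (run search_loop s) by split=> //; lia.
apply: (@for_rule I) => //.
  by rewrite /I; sx; rewrite EM EX EY /X /Y muln0 !expn0 muln1; split=> //; [left | lia].
move=> j s2 jn [A1 _ _ _] [h1 h2 h3 h4 h5].
have b1 : va s2 vONE = 1 by rewrite A1.
have b2 : va s2 vZERO = 0 by rewrite A1.
have b3 : va s2 vJ = J by rewrite A1.
have b4 : va s2 30 = eb by rewrite A1.
rewrite /I /search_body; sx; rewrite run_if; sx; rewrite subn_gt0 h1 h2 b1.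
case: ltnP => hXY; sx.
  have ltm : va s2 vM < m.
    rewrite ltn_neqAle h3 andbT; apply: contraTneq hXY => ->; rewrite -leqNgt.
    exact: le_m.
  spec power_loop (fun s => @power_loopP s J eb) H.
  move: H; sx; case=> // -> ->; set t := tm (run _ _) => g; rewrite h1 h2 /X /Y addn1 mulnS !expnD.
  split; [by rewrite mulnC | by rewrite -mulnA [J`! ^ _ * _]mulnC | exact: ltm | |].
    by case: h4 => [->|e]; [left | move: ltm; rewrite e ltnn].
  by move: g; lia.
have e : va s2 vM = m.
  apply/eqP; rewrite eqn_leq h3 leqNgt; apply: contraTN hXY => /lt_m.
  by rewrite -ltnNge.
split=> //; [by right | lia].
Qed.

Definition log_phase : com :=
  CConst vJ 0;; CConst vS 0;; sqrt_loop;; CConst 20 c;; CAdd vJ vJ 20;;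
  CConst vY 1;; CConst 23 ea;; pow_loop;;
  CConst vX 1;; CConst vM 0;; CConst 30 eb;; CAdd 31 vN vN;; CAdd 31 31 31;;
  search_loop;; CAdd vT vM vONE.

(** The two premises on [J] split the exactness of the search: acceptance of [m] is required for
    large [J] only, whereas smaller exponents are to be rejected for every [J], which partial sums
    below e guarantee. *)
Lemma log_phaseP s n m : va s vN = n -> va s vONE = 1 -> va s vZERO = 0 -> 0 < n ->
  m <= 4 * n ->
  (forall J, n < (J - c).+1 * (J - c).+1 -> c <= J ->
    n ^ ea * J`! ^ (eb * m) <= exp_num J ^ (eb * m)) ->
  (forall J i, i < m -> exp_num J ^ (eb * i) < n ^ ea * J`! ^ (eb * i)) ->
  let s' := run log_phase s in
  va s' vT = m.+1 /\
  tm s' <= tm s + (320 * (eb * (c.+1 * c.+1)) + 8 * ea + 4 * eb + 60) * (n * n).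
Proof.
move=> En E1 E0 n0 m4 le_m lt_m; rewrite /log_phase; do 4 sx_step.
have [g1 g2 g3] := @sqrt_loopP (setv (tick (setv (tick s) vJ 0)) vS 0) n En E1 E0 erefl erefl.
move: g1 g2 g3; set s1 := run sqrt_loop _; set r := va s1 vJ => g1 g2 g3.
have [a0 a1 a2] : [/\ va s1 vN = n, va s1 vONE = 1 & va s1 vZERO = 0] by rewrite /s1; sx.
do 9 sx_step; rewrite -/s1 -/r.
set s2 := setv _ 23 _.
have [g4 g5] := @pow_loopP s2 n ea a0 a2 erefl erefl.
move: g4 g5; set s3 := run pow_loop s2 => g4 g5.
have [a3 a4 a5 a6] : [/\ va s3 vN = n, va s3 vONE = 1, va s3 vZERO = 0 & va s3 vJ = r + c].
  by rewrite /s3 /s2; sx.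
do 12 sx_step; rewrite -/s3 (a0 : va s2 vN = n).
set s4 := setv _ 31 _.
have [|||g6 g7] := @search_loopP s4 (r + c) (n ^ ea) (4 * n) m a4 a5 a6 erefl _ erefl g4 erefl m4.
- by rewrite /s4; sx; lia.
- by apply: le_m; rewrite ?addnK // leq_addl.
- by move=> i; apply: lt_m.
sx; rewrite -/s4 g6 {1}/s4; sx; rewrite a4 addn1; split=> //.
have r0 : 0 < r by case: (r) g2 => //; lia.
have hJ : (r + c).+1 * (r + c).+1 <= 4 * (n * (c.+1 * c.+1)).
  have : (r + c).+1 <= (2 * r) * c.+1 by nia.
  move=> h; apply: leq_trans (leq_mul h h) _; nia.
have t3 : tm s4 = (tm s3) + 5 by rewrite /s4; sx; lia.
have t2 : tm s2 = (tm s1) + 4 by rewrite /s2; sx; lia.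
have hn : n <= n * n by rewrite leq_pmulr.
have hn2 : 0 < n * n by rewrite muln_gt0 n0.
have g8 : tm (run search_loop s4) <= tm s4 + 4 * n * (eb * (20 * (4 * (n * (c.+1 * c.+1))) + 1) + 5) + 1.
  by apply: leq_trans g7 _; rewrite leq_add2r leq_add2l leq_mul2l leq_add2r !leq_mul2l leq_add2r leq_mul2l hJ !orbT.
have e1 : 4 * n * (eb * (20 * (4 * (n * (c.+1 * c.+1))) + 1) + 5) =
  320 * (eb * (c.+1 * c.+1)) * (n * n) + 4 * eb * n + 20 * n by lia.
have e2 : ea * (2 * n + 6) <= 8 * ea * (n * n) by nia.
have e3 : 4 * eb * n <= 4 * eb * (n * n) by rewrite leq_mul2l hn orbT.
move: g3; sx => g3; move: g5 g8; rewrite t3 t2 e1 => g5 g8.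
rewrite !mulnDl; lia.
Qed.

End LogPhase.

Import Order.TTheory.

(** * Linear extensions that reverse incomparable pairs *)

Section Raising.

Variables (T : eqType) (le : rel T).

Definition before (L : seq T) (x y : T) : bool := index x L < index y L.

Lemma before_filter (p : pred T) L x y : p x -> p y ->
  before [seq z <- L | p z] x y = before L x y.
Proof.
move=> px py; rewrite /before; elim: L => //= a L IH; case: ifP => pa /=.
  by case: (a =P x) => _; case: (a =P y) => _ //; rewrite ltnS.
rewrite ifF; last by apply: contraFF pa => /eqP->.
by rewrite ifF ?ltnS //; apply: contraFF pa => /eqP->.
Qed.

Lemma before_cat_l A B x y : x \in A -> y \notin A -> before (A ++ B) x y.
Proof.
move=> xA yA; rewrite /before !index_cat xA (negbTE yA).
by apply: leq_trans (leq_addr _ _); rewrite index_mem.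
Qed.

Lemma before_cat_ll A B x y : x \in A -> y \in A -> before (A ++ B) x y = before A x y.
Proof. by move=> xA yA; rewrite /before !index_cat xA yA. Qed.

Lemma before_cat_rr A B x y : x \notin A -> y \notin A -> before (A ++ B) x y = before B x y.
Proof. by move=> /negbTE xA /negbTE yA; rewrite /before !index_cat xA yA ltn_add2l. Qed.

Lemma before_rev L x y : uniq L -> x \in L -> y \in L -> before (rev L) x y = before L y x.
Proof.
have irev z : uniq L -> z \in L -> index z (rev L) = size L - (index z L).+1.
  move=> uL zL; have iz : index z L < size L by rewrite index_mem.
  rewrite -{1}(nth_index z zL) -[L in nth _ L]revK nth_rev ?size_rev //.
  by rewrite index_uniq ?rev_uniq ?size_rev //; lia.
move=> uL xL yL; rewrite /before !irev //.
by move: (xL) (yL); rewrite -!index_mem; lia.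
Qed.

Definition extends (L : seq T) : Prop := forall x y,
  x \in L -> y \in L -> x != y -> le x y -> before L x y.

Variable L0 : seq T.

(** The raised elements come in the order of [L0] rather than of [L]. Either choice keeps an
    extension, but this one allows the up-sets to be sorted once and for all. *)
Definition raise (L : seq T) (s : T) : seq T :=
  [seq x <- L | ~~ le s x] ++ [seq x <- L0 | le s x].

Definition raised (S : seq T) : seq T := foldl raise L0 S.

Hypothesis uL0 : uniq L0.

Lemma mem_raised S : raised S =i L0.
Proof.
elim/last_ind: S => // S s IH x; rewrite /raised -cats1 foldl_cat /= -/(raised S).
by rewrite mem_cat !mem_filter IH -andb_orl orNb.
Qed.

Lemma uniq_raised S : uniq (raised S).
Proof.
elim/last_ind: S => // S s IH; rewrite /raised -cats1 foldl_cat /= -/(raised S).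
rewrite cat_uniq !filter_uniq // andbT; apply/hasPn => x.
by rewrite !mem_filter => /andP[->].
Qed.

(** Since [undup] keeps last occurrences, each element stands where the last raising that moved it
    has put it. *)
Lemma raised_undup S : raised S = undup (L0 ++ flatten [seq [seq y <- L0 | le s y] | s <- S]).
Proof.
elim/last_ind: S => [|S s IH]; first by rewrite /= cats0 undup_id.
rewrite map_rcons flatten_rcons catA undup_cat -IH (undup_id (filter_uniq _ uL0)).
rewrite {1}/raised -cats1 foldl_cat /= -/(raised S); congr (_ ++ _).
apply: eq_in_filter => x; rewrite mem_raised mem_filter => ->.
by rewrite andbT.
Qed.

Hypothesis le_trans : transitive le.

Lemma extends_raised S : extends L0 -> extends (raised S).
Proof.
move=> ext0; elim/last_ind: S => // S s IH.
rewrite /raised -cats1 foldl_cat /= -/(raised S) => x y xL yL xy lexy.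
have mem_r z : z \in raise (raised S) s -> z \in L0.
  by rewrite mem_cat !mem_filter mem_raised => /orP[] /andP[].
have [x0 y0] := (mem_r _ xL, mem_r _ yL).
case: (boolP (le s x)) => sx.
  have sy : le s y by apply: le_trans lexy.
  rewrite before_cat_rr ?mem_filter ?sx ?sy // before_filter //; exact: ext0.
case: (boolP (le s y)) => sy.
  by apply: before_cat_l; rewrite !mem_filter ?sx ?sy ?mem_raised.
rewrite before_cat_ll ?mem_filter ?mem_raised ?sx ?sy // before_filter //.
by apply: IH; rewrite ?mem_raised.
Qed.

(** Raising [u] puts it above [v]. Later raisings never move [v], as no member of [S2] lies below
    it, so [v] cannot overtake [u] again. *)
Lemma raised_separates S1 S2 u v : u \in L0 -> v \in L0 -> le u u -> ~~ le u v ->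
  (forall s, s \in S2 -> ~~ le s v) -> before (raised (S1 ++ u :: S2)) v u.
Proof.
move=> uL vL uu uv; elim/last_ind: S2 => [|S2 s IH] hS.
  rewrite cats1 /raised -cats1 foldl_cat /= -/(raised S1).
  by apply: before_cat_l; rewrite !mem_filter ?uv ?uu ?mem_raised.
rewrite -rcons_cons -rcons_cat /raised -cats1 foldl_cat /= -/(raised _).
have sv : ~~ le s v by apply: hS; rewrite mem_rcons mem_head.
have {}IH : before (raised (S1 ++ u :: S2)) v u.
  by apply: IH => s' hs'; apply: hS; rewrite mem_rcons inE hs' orbT.
case: (boolP (le s u)) => su.
  by apply: before_cat_l; rewrite !mem_filter ?sv ?su ?mem_raised.
by rewrite before_cat_ll ?mem_filter ?mem_raised ?sv ?su // before_filter.
Qed.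

(* [u] is moved above [v] by the class [p] when every member of [p] that lies
   below [v] comes before [u] in the elimination order [vs]. *)
Lemma class_separates vs (p : pred T) u v : uniq vs -> u \in vs -> u \in L0 -> v \in L0 ->
  p u -> le u u -> ~~ le u v ->
  (forall s, s \in vs -> p s -> le s v -> index s vs < index u vs) ->
  before (raised [seq s <- vs | p s]) v u.
Proof.
move=> uvs uin uL vL pu uu uv h; case/splitPr: uin uvs h => V1 V2 uvs h.
rewrite filter_cat /= pu; apply: raised_separates => // s; rewrite mem_filter => /andP[ps sV].
apply/negP => sv; have := h s _ ps sv; rewrite mem_cat inE sV !orbT => /(_ isT).
move: uvs; rewrite cat_uniq /= => /and3P[_ /norP[uV1 /hasPn h2] /andP[uV2 _]].
rewrite !index_cat (negbTE uV1) (negbTE (h2 s sV)) /= eqxx addn0.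
by rewrite ltnNge leq_addr.
Qed.

End Raising.

(** * Criteria for realizers, and a first linear extension *)

Section Realizer.

Context {d : Order.disp_t} {P : finPOrderType d}.

Lemma mem_listed_order (s : seq P) x y :
  ((x, y) \in listed_order s) = (index x s <= index y s).
Proof. by rewrite inE. Qed.

Lemma listed_linear_extension (s : seq P) : (forall x, x \in s) ->
  (forall x y : P, (x <= y)%O -> index x s <= index y s) ->
  linear_extension (listed_order s).
Proof.
move=> sT h; apply/andP; split; last first.
  by apply/forallP => x; apply/forallP => y; rewrite !mem_listed_order leq_total.
apply/and4P; split.
- by apply/forallP => x; rewrite mem_listed_order.
- apply/forallP => x; apply/forallP => y; apply/implyP; rewrite !mem_listed_order -eqn_leq.
  by move=> /eqP e; rewrite -(nth_index x (sT x)) e nth_index.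
- apply/forallP => x; apply/forallP => y; apply/forallP => z; apply/implyP.
  by rewrite !mem_listed_order => /andP[]; apply: leq_trans.
- by apply/forallP => x; apply/forallP => y; apply/implyP; rewrite mem_listed_order; apply: h.
Qed.

Lemma realizerI (A : {pred {set P * P}}) : (forall L, L \in A -> linear_extension L) ->
  (forall x y : P, x != y -> ~~ (x <= y)%O -> exists2 L, L \in A & (x, y) \notin L) ->
  realizer A.
Proof.
move=> linA sepA; apply/andP; split; first by apply/forallP => L; apply/implyP; apply: linA.
apply/forallP => x; apply/forallP => y; apply/implyP => xy; apply/eqP.
apply/idP/idP => [le_xy|]; last first.
  apply: contraTT => /(sepA _ _ xy)[L LA nL].
  by apply/forallPn; exists L; rewrite LA.
apply/forallP => L; apply/implyP => /linA /andP[/and4P[_ _ _ /forallP h] _].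
by have /forallP /(_ y) /implyP := h x; apply.
Qed.

End Realizer.

Section SortedExtension.

Context {d : Order.disp_t} {P : finPOrderType d}.

Definition downset_size (x : P) : nat := #|[set z : P | (z <= x)%O]|.

Lemma downset_size_lt (x y : P) : x != y -> (x <= y)%O -> downset_size x < downset_size y.
Proof.
move=> xy le_xy; apply: proper_card; rewrite properE; apply/andP; split.
  by apply/subsetP => z; rewrite !inE => zx; apply: le_trans le_xy.
apply/subsetPn; exists y; rewrite !inE ?lexx //.
by apply: contra xy => yx; apply/eqP/le_anti; rewrite le_xy.
Qed.

Definition sorted_elements : seq P := sort (relpre downset_size leq) (enum P).

Lemma perm_sorted_elements : perm_eq sorted_elements (enum P).
Proof. exact/permPl/perm_sort. Qed.

Lemma mem_sorted_elements x : x \in sorted_elements.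
Proof. by rewrite (perm_mem perm_sorted_elements) mem_enum. Qed.

Lemma extends_sorted_elements : extends (<=%O : rel P) sorted_elements.
Proof.
move=> x y _ _ xy le_xy; rewrite /before ltnNge leq_eqVlt negb_or; apply/andP; split.
  apply: contra xy => /eqP e; apply/eqP.
  by rewrite -(nth_index x (mem_sorted_elements x)) -e nth_index ?mem_sorted_elements.
apply/negP => lt_i.
have tr : transitive (relpre downset_size leq) by move=> a b c; apply: leq_trans.
have so : sorted (relpre downset_size leq) sorted_elements.
  by apply: sort_sorted => a b; apply: leq_total.
have := sorted_ltn_index tr so y x (mem_sorted_elements y) (mem_sorted_elements x) lt_i.
by rewrite /= leqNgt downset_size_lt.
Qed.

End SortedExtension.

(** * Random colour classes by counting *)

Section Averaging.

Variables (T : finType) (k : nat).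
Notation q := k.+2.

(** Colour 0 is the random class: a uniformly chosen [f] puts each element into it independently
    with probability 1/(k + 2). *)
Definition isolates (f : {ffun T -> 'I_q}) (F : {set T}) (u : T) : bool :=
  (f u == ord0) && [forall w in F, f w != ord0].

(** Independence gives the probability (1/q) (1 - 1/q)^|F|, which is at least (q - 1)^(q - 1) / q^q
    because |F| <= q - 1; denominators are cleared. *)
Lemma card_isolates (F : {set T}) (u : T) : u \notin F -> #|F| <= k.+1 ->
  q ^ #|T| * q.-1 ^ q.-1 <= #|[set f | isolates f F u]| * q ^ q.
Proof.
move=> uF leF.
pose G (x : T) : pred 'I_q := if x == u then pred1 ord0 else if x \in F then predC1 ord0 else predT.
have -> : #|[set f | isolates f F u]| = #|family G|.
  apply: eq_card => f; rewrite inE; apply/andP/familyP => [[fu /forall_inP fF] x|h].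
    rewrite /G; case: eqP => [->|_]; first by rewrite unfold_in.
    by case: ifP => // xF; rewrite unfold_in; apply: fF.
  split; first by have := h u; rewrite /G eqxx unfold_in.
  apply/forall_inP => w wF; have := h w; rewrite /G wF ifF ?unfold_in //.
  by apply/eqP => e; move: uF; rewrite -e wF.
have -> : #|family G| = \prod_x #|G x| by rewrite card_family foldrE big_map big_enum.
rewrite (bigD1 u) //= {1}/G eqxx card1 mul1n (bigID (mem F)) /=.
have -> : \prod_(i | (i != u) && (i \in F)) #|G i| = q.-1 ^ #|F|.
  rewrite -prod_nat_const; apply: eq_big => [x|x /andP[xu xF]].
    by rewrite andb_idl // => xF; apply: contraNneq uF => <-.
  by rewrite /G (negbTE xu) xF cardC1 card_ord.
have -> : \prod_(i | (i != u) && (i \notin F)) #|G i| = q ^ (#|T| - #|F|.+1).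
  have -> : #|T| - #|F|.+1 = #|[pred x | (x != u) && (x \notin F)]|.
    rewrite -(cardsC (u |: F)) cardsU1 uF add1n addKn.
    by apply: eq_card => x; rewrite !inE negb_or.
  rewrite -prod_nat_const; apply: eq_bigr => x /andP[xu xF].
  by rewrite /G (negbTE xu) (negbTE xF) card_ord.
have leT : #|F|.+1 <= #|T| by have := max_card (mem (u |: F)); rewrite cardsU1 uF.
have -> : q ^ #|T| = q ^ #|F|.+1 * q ^ (#|T| - #|F|.+1) by rewrite -expnD subnKC.
have -> : q ^ q = q ^ #|F|.+1 * q ^ (k.+1 - #|F|) by rewrite -expnD; congr (_ ^ _); lia.
have -> : q.-1 ^ q.-1 = q.-1 ^ #|F| * q.-1 ^ (k.+1 - #|F|) by rewrite -expnD; congr (_ ^ _) => /=; lia.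
have h : q.-1 ^ (k.+1 - #|F|) <= q ^ (k.+1 - #|F|).
  by case: (k.+1 - #|F|) => // e; rewrite leq_exp2r.
move: (q ^ #|F|.+1) (q ^ (#|T| - #|F|.+1)) (q.-1 ^ #|F|) => a b c.
by have := leq_mul (leqnn (a * b * c)) h; lia.
Qed.

(** If every [f] isolated too few pairs, summation over all [f] and exchange of the sums would
    contradict [card_isolates]. *)
Lemma isolating_exists (R : {set T * T}) (F : T -> {set T}) :
  (forall p, p \in R -> p.2 \notin F p.1 /\ #|F p.1| <= k.+1) ->
  exists f, #|[set p in R | ~~ isolates f (F p.1) p.2]| * q ^ q <=
            #|R| * (q ^ q - q.-1 ^ q.-1).
Proof.
move=> hR; pose sep f := #|[set p in R | isolates f (F p.1) p.2]|.
have [/existsP[f hf]|/existsPn h] := boolP [exists f, #|R| * q.-1 ^ q.-1 <= sep f * q ^ q].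
  exists f; have e : #|R| = sep f + #|[set p in R | ~~ isolates f (F p.1) p.2]|.
    rewrite -(cardsID [set p | isolates f (F p.1) p.2] R); congr (_ + _).
      by apply: eq_card => p; rewrite !inE.
    by apply: eq_card => p; rewrite !inE andbC.
  by rewrite mulnBr {1}e mulnDl; lia.
have : \sum_(f : {ffun T -> 'I_q}) sep f * q ^ q < \sum_(f : {ffun T -> 'I_q}) #|R| * q.-1 ^ q.-1.
  have lt f : sep f * q ^ q < #|R| * q.-1 ^ q.-1 by rewrite ltnNge h.
  rewrite (bigD1 [ffun _ => ord0]) //= [X in _ < X](bigD1 [ffun _ => ord0]) //=.
  by rewrite -addSn leq_add // leq_sum // => f _; apply: ltnW.
rewrite sum_nat_const card_ffun card_ord -big_distrl /= ltnNge; case/negP.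
have -> : \sum_f sep f = \sum_(p in R) #|[set f | isolates f (F p.1) p.2]|.
  under eq_bigr => f _ do rewrite /sep -sum1_card.
  rewrite (exchange_big_dep (mem R)) /=; last by move=> f p _; rewrite inE => /andP[].
  by apply: eq_bigr => p pR; rewrite -sum1_card; apply: eq_bigl => f; rewrite !inE pR.
rewrite big_distrl /= mulnCA -sum_nat_const; apply: leq_sum => p /hR[h1 h2].
exact: card_isolates.
Qed.

(** Each new function is chosen for the pairs that are still left, so the surviving fractions
    multiply. *)
Lemma isolating_family (R : {set T * T}) (F : T -> {set T}) t :
  (forall p, p \in R -> p.2 \notin F p.1 /\ #|F p.1| <= k.+1) ->
  exists fs : seq {ffun T -> 'I_q}, size fs = t /\
    #|[set p in R | all (fun f => ~~ isolates f (F p.1) p.2) fs]| * (q ^ q) ^ t <=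
    #|R| * (q ^ q - q.-1 ^ q.-1) ^ t.
Proof.
move=> hR; elim: t => [|t [fs [sz IH]]].
  by exists [::]; split=> //; rewrite !expn0 !muln1 subset_leq_card //; apply/subsetP => p; rewrite inE => /andP[].
set R' := [set p in R | _] in IH.
have hR' p : p \in R' -> p.2 \notin F p.1 /\ #|F p.1| <= k.+1 by rewrite inE => /andP[/hR].
have [f hf] := isolating_exists hR'.
exists (rcons fs f); split; first by rewrite size_rcons sz.
have -> : [set p in R | all (fun f => ~~ isolates f (F p.1) p.2) (rcons fs f)] =
    [set p in R' | ~~ isolates f (F p.1) p.2].
  by apply/setP => p; rewrite !inE all_rcons -andbA [~~ _ && _]andbC.
move: hf IH; move: (q ^ q) (q ^ q - _) => A B hf IH.
rewrite (expnS A) (expnS B) mulnA; apply: leq_trans (leq_mul hf (leqnn _)) _.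
by rewrite mulnAC [X in _ <= X]mulnCA [X in _ <= X]mulnC leq_mul2r IH orbT.
Qed.

End Averaging.

(** * The bound on the dimension *)

Section DimensionBound.

Context {d : Order.disp_t} (P : finPOrderType d).

Lemma order_dim_le m (ls : seq {set P * P}) : size ls <= m -> realizer (mem ls) -> order_dim P <= m.
Proof.
move=> sz re; rewrite /order_dim; case: ex_minnP => m0 _ min_m0.
pose A := [set L in ls].
have hA : #|A| <= size ls by rewrite cardsE card_size.
apply: leq_trans (leq_trans hA sz); apply: min_m0; apply/existsP; exists A; rewrite eqxx andbT.
have eA : A =i ls by move=> L; rewrite inE.
case/andP: re => /forallP h1 /forallP h2; apply/andP; split.
  by apply/forallP => L; rewrite eA; apply: h1.
apply/forallP => x; apply/forallP => y; have /forallP/(_ y) := h2 x.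
by rewrite (eq_forallb (P2 := fun L => (L \in A) ==> ((x, y) \in L))) // => L; rewrite eA.
Qed.

Lemma degeneracyP : degenerate (@comparability d P) (degeneracy (@comparability d P)).
Proof. by rewrite /degeneracy; case: ex_minnP. Qed.

(** With p = (k + 1)^(k + 1) / (k + 2)^(k + 2) the last premise reads n^2 (1 - p)^t <= 1. There are
    strictly fewer than n^2 pairs to treat, the diagonal being excluded, so less than one pair
    survives [t] classes. *)
Lemma order_dim_bound k t : degenerate (@comparability d P) k -> 0 < #|P| ->
  #|P| ^ 2 * (k.+2 ^ k.+2 - k.+1 ^ k.+1) ^ t <= (k.+2 ^ k.+2) ^ t -> order_dim P <= 2 * t.
Proof.
move=> /existsP[s /andP[us /forallP hs]] n0 ht.
have ins x : x \in s.
  have hsz : size (enum P) <= size s by rewrite size_tuple -cardE.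
  by have [_ ->] := uniq_min_size us (fun y _ => mem_enum P y) hsz; rewrite mem_enum.
pose F (v : P) := v |: [set w | comparability v w && (index v s < index w s)].
pose R := [set p : P * P | (index p.1 s < index p.2 s) && ~~ (p.1 >=< p.2)%O].
have hR p : p \in R -> p.2 \notin F p.1 /\ #|F p.1| <= k.+1.
  rewrite !inE /comparability => /andP[lt_p inc]; rewrite negb_or (negbTE inc) andbF /= andbT.
  split; first by apply: contraTneq lt_p => ->; rewrite ltnn.
  by rewrite cardsU1 !inE ltnn andbF add1n ltnS.
have ltR : #|R| < #|P| ^ 2.
  rewrite -mulnn -(card_prod P P) -cardsT; apply: proper_card; rewrite properE subsetT /=.
  have /card_gt0P[x _] := n0.
  by apply/subsetPn; exists (x, x); rewrite !inE // ltnn.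
have [fs [sz hfs]] := isolating_family t hR.
set R' := [set p in R | _] in hfs.
have R'0 : R' = set0.
  apply/eqP; rewrite -cards_eq0 -leqn0 leqNgt; apply/negP => R'gt.
  have A0 : 0 < (k.+2 ^ k.+2) ^ t by rewrite !expn_gt0.
  have B0 : 0 < (k.+2 ^ k.+2 - k.+1 ^ k.+1) ^ t.
    rewrite expn_gt0 subn_gt0; apply/orP; left.
    by apply: (@leq_trans (k.+2 ^ k.+1)); [rewrite ltn_exp2r | rewrite leq_exp2l].
  have : (k.+2 ^ k.+2) ^ t < (k.+2 ^ k.+2) ^ t; last by rewrite ltnn.
  apply: leq_ltn_trans (leq_pmull _ R'gt) _; apply: leq_ltn_trans hfs _.
  by apply: leq_trans ht; rewrite ltn_pmul2r.
pose le : rel P := <=%O; pose ge : rel P := fun x y => (y <= x)%O.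
pose L0 := @sorted_elements d P.
have uL0 : uniq L0 by rewrite (perm_uniq perm_sorted_elements) enum_uniq.
have inL0 x : x \in L0 by apply: mem_sorted_elements.
have trle : transitive le by move=> a b c; apply: le_trans.
have trge : transitive ge by move=> a b c ba ca; apply: le_trans ca ba.
have uL1 : uniq (rev L0) by rewrite rev_uniq.
have ext1 : extends ge (rev L0).
  move=> x y _ _ xy yx; rewrite before_rev //.
  by apply: extends_sorted_elements => //; rewrite eq_sym.
pose cls (f : {ffun P -> 'I_k.+2}) := [seq x <- s | f x == ord0].
pose up f := raised le L0 (cls f); pose dn f := rev (raised ge (rev L0) (cls f)).
pose ls := [seq listed_order (up f) | f <- fs] ++ [seq listed_order (dn f) | f <- fs].
have lin_of (L : seq P) : L =i L0 -> (forall x y, x != y -> (x <= y)%O -> before L x y) ->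
    linear_extension (listed_order L).
  move=> inL h; apply: listed_linear_extension => [x|x y xy]; first by rewrite inL.
  by have [->|ne] := eqVneq x y; [| apply: ltnW; apply: h].
have bup f x y : x != y -> (x <= y)%O -> before (up f) x y.
  move=> xy le_xy; apply: (extends_raised trle) => //; rewrite ?mem_raised //.
  exact: extends_sorted_elements.
have mdn f : raised ge (rev L0) (cls f) =i rev L0 by apply: mem_raised.
have bdn f x y : x != y -> (x <= y)%O -> before (dn f) x y.
  move=> xy le_xy; rewrite before_rev ?uniq_raised ?mdn ?mem_rev //.
  by apply: (extends_raised trge) => //; rewrite ?mdn ?mem_rev // eq_sym.
apply: (@order_dim_le _ ls); first by rewrite size_cat !size_map sz mul2n addnn.
apply: realizerI => [L|x y xy nle].
  rewrite mem_cat => /orP[] /mapP[f _ ->].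
    by apply: lin_of => [x|]; [rewrite mem_raised | apply: bup].
  by apply: lin_of => [x|]; [rewrite mem_rev mdn mem_rev | apply: bdn].
(* Comparable pairs need at least one extension. For t = 0 the premise would say n^2 <= 1, against
   [x != y]. *)
have fs0 : 0 < size fs.
  rewrite sz; case: t ht {hfs sz} => // ; rewrite !expn0 muln1.
  have lt1 : 1 < #|P|.
    by rewrite -cardsT (cardsD1 x) inE (cardsD1 y) !inE eq_sym xy.
  move=> h; have : #|P| <= 1 by apply: leq_trans h; rewrite -{1}[#|P|]expn1 leq_exp2l.
  by rewrite leqNgt lt1.
have sep v u f : (v, u) \in R -> f \in fs -> isolates f (F v) u ->
    before (up f) v u /\ before (dn f) u v.
  rewrite inE /= => /andP[lt_vu inc] ff /andP[/eqP fu /forall_inP fF].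
  have key w : w \in s -> f w == ord0 -> (w >=< v)%O -> index w s < index u s.
    move=> _ fw cmp; apply: leq_ltn_trans lt_vu; rewrite leqNgt; apply/negP => lt_vw.
    have := fF w; rewrite fw /= => /(_ _)/negP; apply=> //.
    have vw : v != w by apply: contraTneq lt_vw => ->; rewrite ltnn.
    by rewrite !inE /comparability vw comparable_sym cmp lt_vw !orbT.
  split.
    apply: class_separates => //; rewrite ?fu //; first exact: lexx.
      by apply: contra inc => h; apply/orP; right.
    by move=> w ws fw wv; apply: key => //; apply/orP; left.
  rewrite before_rev ?uniq_raised ?mdn ?mem_rev //.
  apply: class_separates => //; rewrite ?mem_rev ?fu //; first exact: lexx.
    by apply: contra inc => h; apply/orP; left.
  by move=> w ws fw wv; apply: key => //; apply/orP; right.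
have get v u : (v, u) \in R -> exists2 f, f \in fs & isolates f (F v) u.
  move=> vuR; have : (v, u) \notin R' by rewrite R'0 inE.
  by rewrite inE vuR /= => /allPn[f ff]; rewrite negbK; exists f.
have out (L : seq P) : before L y x -> (x, y) \notin listed_order L.
  by rewrite mem_listed_order -ltnNge.
case: (boolP (y <= x)%O) => yx.
  case: fs fs0 @ls {hfs R' R'0 sz sep get} => // f fs _.
  exists (listed_order (up f)); first by rewrite mem_head.
  by apply: out; apply: bup => //; rewrite eq_sym.
have inc : ~~ (x >=< y)%O by rewrite /Order.comparable negb_or nle yx.
case: (ltngtP (index x s) (index y s)) => hi.
- have /get[f ff iso] : (x, y) \in R by rewrite inE hi.
  exists (listed_order (dn f)); first by rewrite mem_cat (map_f (listed_order \o dn) ff) orbT.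
  by apply: out; case: (sep x y f) => //; rewrite inE hi.
- have /get[f ff iso] : (y, x) \in R by rewrite inE hi comparable_sym.
  exists (listed_order (up f)); first by rewrite mem_cat (map_f (listed_order \o up) ff).
  by apply: out; case: (sep y x f) => //; rewrite inE hi comparable_sym.
- by move: xy; rewrite -(nth_index x (ins x)) hi nth_index ?eqxx.
Qed.

End DimensionBound.

(** * The complete program *)

Lemma sum_iota_le (F : nat -> nat) n b : (forall x, x < n -> F x <= b) ->
  \sum_(x <- iota 0 n) F x <= n * b.
Proof.
move=> h; rewrite -{1}[n]subn0 -/(index_iota 0 n) big_nat.
apply: leq_trans (_ : \sum_(0 <= x < n) b <= _); last by rewrite sum_nat_const_nat subn0.
by rewrite [leqRHS]big_nat; apply: leq_sum => x /andP[_]; apply: h.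
Qed.

Section Positions.

Variables (n : nat) (le : rel nat) (f : nat -> nat) (K : nat).
Hypothesis elim_f : elimination n le f n K.

Definition pos_le : rel nat := fun i j => le (f i) (f j).
Notation lep := pos_le.
Definition base_order : seq nat := by_down_count n lep.

Lemma elim_lt i : i < n -> f i < n.
Proof. by case: elim_f => _ h _ _; apply: h. Qed.

Lemma elim_inj i j : i < n -> j < n -> f i = f j -> i = j.
Proof.
move=> ni nj; case: elim_f => u _ _ _ e.
have := nth_uniq 0 (s := mkseq f n); rewrite size_mkseq => h.
by have := h i j ni nj u; rewrite !nth_mkseq // e eqxx => /esym/eqP.
Qed.

Lemma perm_elim : perm_eq (mkseq f n) (iota 0 n).
Proof.
have [u h _ _] := elim_f; apply: uniq_perm => //; first exact: iota_uniq.
have sub : {subset mkseq f n <= iota 0 n}.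
  by move=> y /mapP[i]; rewrite !mem_iota => /= ni ->; apply: h.
by case: (uniq_min_size u sub) => //; rewrite size_mkseq size_iota.
Qed.

Lemma mem_elim_prefix i j : i < n -> j <= n -> (f i \in mkseq f j) = (i < j).
Proof.
move=> ni nj; apply/mapP/idP => [[h]|ij]; last by exists i; rewrite ?mem_iota.
rewrite mem_iota => /= hj e; rewrite (elim_inj ni _ e) //.
exact: leq_trans nj.
Qed.

Lemma residual_degree_pos i : i < n ->
  residual_degree n le (mkseq f i) (f i) = count (fun j => (i <= j) && cmp_rel lep i j) (iota 0 n).
Proof.
move=> ni; rewrite /residual_degree -(permP perm_elim) count_map.
apply: eq_in_count => j; rewrite mem_iota => /= nj.
by rewrite (mem_elim_prefix nj (ltnW ni)) -leqNgt.
Qed.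

Lemma perm_base_order : perm_eq base_order (iota 0 n).
Proof.
have part j : perm_eq (flatten [seq [seq y <- iota 0 n | down_count n lep y == h] | h <- iota 0 j])
    [seq y <- iota 0 n | down_count n lep y < j].
  elim: j => [|j IH]; first by rewrite /= (eq_filter (a2 := pred0)) // filter_pred0.
  have Ei : iota 0 j.+1 = iota 0 j ++ [:: j] by rewrite -addn1 iotaD.
  rewrite Ei map_cat flatten_cat /= cats0.
  apply: perm_trans (perm_cat IH (perm_refl _)) _.
  set A := [seq y <- iota 0 n | down_count n lep y < j.+1].
  have e1 : [seq y <- iota 0 n | down_count n lep y < j] = [seq y <- A | down_count n lep y < j].
    by rewrite -filter_predI; apply: eq_filter => y /=; case: ltnP => // h; rewrite ltnS ltnW.
  have e2 : [seq y <- iota 0 n | down_count n lep y == j] =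
      [seq y <- A | ~~ (down_count n lep y < j)].
    rewrite -filter_predI; apply: eq_filter => y /=.
    by rewrite -leqNgt ltnS eq_sym eqn_leq.
  by rewrite e1 e2 perm_filterC.
apply: perm_trans (part n.+1) _.
rewrite (_ : [seq y <- _ | _] = iota 0 n) //; apply/all_filterP/allP => y _ /=.
by rewrite ltnS -{2}(size_iota 0 n); apply: count_size.
Qed.

Lemma mem_base_order i : (i \in base_order) = (i < n).
Proof. by rewrite (perm_mem perm_base_order) mem_iota. Qed.

Lemma size_fwd v : v < n -> size (fwd lep base_order v) <= K.
Proof.
move=> vn; rewrite size_filter (permP perm_base_order) -residual_degree_pos //.
by have [_ _ h _] := elim_f; apply: h.
Qed.

Lemma descendingE : descending n n = rev (iota 0 n).
Proof.
apply: (@eq_from_nth _ 0); rewrite ?size_rev ?size_map ?size_iota // => i ni.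
rewrite (nth_map 0) ?size_iota // nth_rev ?size_iota // !nth_iota //; lia.
Qed.

(** Every comparability is counted in the forward list of its earlier member. The up-sets, and
    likewise the down-sets, therefore amount to at most twice the total length of the forward
    lists. *)
Lemma size_related k : k < 2 ->
  size (flatten [seq related_list lep base_order k x | x <- descending n n]) <= 2 * (n * K).
Proof.
move=> k2; rewrite size_flatten /shape -map_comp sumnE big_map descendingE.
rewrite (perm_big (iota 0 n)) /=; last by rewrite perm_rev.
pose F x y := (x <= y) && cmp_rel lep x y.
have le1 x : size (related_list lep base_order k x) <=
    count (F x) (iota 0 n) + count (F^~ x) (iota 0 n).
  rewrite /related_list size_filter -(permP (_ : perm_eq base_order _)); last first.
    by rewrite /src; case: ifP => _ //; rewrite perm_sym perm_rev.
  rewrite (permP perm_base_order) -count_predUI; apply: leq_trans (leq_addr _ _).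
  apply: sub_count => y /=; rewrite /F (cmpC _ y).
  have [xy|/ltnW ->] := leqP x y; rewrite /cmp_rel /=.
    by case: k k2 => [|[|//]] _ /= ->; rewrite ?orbT.
  by case: k k2 => [|[|//]] _ /= ->; rewrite ?orbT.
apply: leq_trans (leq_sum _ (fun x _ => le1 x)) _; rewrite big_split /= mul2n -addnn.
have h1 : \sum_(x <- iota 0 n) count (F x) (iota 0 n) <= n * K.
  apply: sum_iota_le => x xn.
  rewrite -residual_degree_pos //; by have [_ _ h _] := elim_f; apply: h.
apply: leq_add => //; apply: leq_trans h1.
under eq_bigr => x _ do rewrite -sum1_count big_mkcond.
under [leqRHS]eq_bigr => x _ do rewrite -sum1_count big_mkcond.
by rewrite exchange_big.
Qed.

Lemma valid_open_pairs : valid_pairs n lep base_order (open_pairs n lep).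
Proof.
move=> p /flattenP[_ /mapP[v hv ->] /mapP[u hu ->]] /=.
move: hv hu; rewrite mem_filter !mem_iota => /= vn /andP[/andP[vu nc] un]; split=> //.
by rewrite mem_filter /= negb_and (negbTE nc) andbF.
Qed.

Lemma size_open_pairs : size (open_pairs n lep) <= n * n.
Proof.
rewrite /open_pairs size_flatten /shape -map_comp sumnE big_map.
apply: sum_iota_le => v _ /=.
by rewrite size_map size_filter -{2}(size_iota 0 n); apply: count_size.
Qed.

End Positions.

(** * Assembly of the phases *)

Section MainProgram.

Variable c : nat.

Definition prepare : com :=
  (CSub 20 vKK vONE;; CAdd 20 20 20;; CAdd 20 20 20;; CAdd vK8 20 20;; CSub vN1 vN vONE);;
  (down_counts;; CConst 23 0;; CAdd 25 vN vONE);;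
  (sort_loop;; CSub 25 vN vONE);;
  reverse_loop;; lists_loop 0;; lists_loop 1;; (lists_loop 2;; CConst vRN 0);; pairs_loop.

Definition find_elimination : com :=
  read_input;; log_phase c 121 50;; degrees;; CConst vKK 0;; elim_loop.

Definition main_com : com := find_elimination;; prepare;; rounds.

Lemma find_eliminationP n (le : rel nat) l m s : si s = n :: l -> 0 < n ->
  (forall a j, ar s a j = 0) -> (forall v, va s v = 0) ->
  (forall i j, i < n -> j < n -> nth 0 l (i * n + j) = le i j) ->
  m <= 4 * n ->
  (forall J, n < (J - c).+1 * (J - c).+1 -> c <= J ->
    n ^ 121 * J`! ^ (50 * m) <= exp_num J ^ (50 * m)) ->
  (forall J i, i < m -> exp_num J ^ (50 * i) < n ^ 121 * J`! ^ (50 * i)) ->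
  let s' := run find_elimination s in
  [/\ base n le s', elimination n le (ar s' aORD) n (va s' vKK), va s' vT = m.+1, so s' = so s &
      tm s' <= tm s + (320 * (50 * (c.+1 * c.+1)) + 1400) * (n * n)].
Proof.
move=> sin n0 ar0 va0 hl m4 le_m lt_m; rewrite /find_elimination.
sx_step; have [a1 a2 a3 a4 t1] := read_inputP sin.
have Z1 : va (run read_input s) vZERO = 0 by sx; rewrite va0.
have D1 j : ar (run read_input s) aDD j = 0 by sx; rewrite ar0.
have O1 : so (run read_input s) = so s by sx.
move: a1 a2 a3 a4 t1 Z1 D1 O1; move: (run read_input s) => s1 a1 a2 a3 a4 t1 Z1 D1 O1.
have b1 : base n le s1.
  split=> // i j ni nj; rewrite a4 ?hl //.
  by apply: (@leq_trans (i.+1 * n)); [rewrite mulSn addnC ltn_add2r | rewrite leq_mul2r ni orbT].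
sx_step; have [e2 t2] := log_phaseP a1 a2 Z1 n0 m4 le_m lt_m.
have b2 : base n le (run (log_phase c 121 50) s1) by apply: (base_ext b1); sx.
have D2 j : ar (run (log_phase c 121 50) s1) aDD j = 0 by sx; rewrite D1.
have O2 : so (run (log_phase c 121 50) s1) = so s by sx.
move: e2 t2 b2 D2 O2; move: (run (log_phase c 121 50) s1) => s2 e2 t2 b2 D2 O2.
sx_step; have [e3 t3] := degreesP b2.
have b3 : base n le (run degrees s2) by apply: (base_ext b2); sx.
have D3 j : ar (run degrees s2) aDD j = 0 by sx; rewrite D2.
have O3 : so (run degrees s2) = so s by sx.
have T3 : va (run degrees s2) vT = m.+1 by sx.
move: e3 t3 b3 D3 O3 T3; move: (run degrees s2) => s3 e3 t3 b3 D3 O3 T3.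
do 2 sx_step.
have b4 : base n le (setv (tick s3) vKK 0) by apply: (base_ext b3); sx.
have D4 j : ar (setv (tick s3) vKK 0) aDD j = 0 by sx.
have E4 j : j < n -> ar (setv (tick s3) vKK 0) aDG j = residual_degree n le [::] j by sx; exact: e3.
have T4 : va (setv (tick s3) vKK 0) vT = m.+1 by sx.
have O4 : so (setv (tick s3) vKK 0) = so s by sx.
have Z4 : va (setv (tick s3) vKK 0) vKK = 0 by sx.
have t4 : tm (setv (tick s3) vKK 0) = (tm s3).+1 by sx.
move: b4 D4 E4 T4 O4 Z4 t4; move: (setv _ vKK 0) => s4 b4 D4 E4 T4 O4 Z4 t4.
have [e5 t5] := elim_loopP b4 Z4 (fun j _ => D4 j) E4.
have hn : n <= n * n by rewrite leq_pmulr.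
have hn1 : 0 < n * n by rewrite muln_gt0 n0.
split=> //.
- by apply: (base_ext b4); sx.
- by sx.
- by sx.
by clear -t1 t2 t3 t4 t5 hn hn1; rewrite !mulnDl; move: t2; rewrite !mulnDl; lia.
Qed.

Definition carries n (f : nat -> nat) K (s s' : store) : Prop :=
  [/\ va s' vN1 = n.-1, va s' vK8 = 8 * K.-1, forall i, i < n -> ar s' aORD i = f i,
      so s' = so s & va s' vT = va s vT].

Lemma carries_run n f K s s' c0 : carries n f K s s' ->
  all (fun v => v \notin mv c0) [:: vN1; vK8; vT] -> aORD \notin ma c0 -> ~~ writes c0 ->
  carries n f K s (run c0 s').
Proof.
move=> [h1 h2 h3 h4 h5] /and4P[c1 c2 c3 _] c4 c5.
by split; rewrite ?frame_va ?frame_ar ?frame_so.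
Qed.

Lemma prepareP n (le : rel nat) f K s : base n le s -> elimination n le f n K -> 0 < n ->
  (forall i, i < n -> ar s aORD i = f i) -> va s vKK = K ->
  let s' := run prepare s in let lep := pos_le le f in
  [/\ static n lep (base_order n le f) f (8 * K.-1) s',
      pair_list s' (va s' vRN) = open_pairs n lep, so s' = so s, va s' vT = va s vT &
      tm s' <= tm s + 300 * (n * n)].
Proof.
move=> b ef n0 EO EK; have [c1 c2 c3 c4 c5] := b.
rewrite /prepare; set lep := pos_le le f; set L := base_order n le f.
have sz : size L = n by rewrite (perm_size (perm_base_order n le f)) size_iota.
have ltL : all (gtn n) L by apply/allP => i; rewrite mem_base_order.
have ltR : all (gtn n) (rev L) by rewrite all_rev.
have hn : n <= n * n by rewrite leq_pmulr.
have hn1 : 0 < n * n by rewrite muln_gt0 n0.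
rewrite [run (_ ;; _) s]run_seq; set s0 := run _ s.
have k0 : carries n f K s s0.
  split; rewrite /s0; sx; [by rewrite c1 c2 subn1 | rewrite EK c2; lia | exact: EO | by [] | by []].
have pb0 : pbase n lep s0.
  split; rewrite /s0; sx; [exact: c1 | exact: c2 | exact: c3 |] => i j ni nj; sx.
  by rewrite !EO // c4 ?c5 //; apply: (elim_lt ef).
have t0 : tm s0 = tm s + 5 by rewrite /s0; sx; lia.
move: pb0 k0 t0; clearbody s0 => pb0 k0 t0.
rewrite [run (_ ;; _) s0]run_seq; have [e1 t1] := down_countsP pb0; set s1 := run _ s0.
have pb1 : pbase n lep s1 by exact: pbase_run.
have k1 : carries n f K s s1 by exact: carries_run.
have E23 : va s1 23 = 0 by rewrite /s1; sx.
have E25 : va s1 25 = n.+1.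
  by have [u1 u2 _ _] := pb0; rewrite /s1; sx; rewrite u1 u2 addn1.
have {}e1 y : y < n -> ar s1 aDC y = down_count n lep y by rewrite /s1; sx; apply: e1.
have {}t1 : tm s1 <= tm s0 + n * (7 * n + 4) + 3 by rewrite /s1; sx; lia.
move: pb1 k1 E23 E25 e1 t1; clearbody s1 => pb1 k1 E23 E25 e1 t1.
rewrite [run (_ ;; _) s1]run_seq; have [e2 t2] := sort_loopP pb1 E23 E25 e1; set s2 := run _ s1.
have sz2 : va (run sort_loop s1) 23 = n by rewrite -sz /L /base_order -e2 size_mkseq.
have {}e2 : mkseq (ar s2 aL0) n = L by rewrite /s2; sx; rewrite /L /base_order -e2 sz2.
have pb2 : pbase n lep s2 by exact: pbase_run.
have k2 : carries n f K s s2 by exact: carries_run.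
have {}E25 : va s2 25 = n.-1.
  by have [u1 u2 _ _] := pb1; rewrite /s2; sx; rewrite u1 u2 subn1.
have {}t2 : tm s2 <= tm s1 + n.+1 * (8 * n + 2) + 2 by rewrite /s2; sx; lia.
move: pb2 k2 E25 e2 t2; clearbody s2 => pb2 k2 E25' e2 t2.
rewrite [run (_ ;; _) s2]run_seq; have [e3 t3] := reverse_loopP pb2 E25'; rewrite e2 in e3.
set s3 := run _ s2 in e3 t3 *.
have pb3 : pbase n lep s3 by exact: pbase_run.
have k3 : carries n f K s s3 by exact: carries_run.
have L3 : mkseq (ar s3 aL0) n = L by rewrite /s3; sx.
move: e3 t3 pb3 k3 L3; clearbody s3 => e3 t3 pb3 k3 L3.
rewrite [run (_ ;; _) s3]run_seq; have [e4 t4] := @lists_loopP n lep 0 s3 _ pb3 e3 ltR.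
set s4 := run _ s3 in e4 t4 *.
have pb4 : pbase n lep s4 by exact: pbase_run.
have k4 : carries n f K s s4 by exact: carries_run.
have L4 : mkseq (ar s4 aL0) n = L by rewrite /s4; sx.
have R4 : mkseq (ar s4 aLR) n = rev L by rewrite /s4; sx.
move: e4 t4 pb4 k4 L4 R4; clearbody s4 => e4 t4 pb4 k4 L4 R4.
rewrite [run (_ ;; _) s4]run_seq; have [e5 t5] := @lists_loopP n lep 1 s4 _ pb4 L4 ltL.
set s5 := run _ s4 in e5 t5 *.
have pb5 : pbase n lep s5 by exact: pbase_run.
have k5 : carries n f K s s5 by exact: carries_run.
have L5 : mkseq (ar s5 aL0) n = L by rewrite /s5; sx.
have R5 : mkseq (ar s5 aLR) n = rev L by rewrite /s5; sx.
have f5 x : x < n -> column n (ar s5 aUP) x (ar s5 aUL x) = [seq y <- rev L | lists_rel lep 0 x y].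
  by rewrite /s5; sx; apply: e4.
move: e5 f5 t5 pb5 k5 L5 R5; clearbody s5 => e5 f5 t5 pb5 k5 L5 R5.
rewrite [run (_ ;; _) s5]run_seq; have [e6 t6] := @lists_loopP n lep 2 s5 _ pb5 L5 ltL.
set s6 := run _ s5.
have pb6 : pbase n lep s6 by exact: pbase_run.
have k6 : carries n f K s s6 by exact: carries_run.
have {}t6 : tm s6 <= tm s5 + n * (20 * n + 5) + 2 by rewrite /s6; sx; lia.
have Z6 : va s6 vRN = 0 by rewrite /s6; sx.
have st6 : static n lep L f (8 * K.-1) s6.
  case: pb6 => p1 p2 p3 _; case: k6 => q1 q2 q3 _ _; split=> //; try by rewrite /s6; sx.
  move=> k x xn; case: k => [|[|k]]; rewrite /s6 /=; sx; [exact: f5 | exact: e5 | exact: e6].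
move: st6 t6 pb6 k6 Z6; clearbody s6 => st6 t6 pb6 k6 Z6.
have [e7 t7] := pairs_loopP pb6 Z6; have [_ _ _ k7 k8] : carries n f K s (run pairs_loop s6).
  exact: carries_run.
split=> //; first exact: (static_run (c := pairs_loop)).
move: t1 t2 t3 t4 t5 t6 t7 hn hn1; rewrite t0.
do ![move: (tm _) => ?]; clear; rewrite (mulSn n) (mulnDr n (7 * n)) (mulnDr n (8 * n)) (mulnDr n (18 * n)) (mulnDr n (20 * n)).
rewrite (mulnCA n 7 n) (mulnCA n 8 n) (mulnCA n 18 n) (mulnCA n 20 n).
move: (n * n) => N; lia.
Qed.

Lemma main_comP n (le : rel nat) l m s : si s = n :: l -> 0 < n ->
  (forall a j, ar s a j = 0) -> (forall v, va s v = 0) ->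
  (forall i j, i < n -> j < n -> nth 0 l (i * n + j) = le i j) ->
  m <= 3 * n ->
  (forall J, n < (J - c).+1 * (J - c).+1 -> c <= J ->
    n ^ 121 * J`! ^ (50 * m) <= exp_num J ^ (50 * m)) ->
  (forall J i, i < m -> exp_num J ^ (50 * i) < n ^ 121 * J`! ^ (50 * i)) ->
  (forall f K, elimination n le f n K -> 1 < K) ->
  exists f K (cols : seq (nat -> nat)), let s' := run main_com s in
  let lep := pos_le le f in let l0 := base_order n le f in
  [/\ elimination n le f n K,
      [/\ size cols = m.+1 & forall i x, i < m.+1 -> x < n -> nth id cols i x < 8 * K.-1],
      4 ^ m.+1 * size [seq p <- open_pairs n lep |
        all (fun col => bad_pair lep l0 col p) cols] <= n * n,
      so s' = so s ++ flatten (flatten [seq round_output n lep l0 f (8 * K.-1) col | col <- cols]) &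
      tm s' <= tm s + (320 * (50 * (c.+1 * c.+1)) + 60 * 100) * (n * n * K.-1)].
Proof.
move=> sin n0 ar0 va0 hl m3 le_m lt_m K_gt1.
have m4 : m <= 4 * n by apply: leq_trans m3 _; rewrite leq_mul2r orbT.
have [b ef T1 O1 t1] := find_eliminationP sin n0 ar0 va0 hl m4 le_m lt_m.
rewrite /main_com; sx_step.
move: b ef T1 O1 t1; move: (run find_elimination s) => s1 b ef T1 O1 t1.
set f := ar s1 aORD in ef; set K := va s1 vKK in ef; have K1 := K_gt1 _ _ ef.
sx_step; have [st E2 O2 T2 t2] := prepareP b ef n0 (fun i _ => erefl) erefl.
move: st E2 O2 T2 t2; move: (run prepare s1) => s2 st E2 O2 T2 t2.
have [] := @roundsP n (pos_le le f) (base_order n le f) f (8 * K.-1) K (2 * (n * K))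
  (perm_base_order n le f) (fun k k2 => size_related ef k2) (ltnW K1) _
  (fun v vn => size_fwd ef vn) s2 _ m.+1 n0 st (@valid_open_pairs _ _ _) E2 (etrans T2 T1).
  (* The open premise is 4 K <= 8 (K - 1), true since K > 1. *)
  by clear -K1; lia.
move=> cols [h1 h2 h3 h4 h5]; exists f, K, cols; split=> //.
- by apply: leq_trans h3 _; apply: size_open_pairs.
- by rewrite h4 O2 O1.
have hR := size_open_pairs n le f.
move: h5 t1 t2 hR; move: (size _) (tm _) (tm s2) (tm s1) (tm s) => N x3 x2 x1 x0 h5 t1 t2 hR.
clear -h5 t1 t2 hR m3 K1 n0; case: K K1 h5 => [//|k] k0 /= h5.
have hk : n * n <= n * n * k by rewrite leq_pmulr.
have h6 : k.+1 * N <= 2 * (n * n * k).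
  rewrite mulnC; apply: leq_trans (leq_mul hR (_ : _ <= k + k)) _; last by rewrite mulnDr; lia.
  by lia.
(* A linear bound on the logarithmic number of rounds is enough, because a round costs O(nk) apart
   from its open pairs. *)
have hm : m.+1 <= 4 * n by lia.
have h7 : m.+1 * (100 * (n * (8 * k)) + 16 * (2 * (n * k.+1)) + 1) <= 3460 * (n * n * k).
  apply: leq_trans (leq_mul hm (_ : _ <= 865 * (n * k))) _; last by clear; nia.
  have nk : n * 1 <= n * k by rewrite leq_mul2l -ltnS k0 orbT.
  rewrite mulnS (mulnCA n 8); move: nk n0; clear; move: (n * k) => x; lia.
have hn1 : 0 < n * n by rewrite muln_gt0 n0.
set C := 320 * _ in t1 *; have h8 : (C + 1400) * (n * n) <= (C + 1400) * (n * n * k).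
  by rewrite leq_mul2l hk orbT.
move: h8; rewrite !mulnDl; move: t1; rewrite mulnDl.
move: (C * (n * n)) (C * (n * n * k)) => X1 X2; move: h6 h7 hk hn1 t2 h5.
move: (n * n * k) (n * n) (m.+1 * _) (k.+1 * N) => *; lia.
Qed.

Lemma main_com_ok : array_ids_ok main_com.
Proof. by []. Qed.

End MainProgram.

(** * The emitted lists as linear extensions that separate all pairs *)

Section EmittedOrders.

Variables (n : nat) (lep : rel nat).
Hypotheses (lep_refl : reflexive lep) (lep_trans : transitive lep).
Hypothesis lep_anti : forall x y, x < n -> y < n -> lep x y -> lep y x -> x = y.
Notation l0 := (by_down_count n lep).
Hypothesis perm_l0 : perm_eq l0 (iota 0 n).
Notation gep := (fun x y => lep y x).

Let mem_l0 x : (x \in l0) = (x < n).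
Proof. by rewrite (perm_mem perm_l0) mem_iota. Qed.

Let uniq_l0 : uniq l0.
Proof. by rewrite (perm_uniq perm_l0) iota_uniq. Qed.

Lemma down_count_lt x y : x < n -> y < n -> x != y -> lep x y ->
  down_count n lep x < down_count n lep y.
Proof.
move=> xn yn xy le_xy.
have h : count (pred1 y) (iota 0 n) = 1 by rewrite count_uniq_mem ?iota_uniq // mem_iota yn.
rewrite /down_count -addn1 -h -count_predUI [X in _ + X](@eq_count _ _ pred0) ?count_pred0 ?addn0.
  apply: sub_count => z /= /orP[zx|/eqP-> //]; exact: lep_trans le_xy.
move=> z /=; apply/negP => /andP[zx /eqP e]; rewrite e in zx.
by move: xy; rewrite (lep_anti xn yn le_xy zx) eqxx.
Qed.

Lemma extends_by_down_count : extends lep l0.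
Proof.
move=> x y; rewrite !mem_l0 => xn yn xy le_xy; have lt_xy := down_count_lt xn yn xy le_xy.
pose A j := flatten [seq [seq z <- iota 0 n | down_count n lep z == h] | h <- iota 0 j].
have mA z j : z < n -> (z \in A j) = (down_count n lep z < j).
  move=> zn; apply/flattenP/idP => [[l /mapP[h hj ->]]|zj].
    by rewrite mem_filter => /andP[/eqP-> _]; move: hj; rewrite mem_iota.
  exists [seq z' <- iota 0 n | down_count n lep z' == down_count n lep z].
    by apply/mapP; exists (down_count n lep z); rewrite ?mem_iota.
  by rewrite mem_filter eqxx mem_iota.
have le_yn : down_count n lep y <= n.+1.
  by rewrite -{2}(size_iota 0 n) ltnW // ltnS count_size.
rewrite /by_down_count -(subnKC le_yn) iotaD map_cat flatten_cat.
by apply: before_cat_l; rewrite -/(A _) mA ?ltnn.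
Qed.

(** Reversal turns first occurrences into last ones and descending positions into increasing ones,
    so the visiting order becomes the closed form of [raised_undup]. *)
Lemma emitted_upward col c :
  emitted n lep l0 0 col c = raised lep l0 [seq s <- iota 0 n | col s == c].
Proof.
rewrite raised_undup // /emitted /undup_first revK /visit_order /src /= rev_cat revK.
congr (undup (_ ++ _)); rewrite /lists_of_class rev_flatten -map_comp -map_rev -filter_rev.
rewrite descendingE revK; congr flatten; apply: eq_map => s.
by rewrite /= /related_list /src /= filter_rev revK.
Qed.

Lemma emitted_downward col c :
  emitted n lep l0 1 col c = rev (raised gep (rev l0) [seq s <- iota 0 n | col s == c]).
Proof.
rewrite raised_undup ?rev_uniq // /emitted /undup_first /visit_order /src /= rev_cat.
congr (rev (undup (_ ++ _))); rewrite /lists_of_class rev_flatten -map_comp -map_rev -filter_rev.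
rewrite descendingE revK; congr flatten; apply: eq_map => s.
by rewrite /= /related_list /src /= filter_rev.
Qed.

Let gep_trans : transitive gep.
Proof. by move=> y x z h1 h2; apply: lep_trans h2 h1. Qed.

Let extends_rev : extends gep (rev l0).
Proof.
move=> x y; rewrite !mem_rev => xl yl xy yx; rewrite before_rev //.
by apply: extends_by_down_count => //; rewrite eq_sym.
Qed.

Lemma perm_emitted k col c : perm_eq (emitted n lep l0 k col c) (iota 0 n).
Proof.
rewrite /emitted; case: ifP => _; last exact: perm_undup_visit.
by rewrite perm_rev; apply: perm_undup_visit.
Qed.

Lemma extends_emitted k col c : k < 2 -> extends lep (emitted n lep l0 k col c).
Proof.
case: k => [|[|//]] _; rewrite ?emitted_upward ?emitted_downward.
  by apply: extends_raised => //; exact: extends_by_down_count.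
move=> x y; rewrite !mem_rev => xL yL xy le_xy; rewrite before_rev //.
  by apply: extends_raised => //; rewrite eq_sym.
by apply: uniq_raised; rewrite rev_uniq.
Qed.

Lemma emitted_separates_open_pair col v u : v < u -> u < n -> ~~ cmp_rel lep v u ->
  ~~ bad_pair lep l0 col (v, u) ->
  before (emitted n lep l0 0 col (col u)) v u /\ before (emitted n lep l0 1 col (col u)) u v.
Proof.
move=> vu un; rewrite /cmp_rel negb_or => /andP[nvu nuv] good; have vn := ltn_trans vu un.
have idx z : z < n -> index z (iota 0 n) = z.
  move=> zn; rewrite -{1}[z]add0n -(@nth_iota 0 0 n z zn) index_uniq ?size_iota ?iota_uniq //.
have key w : w \in iota 0 n -> col w == col u -> cmp_rel lep v w -> index w (iota 0 n) < index u (iota 0 n).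
  rewrite mem_iota /= => wn cw vw; rewrite !idx // ltnNge; apply: contra good => uw; apply/hasP; exists w => //.
  by rewrite mem_filter mem_l0 /= vw (leq_trans (ltnW vu) uw) wn.
split.
  rewrite emitted_upward; apply: class_separates => //; rewrite ?iota_uniq ?mem_iota ?mem_l0 //.
  by move=> w wi cw wv; apply: key => //; rewrite /cmp_rel wv orbT.
rewrite emitted_downward before_rev ?mem_raised ?mem_rev ?mem_l0 //; last first.
  by apply: uniq_raised; rewrite rev_uniq.
apply: class_separates; rewrite ?rev_uniq ?iota_uniq ?mem_iota ?mem_rev ?mem_l0 //.
by move=> w wi cw wv; apply: key => //; rewrite /cmp_rel wv.
Qed.

Lemma emitted_separates (cols : seq (nat -> nat)) K8 : 0 < size cols -> 0 < K8 ->
  (forall i x, i < size cols -> x < n -> nth id cols i x < K8) ->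
  [seq p <- open_pairs n lep | all (fun col => bad_pair lep l0 col p) cols] = [::] ->
  forall x y, x < n -> y < n -> x != y -> ~~ lep x y ->
  exists i c k, [/\ i < size cols, c < K8, k < 2 & before (emitted n lep l0 k (nth id cols i) c) y x].
Proof.
move=> T0 K0 hc nil_bad x y xn yn xy nxy.
have [yx|nyx] := boolP (lep y x).
  (* A comparable pair is ordered correctly by every emitted list, so the choice is arbitrary. *)
  exists 0, 0, 0; split=> //; apply: extends_emitted => //; last by rewrite eq_sym.
    by rewrite (perm_mem (perm_emitted _ _ _)) mem_iota.
  by rewrite (perm_mem (perm_emitted _ _ _)) mem_iota.
have get v u : v < u -> u < n -> ~~ cmp_rel lep v u -> exists i, [/\ i < size cols,
    nth id cols i u < K8 & ~~ bad_pair lep l0 (nth id cols i) (v, u)].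
  move=> vu un nc; have vn := ltn_trans vu un.
  have : (v, u) \in open_pairs n lep.
    apply/flattenP; exists (open_pairs_from lep v n).
      by apply/mapP; exists v; rewrite ?mem_iota.
    by apply/mapP; exists u; rewrite // mem_filter /open_pair vu nc mem_iota.
  have [hb|] := boolP (all (fun col => bad_pair lep l0 col (v, u)) cols).
    by move=> h; have := in_nil (v, u); rewrite -nil_bad mem_filter hb h.
  rewrite -has_predC => /(has_nthP id)[i hi good] _.
  by exists i; split=> //; apply: hc.
have nc : ~~ cmp_rel lep x y by rewrite /cmp_rel negb_or nxy.
case: (ltngtP x y) => hi.
- have [i [h1 h2 h3]] := get _ _ hi yn nc.
  exists i, (nth id cols i y), 1; split=> //.
  by have [] := emitted_separates_open_pair hi yn nc h3.
- rewrite cmpC in nc; have [i [h1 h2 h3]] := get _ _ hi xn nc.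
  exists i, (nth id cols i x), 0; split=> //.
  by have [] := emitted_separates_open_pair hi xn nc h3.
- by rewrite hi eqxx in xy.
Qed.

End EmittedOrders.

(** * From positions back to elements of the poset *)

Lemma nth_allpairs (A B C : Type) (z : C) (x0 : A) (y0 : B) (g : A -> B -> C) s t i j :
  i < size s -> j < size t ->
  nth z [seq g x y | x <- s, y <- t] (i * size t + j) = g (nth x0 s i) (nth y0 t j).
Proof.
elim: s i => // a s IH [|i] /= hi hj; rewrite nth_cat size_map.
  by rewrite mul0n hj (nth_map y0).
by rewrite mulSn -addnA ltnNge leq_addr /= addKn IH.
Qed.

Lemma size_flatten_const (A B : Type) (F : A -> seq B) m s : (forall x, size (F x) = m) ->
  size (flatten [seq F x | x <- s]) = size s * m.
Proof. by move=> h; elim: s => //= x s IH; rewrite size_cat h IH. Qed.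

Lemma index_map_in (A B : eqType) (g : A -> B) s x :
  (forall y, y \in s -> g y = g x -> y = x) -> index (g x) [seq g y | y <- s] = index x s.
Proof.
elim: s => //= a s IH h; have [->|ne] := eqVneq a x; first by rewrite !eqxx.
rewrite ifF ?IH // => [y ys|]; first by apply: h; rewrite inE ys orbT.
by apply: contraNF ne => /eqP e; apply/eqP/h; rewrite ?mem_head.
Qed.

Section Numbering.

Context {d : Order.disp_t} {P : finPOrderType d}.
Variable x0 : P.
Notation n := #|P|.

Definition element (i : nat) : P := nth x0 (enum P) i.
Definition rank (x : P) : nat := enum_rank x.
Definition le_index : rel nat := fun i j => (element i <= element j)%O.

Lemma rank_lt x : rank x < n.
Proof. exact: ltn_ord. Qed.

Lemma rankK : cancel rank element.
Proof. by move=> x; apply: nth_enum_rank. Qed.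

Lemma elementK i : i < n -> rank (element i) = i.
Proof.
move=> ni; have hi : i < size (enum P) by rewrite -cardE.
by apply/eqP; rewrite -(nth_uniq x0 _ hi (enum_uniq P)) -?cardE ?rank_lt // -/(element _) rankK.
Qed.

Lemma le_index_refl : reflexive le_index.
Proof. by move=> i; apply: lexx. Qed.

Lemma le_index_trans : transitive le_index.
Proof. by move=> j i k; apply: le_trans. Qed.

Lemma le_index_anti i j : i < n -> j < n -> le_index i j -> le_index j i -> i = j.
Proof.
move=> ni nj h1 h2; rewrite -(elementK ni) -(elementK nj); congr rank.
by apply/le_anti; rewrite -/(le_index i j) h1 -/(le_index j i).
Qed.

Lemma encode_posetE : exists l, encode_poset P = n :: l /\
  forall i j, i < n -> j < n -> nth 0 l (i * n + j) = le_index i j.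
Proof.
eexists; split; first by [].
move=> i j ni nj; rewrite {1}cardE (@nth_allpairs _ _ _ 0 x0 x0) -?cardE //.
Qed.

Lemma map_element : [seq element i | i <- iota 0 n] = enum P.
Proof. by rewrite cardE; apply: mkseq_nth. Qed.

Lemma map_rank : [seq rank x | x <- enum P] = iota 0 n.
Proof.
rewrite -map_element -map_comp map_id_in // => i; rewrite mem_iota => ni.
exact: elementK.
Qed.

Lemma count_iota_card (p : pred nat) : count p (iota 0 n) = #|[set x : P | p (rank x)]|.
Proof.
rewrite -map_rank count_map -size_filter cardE /enum_mem; congr size.
rewrite -filter_predI; apply: eq_filter => x; rewrite /= andbT.
by rewrite -[RHS]/(x \in [set x | p (rank x)]) inE.
Qed.

Variables (f : nat -> nat) (K : nat).
Hypothesis elim_f : elimination n le_index f n K.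

Lemma elimination_gt0 : 0 < K.
Proof.
have [_ lt_f le_K _] := elim_f.
have n0 : 0 < n by apply/card_gt0P; exists x0.
apply: leq_trans (le_K 0 n0); rewrite -has_count; apply/hasP; exists (f 0).
  by rewrite mem_iota lt_f.
by rewrite /cmp_rel /= /le_index lexx.
Qed.

Definition placed (i : nat) : P := element (f i).

Lemma placed_inj i j : i < n -> j < n -> placed i = placed j -> i = j.
Proof.
move=> ni nj e; apply: (elim_inj elim_f) => //.
by rewrite -(elementK (elim_lt elim_f ni)) -(elementK (elim_lt elim_f nj)) -/(placed i) e.
Qed.

Lemma placed_onto x : exists2 i, i < n & placed i = x.
Proof.
have : rank x \in mkseq f n by rewrite (perm_mem (perm_elim elim_f)) mem_iota rank_lt.
by case/mapP=> i; rewrite mem_iota => /= ni e; exists i; rewrite // /placed -e rankK.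
Qed.

Lemma perm_placed (L : seq nat) : perm_eq L (iota 0 n) ->
  perm_eq [seq element y | y <- [seq f i | i <- L]] (enum P).
Proof.
move=> pL; rewrite -map_element; apply: perm_map.
by apply: perm_trans (perm_map f pL) _; apply: perm_elim elim_f.
Qed.

Lemma index_placed L i : perm_eq L (iota 0 n) -> i < n ->
  index (placed i) [seq placed j | j <- L] = index i L.
Proof.
move=> pL ni; apply: index_map_in => j; rewrite (perm_mem pL) mem_iota => nj.
exact: placed_inj.
Qed.

(** The elimination order itself is the required enumeration; [K] counts each element along with its
    later neighbours, and leaving it out gives K - 1. *)
Lemma degenerate_elimination : degenerate (@comparability d P) K.-1.
Proof.
pose s := [seq element y | y <- [seq f i | i <- iota 0 n]].
have ps : perm_eq s (enum P) by apply: perm_placed.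
have szs : size s == n by rewrite !size_map size_iota.
apply/existsP; exists (Tuple szs) => /=; apply/andP; split.
  by rewrite (perm_uniq ps) enum_uniq.
have idx i : i < n -> index (placed i) s = i.
  move=> ni; rewrite /s -map_comp index_placed //.
  by rewrite -{1}[i]add0n -(@nth_iota 0 0 n i ni) index_uniq ?size_iota ?iota_uniq.
apply/forallP => x; have [i ni <-] := placed_onto x; rewrite idx //.
have [_ _ le_K _] := elim_f.
have := le_K i ni; rewrite (residual_degree_pos elim_f ni) => h.
rewrite -ltnS (prednK elimination_gt0); apply: leq_trans h.
rewrite -addn1 -(_ : count (pred1 i) (iota 0 n) = 1); last first.
  by rewrite count_uniq_mem ?iota_uniq // mem_iota ni.
set p := fun j : nat => _.
apply: leq_trans (_ : count [pred j | (i < j) && cmp_rel (pos_le le_index f) i j] (iota 0 n) + count (pred1 i) (iota 0 n) <= _).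
  rewrite leq_add2r -size_filter.
  apply: leq_trans (_ : #|[seq placed j | j <- [seq j <- iota 0 n | (i < j) && cmp_rel (pos_le le_index f) i j]]| <= _); last first.
    by apply: leq_trans (card_size _) _; rewrite size_map.
  apply/subset_leq_card/subsetP => y; rewrite inE; have [j nj <-] := placed_onto y.
  rewrite idx // => /andP[/andP[_ cij] ij]; apply: map_f.
  by rewrite mem_filter mem_iota /= ij; apply/andP.
rewrite -count_predUI [X in _ + X](@eq_count _ _ pred0) ?count_pred0 ?addn0.
  apply: sub_count => j /= /orP[/andP[ij cij]|/eqP->]; rewrite /p ?(ltnW ij) //.
  by rewrite leqnn /cmp_rel /pos_le /le_index lexx.
by move=> j /=; case: eqP => [->|]; rewrite ?ltnn ?andbF.
Qed.

(** Take the stage at which [K] is attained. In any enumeration, the first of the elements still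
    present is comparable to at least K - 1 others still present, and all of these succeed it. *)
Lemma elimination_le_degenerate k : degenerate (@comparability d P) k -> K <= k.+1.
Proof.
have [_ _ _ [->//|[i ni hK]]] := elim_f => /existsP[s /andP[us /forallP hs]].
pose U := [pred x : P | rank x \notin mkseq f i].
have U0 : U (placed i).
  by rewrite /= (elementK (elim_lt elim_f ni)) (mem_elim_prefix elim_f) ?ltnn // ltnW.
case: (arg_minnP (fun x : P => index x s) U0) => x Ux minx.
have := hK _ (rank_lt x) Ux; rewrite /residual_degree count_iota_card => h.
apply: leq_trans h _; rewrite (cardsD1 x) -add1n; apply: leq_add; first exact: leq_b1.
apply: leq_trans (hs x); apply/subset_leq_card/subsetP => y; rewrite !inE.
case/and3P=> yx Uy; rewrite /cmp_rel /le_index !rankK => cxy.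
rewrite /comparability eq_sym yx /Order.comparable cxy /= ltn_neqAle minx // andbT.
have ins z : z \in s.
  have hsz : size (enum P) <= size s by rewrite size_tuple -cardE.
  by have [_ ->] := uniq_min_size us (fun y _ => mem_enum P y) hsz; rewrite mem_enum.
by apply: contra yx => /eqP e; rewrite -(nth_index x (ins y)) -e nth_index.
Qed.

Lemma elimination_degeneracy : K.-1 = degeneracy (@comparability d P).
Proof.
rewrite /degeneracy; case: ex_minnP => k dk mink; apply/eqP; rewrite eqn_leq.
rewrite mink ?degenerate_elimination // andbT -ltnS (prednK elimination_gt0).
exact: elimination_le_degenerate.
Qed.

Notation lep := (pos_le le_index f).
Notation l0 := (base_order n le_index f).

Lemma output_orders (cols : seq (nat -> nat)) K8 : 0 < size cols -> 0 < K8 ->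
  (forall i x, i < size cols -> x < n -> nth id cols i x < K8) ->
  [seq p <- open_pairs n lep | all (fun col => bad_pair lep l0 col p) cols] = [::] ->
  exists ss : seq (seq P),
  [/\ encode_orders ss = flatten (flatten [seq round_output n lep l0 f K8 col | col <- cols]),
      all (fun s => perm_eq s (enum P)) ss,
      realizer (mem (map (@listed_order d P) ss)) &
      size ss = size cols * (K8 * 2)].
Proof.
move=> T0 K0 hc nil_bad.
have pl0 := perm_base_order n le_index f.
have rp : reflexive lep by move=> x; apply: le_index_refl.
have tp : transitive lep by move=> y x z; apply: le_index_trans.
have ap x y : x < n -> y < n -> lep x y -> lep y x -> x = y.
  move=> xn yn h1 h2; apply: (elim_inj elim_f) => //.
  by apply: le_index_anti => //; apply: (elim_lt elim_f).
pose W := flatten [seq round_output n lep l0 f K8 col | col <- cols].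
have sz_W : size W = size cols * (K8 * 2).
  by apply: size_flatten_const => col; rewrite (size_flatten_const (m := 2)) ?size_iota.
have W_P L : L \in W -> exists E, [/\ L = [seq f y | y <- E], perm_eq E (iota 0 n) & extends lep E].
  case/flattenP=> _ /(nthP [::])[i hi <-].
  rewrite size_map in hi; rewrite (nth_map id) //; case/flattenP=> _ /mapP[c _ ->].
  rewrite !inE => /orP[] /eqP->.
    exists (emitted n lep l0 0 (nth id cols i) c); split=> //; first exact: perm_emitted.
    exact: extends_emitted.
  exists (emitted n lep l0 1 (nth id cols i) c); split=> //; first exact: perm_emitted.
  exact: extends_emitted.
have W_in i c k : i < size cols -> c < K8 -> k < 2 ->
    [seq f y | y <- emitted n lep l0 k (nth id cols i) c] \in W.
  move=> hi hcK k2; apply/flattenP; exists (round_output n lep l0 f K8 (nth id cols i)).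
    by rewrite -(nth_map id [::] (round_output n lep l0 f K8)) // mem_nth ?size_map.
  apply/flattenP; exists (class_output n lep l0 f (nth id cols i) c).
    by apply/mapP; exists c; rewrite ?mem_iota.
  by rewrite !inE; case: k k2 => [|[|//]] _; rewrite eqxx ?orbT.
exists [seq [seq element y | y <- L] | L <- W]; split.
- rewrite /encode_orders -map_comp -/W; congr flatten; rewrite -[RHS]map_id.
  apply/eq_in_map => L /W_P[E [-> pE _]]; rewrite /= -!map_comp.
  apply/eq_in_map => i; rewrite (perm_mem pE) mem_iota => /= ni.
  exact: elementK (elim_lt elim_f ni).
- by rewrite all_map; apply/allP => L /W_P[E [-> pE _]] /=; apply: perm_placed.
- apply: realizerI => [_ /mapP[_ /mapP[L /W_P[E [-> pE eE]] ->] ->]|x y xy nxy].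
    apply: listed_linear_extension => [x|x y].
      by rewrite (perm_mem (perm_placed pE)) mem_enum.
    have [i ni <-] := placed_onto x; have [j nj <-] := placed_onto y => le_ij.
    rewrite -map_comp !index_placed //.
    have [->//|ne] := eqVneq i j; apply: ltnW; apply: eE => //.
      by rewrite (perm_mem pE) mem_iota.
    by rewrite (perm_mem pE) mem_iota.
  move: xy nxy; have [i ni <-] := placed_onto x; have [j nj <-] := placed_onto y => xy nxy.
  have ne : i != j by apply: contra xy => /eqP->.
  have [a [c [k [ha hcK k2 bf]]]] := emitted_separates rp tp ap pl0 T0 K0 hc nil_bad ni nj ne nxy.
  have pE := perm_emitted pl0 k (nth id cols a) c.
  exists (listed_order [seq element y | y <- [seq f y | y <- emitted n lep l0 k (nth id cols a) c]]).
    by apply: map_f; apply: map_f; apply: W_in.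
  by rewrite mem_listed_order -map_comp !index_placed // -ltnNge.
- by rewrite size_map.
Qed.

End Numbering.

(** A single element has no comparabilities. Two elements make log n positive, from which the
    estimates for the number of rounds start. *)
Lemma card_gt1_degeneracy {d : Order.disp_t} (P : finPOrderType d) :
  0 < degeneracy (@comparability d P) -> 1 < #|P|.
Proof.
rewrite !ltnNge; apply: contra => le1; rewrite /degeneracy.
case: ex_minnP => k _; apply; apply/existsP; exists (enum_tuple P).
rewrite enum_uniq; apply/forallP => x; rewrite leqn0 cards_eq0; apply/eqP/setP => y.
by rewrite !inE /comparability (fintype_le1P le1 x y) eqxx.
Qed.

From mathcomp Require Import all_algebra ring lra.
From mathcomp Require Import boolp classical_sets functions reals topology normedtype sequences derive realfun exp.

Import GRing.Theory Num.Theory numFieldNormedType.Exports.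
Local Open Scope ring_scope.

(** * Rational approximation of powers of e *)

Section ExponentialAtOne.

Variable R : realType.

Definition exp_partial (j : nat) : R := \sum_(i < j.+1) (i`!%:R)^-1.

Lemma exp_partial_le_e j : exp_partial j <= expR 1.
Proof.
have -> : exp_partial j = series (exp_coeff 1) j.+1.
  by rewrite /series /= big_mkord; apply: eq_bigr => i _; rewrite /exp_coeff /= expr1n mul1r.
apply: nondecreasing_cvgn_le; last exact: is_cvg_series_exp_coeff.
by apply: nondecreasing_series => i _ _; apply: exp_coeff_ge0.
Qed.

Lemma exp_partialS j : exp_partial j.+1 = exp_partial j + (j.+1`!%:R)^-1.
Proof. by rewrite /exp_partial big_ord_recr. Qed.

(** Adding 1/j! to the j-th partial sum gives a sequence that does not increase, since 2/(j + 1)! <=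
    1/j! for j >= 1; each of its values thus bounds all later partial sums. *)
Lemma e_le_exp_partial j : (0 < j)%N -> expR 1 <= exp_partial j + (j`!%:R)^-1.
Proof.
move=> j0.
have mono i : (j <= i)%N -> exp_partial i + (i`!%:R)^-1 <= exp_partial j + (j`!%:R)^-1.
  elim: i => [|i IH]; first by rewrite leqn0 => /eqP e; rewrite e in j0.
  rewrite leq_eqVlt => /orP[/eqP->//|]; rewrite ltnS => ji.
  apply: le_trans (IH ji); rewrite exp_partialS -addrA lerD2l factS natrM invfM.
  have fi : 0 < (i`!%:R : R)^-1 by rewrite invr_gt0 ltr0n fact_gt0.
  rewrite -mulrDl -[leRHS]mul1r ler_pM2r // -mulr2n -[_ *+ 2]mulr_natr ler_pdivrMl ?ltr0n // mulr1.
  by rewrite ler_nat ltnS; apply: leq_trans ji.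
rewrite /expR; apply: limr_le; first exact: is_cvg_series_exp_coeff.
exists j.+1 => // i /= ji.
have -> : series (exp_coeff 1) i = exp_partial i.-1.
  rewrite -[in LHS](prednK (leq_ltn_trans (leq0n _) ji)) /series /= big_mkord.
  by apply: eq_bigr => h _; rewrite /exp_coeff /= expr1n mul1r.
have ji' : (j <= i.-1)%N by rewrite -ltnS prednK //; apply: leq_ltn_trans ji.
by apply: le_trans (mono _ ji'); rewrite lerDl invr_ge0 ler0n.
Qed.

Lemma e_le3 : expR 1 <= 3 :> R.
Proof.
apply: le_trans (@e_le_exp_partial 2 _) _ => //.
rewrite !exp_partialS /exp_partial big_ord1 fact0 (_ : 1`! = 1)%N // (_ : 2`! = 2)%N //.
lra.
Qed.

Lemma e_ge1 : 1 <= expR 1 :> R.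
Proof. by rewrite -[leLHS]expR0 ler_expR. Qed.

Lemma bernoulli (t : R) n : 0 <= t <= 1 -> 1 - n%:R * t <= (1 - t) ^+ n.
Proof.
case/andP=> t0 t1; elim: n => [|n IH]; first by rewrite mul0r subr0 expr0.
have h : 0 <= 1 - t by rewrite subr_ge0.
rewrite exprS; apply: le_trans (ler_wpM2l h IH).
have : 0 <= n%:R * t * t by rewrite !mulr_ge0.
by rewrite -natr1; nra.
Qed.

(** The partial sum is e (1 - t) with 0 <= t <= 1/j!, and Bernoulli's inequality applies to (1 -
    t)^a. *)
Lemma exp_partial_expn a j : (0 < j)%N ->
  expR a%:R - a%:R * expR a%:R / j`!%:R <= exp_partial j ^+ a.
Proof.
move=> j0; set E := expR 1 : R; have E1 : 1 <= E := e_ge1.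
have E0 : 0 < E := expR_gt0 1.
have Ea : expR a%:R = E ^+ a by rewrite -[a%:R]mulr1 expRM_natl.
have le1 := exp_partial_le_e j; have le2 := e_le_exp_partial j0.
have x0 : 0 <= exp_partial j by rewrite sumr_ge0 // => i _; rewrite invr_ge0.
pose t := (E - exp_partial j) / E.
have t01 : 0 <= t <= 1.
  apply/andP; split; first by rewrite divr_ge0 ?subr_ge0 // ltW.
  by rewrite ler_pdivrMr // mul1r gerBl.
have tle : t <= (j`!%:R)^-1.
  rewrite ler_pdivrMr //; apply: (@le_trans _ _ (j`!%:R)^-1); first by rewrite lerBlDl.
  by rewrite ler_peMr // invr_ge0.
have -> : exp_partial j = E * (1 - t) by rewrite /t mulrBr mulr1 mulrCA divff ?gt_eqF // mulr1 opprB addrC subrK.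
rewrite exprMn Ea; apply: le_trans (ler_wpM2l _ (bernoulli a t01)); last by rewrite exprn_ge0 // ltW.
rewrite mulrBr mulr1 lerD2l lerN2 mulrCA -mulrA ler_wpM2l //.
by rewrite ler_wpM2l // exprn_ge0 // ltW.
Qed.

(** The series of e^n contains the term n^n / n!. *)
Lemma factorial_ge (n : nat) : (n%:R / expR 1) ^+ n <= (n`!%:R : R).
Proof.
rewrite expr_div_n ler_pdivrMr ?exprn_gt0 ?expR_gt0 // -expRM_natl mulr1.
case: n => [|n]; first by rewrite expr0 fact0 mul1r expR0.
have := @expR_ge1Dxn R n.+1%:R n (ler0n _ _).
rewrite -ler_pdivrMl ?ltr0n ?fact_gt0 // mulrC => h; apply: le_trans h.
by rewrite lerDr.
Qed.

(** From n >= 9 >= e^2 it follows that n / e >= e. *)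
Lemma factorial_ge_exp (n : nat) : (9 <= n)%N -> expR n%:R <= (n`!%:R : R).
Proof.
move=> n9; apply: le_trans (factorial_ge n).
have -> : expR n%:R = expR 1 ^+ n :> R by rewrite -{1}[n%:R]mulr1 expRM_natl.
have E0 : 0 < expR 1 :> R := expR_gt0 1.
apply: lerXn2r; rewrite ?nnegrE ?expR_ge0 ?divr_ge0 ?expR_ge0 //.
rewrite ler_pdivlMr //.
have h : (9 : R) <= n%:R by rewrite ler_nat.
have := e_le3; have := e_ge1; nra.
Qed.

End ExponentialAtOne.

(** * Hermite's integral and the distance of e^a from integers *)

Section HermiteIntegers.

Variables a r : nat.

(** The polynomial f in Hermite's integral of e^x f(x) over [0, a]. *)
Definition hermite_int : {poly int} := 'X^r * (a%:R%:P - 'X) ^+ r.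

(** Multiplication by a - X enlarges the sum of the absolute values of the coefficients at most by
    the factor a + 1. *)
Lemma sum_coef_power (m N : nat) :
  \sum_(i < N) `|((a%:R%:P - 'X : {poly int}) ^+ m)`_i| <= (a.+1%:R : int) ^+ m.
Proof.
elim: m N => [|m IH] N.
  rewrite !expr0; under eq_bigr => i _ do rewrite coef1.
  case: N => [|N]; first by rewrite big_ord0.
  by rewrite big_ord_recl big1 // addr0.
set h := _ ^+ m in IH *; rewrite exprS -/h mulrBl.
have le1 : \sum_(i < N) `|(a%:R%:P * h - 'X * h)`_i| <=
    a%:R * \sum_(i < N) `|h`_i| + \sum_(i < N) `|('X * h)`_i|.
  rewrite big_distrr -big_split /=; apply: ler_sum => i _.
  rewrite coefB coefCM; apply: le_trans (ler_normB _ _) _.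
  by rewrite normrM [`|a%:R|]ger0_norm.
have le2 : \sum_(i < N) `|('X * h)`_i| <= \sum_(i < N) `|h`_i|.
  case: N {le1} => [|N]; first by rewrite !big_ord0.
  rewrite big_ord_recl coefXM /= normr0 add0r [leRHS]big_ord_recr /=.
  rewrite (eq_bigr (fun i : 'I_N => `|h`_i|)) ?lerDl // => i _.
  by rewrite coefXM /bump /=.
apply: le_trans le1 _; apply: le_trans (lerD (lexx _) le2) _.
rewrite exprS -[X in _ <= X * _]natr1 mulrDl mul1r.
by apply: lerD; [apply: ler_wpM2l|].
Qed.

(** The i-th derivative of f at 0 divided by r!. It is an integer: below [r] it vanishes, and from
    [r] on it is i!/r! times a coefficient. *)
Definition hermite_coef (i : nat) : int :=
  if (i < r)%N then 0 else (i`! %/ r`!)%N%:Z * hermite_int`_i.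

Lemma hermite_coefE i : (hermite_int^`(i)).[0] = r`!%:R * hermite_coef i.
Proof.
rewrite nderivn_def hornerMn horner_coef0 coef_nderivn addn0 binn mulr1n.
rewrite /hermite_coef; case: ltnP => ir.
  by rewrite /hermite_int coefXnM ir mul0rn mulr0.
have /dvdnP[q e] : (r`! %| i`!)%N.
  by rewrite -(bin_fact ir) mulnCA dvdn_mulr.
rewrite e mulnK ?fact_gt0 // mulrA -[X in _ *+ X]/(q * r`!)%N -mulr_natl natrM.
by rewrite [q%:R * _]mulrC; congr (_ * _ * _); rewrite natz.
Qed.

(** For F = f - f' + f'' - ... these are F(a)/r! and F(0)/r!. The signs disappear from the first
    because f(a - x) = f(x), which makes the i-th derivatives at a and at 0 differ by the factor
    (-1)^i. *)
Definition hermite_A : int := \sum_(i < (2 * r).+1) hermite_coef i.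
Definition hermite_B : int := \sum_(i < (2 * r).+1) (-1) ^+ i * hermite_coef i.

Lemma hermite_A_le : `|hermite_A| <= (2 * r)`!%:R * a.+1%:R ^+ r.
Proof.
have fact_mono (m p : nat) : (m <= p)%N -> (m`! <= p`!)%N.
  by move=> mp; apply: dvdn_leq; [exact: fact_gt0 | rewrite -(bin_fact mp) mulnCA dvdn_mulr].
apply: le_trans (ler_norm_sum _ _ _) _.
apply: le_trans (_ : \sum_(i < (2 * r).+1) (2 * r)`!%:R * `|hermite_int`_i| <= _).
  apply: ler_sum => i _; rewrite /hermite_coef; case: ltnP => _.
    by rewrite normr0 mulr_ge0.
  rewrite normrM ler_wpM2r // natz lez_nat; apply: leq_trans (leq_div _ _) _.
  by apply: fact_mono; rewrite -ltnS.
rewrite -big_distrr /=; apply: ler_wpM2l => //.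
apply: le_trans (sum_coef_power r r.+1).
rewrite (_ : (2 * r).+1 = r + r.+1)%N; last by rewrite mul2n -addnn addnS.
rewrite big_split_ord /= big1 ?add0r; last first.
  by move=> i _; rewrite /hermite_int coefXnM ltn_ord normr0.
apply: ler_sum => i _; rewrite /hermite_int coefXnM /= ltnNge leq_addr /= addKn.
exact: lexx.
Qed.

End HermiteIntegers.

Section HermiteReal.

Variables (R : realType) (a r : nat).

Definition hermite_poly : {poly R} := 'X^r * (a%:R%:P - 'X) ^+ r.

Lemma hermite_poly_map : hermite_poly = map_poly intr (hermite_int a r).
Proof.
rewrite /hermite_int rmorphM rmorphXn /= map_polyX rmorphXn /= rmorphB /= map_polyX.
by rewrite map_polyC /= rmorph_nat.
Qed.

Lemma derivn_reflect (p : {poly R}) (c : R) i :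
  (p \Po (c%:P - 'X))^`(i) = (-1) ^+ i *: (p^`(i) \Po (c%:P - 'X)).
Proof.
elim: i => [|i IH]; first by rewrite !derivn0 expr0 scale1r.
rewrite !derivnS IH derivZ deriv_comp derivB derivC derivX sub0r mulrN1.
by rewrite exprS mulN1r scaleNr scalerN.
Qed.

Lemma hermite_symmetric : hermite_poly \Po (a%:R%:P - 'X) = hermite_poly.
Proof.
rewrite /hermite_poly comp_polyM comp_Xn_poly rmorphXn /= comp_polyB comp_polyC comp_polyX.
by rewrite subKr mulrC.
Qed.

Lemma hermite_at0 i : (hermite_poly^`(i)).[0] = r`!%:R * (hermite_coef a r i)%:~R.
Proof.
rewrite hermite_poly_map derivn_map -[0 : R](rmorph0 (intr : {rmorphism int -> R})).
by rewrite horner_map hermite_coefE /= rmorphM /= rmorph_nat.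
Qed.

Lemma hermite_ata i : (hermite_poly^`(i)).[a%:R] = (-1) ^+ i * (r`!%:R * (hermite_coef a r i)%:~R).
Proof.
rewrite -hermite_at0 -{1}hermite_symmetric derivn_reflect hornerZ horner_comp !hornerE.
by rewrite subrr.
Qed.

(** The polynomial F obtained by repeated integration by parts: F + F' = f, so that e^x F(x) is an
    antiderivative of e^x f(x). *)
Definition hermite_sum : {poly R} := \sum_(i < (2 * r).+1) (-1) ^+ i *: hermite_poly^`(i).

Lemma hermite_sum0 : hermite_sum.[0] = r`!%:R * (hermite_B a r)%:~R.
Proof.
rewrite horner_sum rmorph_sum big_distrr /=; apply: eq_bigr => i _.
by rewrite hornerZ hermite_at0 rmorphM rmorphXn /= rmorphN1 mulrCA.
Qed.

Lemma hermite_suma : hermite_sum.[a%:R] = r`!%:R * (hermite_A a r)%:~R.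
Proof.
rewrite horner_sum rmorph_sum big_distrr /=; apply: eq_bigr => i _.
by rewrite hornerZ hermite_ata mulrA -expr2 sqrr_sign mul1r.
Qed.

Lemma hermite_sum_deriv : hermite_sum + hermite_sum^`() = hermite_poly.
Proof.
have tele N : \sum_(i < N) (-1) ^+ i *: hermite_poly^`(i) +
    (\sum_(i < N) (-1) ^+ i *: hermite_poly^`(i))^`() =
    hermite_poly - (-1) ^+ N *: hermite_poly^`(N).
  elim: N => [|N IH]; first by rewrite !big_ord0 deriv0 addr0 expr0 scale1r derivn0 subrr.
  rewrite !big_ord_recr /= derivD addrACA IH derivZ -derivnS addrA subrK.
  by rewrite exprS mulN1r scaleNr opprK.
rewrite /hermite_sum tele derivn_poly0 ?scaler0 ?subr0 //.
apply: leq_trans (size_polyMleq _ _) _; rewrite size_polyXn /=.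
have sz : (size ((a%:R%:P - 'X)%R : {poly R}) <= 2)%N.
  apply: leq_trans (size_polyD _ _) _; rewrite size_polyN size_polyX geq_max andbT.
  exact: leq_trans (size_polyC_leq1 _) _.
apply: leq_trans (leq_add (leqnn r) (size_poly_exp_leq _ _)) _.
by rewrite addnS ltnS mul2n -addnn leq_add2l -[X in (_ <= X)%N]mul1n leq_mul2r orbC -subn1 leq_subLR sz.
Qed.

(** The mean value theorem for e^x F(x) stands in for the integral of e^x f(x) from x to y. *)
Lemma hermite_increment (x y : R) : x < y -> exists2 c, x < c < y &
  expR y * hermite_sum.[y] - expR x * hermite_sum.[x] =
  expR c * (c * (a%:R - c)) ^+ r * (y - x).
Proof.
move=> xy; pose phi : R -> R := ((expR : R -> R) * horner hermite_sum).
have dphi (z : R) : is_derive z (1 : R) phi (expR z * hermite_poly.[z]).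
  have h := is_deriveM (is_derive_expR z) (is_derive_poly hermite_sum z).
  apply: (is_derive_eq h).
  by rewrite -hermite_sum_deriv hornerD mulrDr addrC /= [_ *: expR z]mulrC.
have cont : {within `[x, y], continuous phi}%classic.
  apply: derivable_within_continuous => z _.
  by have [] := dphi z.
have [c cxy e] := MVT xy (fun z _ => dphi z) cont.
exists c; first by rewrite in_itv in cxy.
move: e; rewrite /phi /= => ->; rewrite /hermite_poly hornerM hornerXn horner_exp.
by rewrite hornerD hornerN hornerC hornerX exprMn.
Qed.

Definition hermite_form : R := r`!%:R * (expR a%:R * (hermite_A a r)%:~R - (hermite_B a r)%:~R).

Lemma hermite_formE :
  hermite_form = expR a%:R * hermite_sum.[a%:R] - expR 0 * hermite_sum.[0].
Proof. by rewrite hermite_suma hermite_sum0 expR0 mul1r /hermite_form mulrBr mulrCA. Qed.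

Lemma hermite_form_le : (0 < a)%N ->
  hermite_form <= a%:R * expR a%:R * (a%:R ^+ 2 / 4) ^+ r.
Proof.
move=> a0; have a0' : 0 < a%:R :> R by rewrite ltr0n.
have [c /andP[c0 ca]] := hermite_increment a0'; rewrite hermite_formE => ->.
rewrite subr0 mulrC -mulrA ler_wpM2l ?ler0n //.
have cac : 0 <= c * (a%:R - c) by apply: mulr_ge0; rewrite ?subr_ge0 ltW.
apply: ler_pM; [exact: expR_ge0 | exact: exprn_ge0 | by rewrite ler_expR ltW |].
apply: lerXn2r; rewrite ?nnegrE //; first by rewrite divr_ge0 // exprn_ge0.
rewrite ler_pdivlMr //.
by have := sqr_ge0 (a%:R - 2 * c); nra.
Qed.

(** The interval is cut at a/4 and a/2. The middle piece alone contributes at least 1, having length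
    a/4 >= 1 and c (a - c) >= 1 throughout; the outer pieces are nonnegative. *)
Lemma hermite_form_ge1 : (4 <= a)%N -> 1 <= hermite_form.
Proof.
move=> a4; have a4' : 4 <= a%:R :> R by rewrite ler_nat.
rewrite hermite_formE.
have x1 : 0 < a%:R / 4 :> R by lra.
have x2 : a%:R / 4 < a%:R / 2 :> R by lra.
have x3 : a%:R / 2 < a%:R :> R by lra.
have [c1 /andP[c10 c11] e1] := hermite_increment x1.
have [c2 /andP[c20 c21] e2] := hermite_increment x2.
have [c3 /andP[c30 c31] e3] := hermite_increment x3.
rewrite -(subrK (expR (a%:R / 2) * hermite_sum.[a%:R / 2]) (_ * hermite_sum.[a%:R])).
rewrite e3 -addrA -(subrK (expR (a%:R / 4) * hermite_sum.[a%:R / 4]) (expR (a%:R / 2) * _)).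
rewrite e2 -addrA e1 subr0.
have pos (c y : R) : 0 < c -> c < a%:R -> 0 <= y -> 0 <= expR c * (c * (a%:R - c)) ^+ r * y.
  move=> c0 ca y0; have cac : 0 <= c * (a%:R - c) by apply: mulr_ge0; rewrite ?subr_ge0 ltW.
  by apply: mulr_ge0 => //; apply: mulr_ge0; [exact: expR_ge0 | exact: exprn_ge0].
have p1 := pos c1 (a%:R / 4) c10 _ _; have p3 := pos c3 (a%:R - a%:R / 2) _ c31 _.
have {}p1 : 0 <= expR c1 * (c1 * (a%:R - c1)) ^+ r * (a%:R / 4) by apply: p1; lra.
have {}p3 : 0 <= expR c3 * (c3 * (a%:R - c3)) ^+ r * (a%:R - a%:R / 2) by apply: p3; lra.
suff : 1 <= expR c2 * (c2 * (a%:R - c2)) ^+ r * (a%:R / 2 - a%:R / 4) by lra.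
have h1 : 1 <= expR c2 by rewrite -[leLHS]expR0 ler_expR; lra.
have h2 : 1 <= (c2 * (a%:R - c2)) ^+ r by apply: exprn_ege1; nra.
have h3 : 1 <= expR c2 * (c2 * (a%:R - c2)) ^+ r by rewrite mulr_ege1.
by rewrite mulr_ege1 //; lra.
Qed.

(* The integer [A N - B] either vanishes or has absolute value at least 1,
   while [e^a A - B] is positive and tiny: hence [e^a - N] is not too small. *)
Lemma expR_nat_separation (N : nat) : (4 <= a)%N -> (2 <= r)%N ->
  2 * (a%:R * expR a%:R * (a%:R ^+ 2 / 4) ^+ r) <= r`!%:R :> R -> N%:R <= expR a%:R :> R ->
  1 <= (expR a%:R - N%:R) * (r`!%:R * ((2 * r)`!%:R * a.+1%:R ^+ r)) :> R.
Proof.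
move=> a4 r2 small leN; set dlt := expR a%:R - N%:R.
have d0 : 0 <= dlt by rewrite subr_ge0.
have f0 : 0 < r`!%:R :> R by rewrite ltr0n fact_gt0.
have f2 : 2 <= r`!%:R :> R by rewrite ler_nat (leq_trans r2) // fact_geq.
have le1 := hermite_form_le (leq_trans (isT : 0 < 4)%N a4).
have ge1 := hermite_form_ge1 a4.
set A : R := (hermite_A a r)%:~R; set z : int := hermite_A a r * N%:Z - hermite_B a r.
have form_z : hermite_form = r`!%:R * (dlt * A + z%:~R).
  rewrite /hermite_form /dlt /z rmorphB rmorphM /= -/A; congr (_ * _).
  by rewrite mulrBl [A * _]mulrC -[N%:Z]natz; set b := intr _ ; rewrite (_ : (N%:R : int)%:~R = N%:R :> R) ?rmorph_nat //; lra.
have Ale : `|A| <= (2 * r)`!%:R * a.+1%:R ^+ r.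
  have := hermite_A_le a r; rewrite -(ler_int R) /A intr_norm => h.
  by apply: le_trans h _; rewrite rmorphM rmorphXn /= !rmorph_nat.
(* The number r! (dlt A + z) lies between 1 and r!/2. Hence r! dlt A is at least 1 for z = 0, at
   most -r!/2 for z >= 1, and at least r! + 1 for z <= -1. *)
suff : 1 <= r`!%:R * (dlt * A) \/ r`!%:R * (dlt * A) <= -1.
  move=> h; apply: (@le_trans _ _ `|r`!%:R * (dlt * A)|).
    by case: h => h; [apply: le_trans h (ler_norm _) | rewrite ler_normr; apply/orP; right; lra].
  rewrite !normrM (ger0_norm d0) (ger0_norm (ltW f0)) mulrCA.
  by apply: ler_wpM2l => //; apply: ler_wpM2l; first exact: ltW.
have half : hermite_form <= r`!%:R / 2 by lra.
rewrite form_z mulrDr in half ge1.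
have [z0|z0] := eqVneq z 0; first by left; move: ge1; rewrite z0 mulr0 addr0.
have [zpos|zneg] : (1 <= z) \/ (z <= -1).
  by case: (ltgtP z 0) z0 => // hz _; [right; lia | left; lia].
  right; have : 1 <= z%:~R :> R by rewrite ler1z.
  by move=> hz; have := ler_wpM2l (ltW f0) hz; lra.
left; have : z%:~R <= -1 :> R by rewrite -(ler_int R) in zneg; move: zneg; rewrite rmorphN1.
by move=> hz; have := ler_wpM2l (ltW f0) hz; lra.
Qed.

End HermiteReal.

(** * Exactness of the test for the number of rounds *)

Section Precision.

Variable R : realType.

Lemma exp_numE j : (exp_num j)%:R = j`!%:R * exp_partial R j.
Proof.
have f0 i : (i`!%:R : R) != 0 by rewrite pnatr_eq0 -lt0n fact_gt0.
elim: j => [|j IH]; first by rewrite /exp_partial big_ord1 fact0 invr1 mulr1.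
rewrite exp_partialS mulrDr divff // [exp_num _]/(j.+1 * exp_num j + 1)%N natrD natrM IH.
by rewrite factS natrM mulrA.
Qed.

Lemma le_expR (x : R) : x <= expR x.
Proof. by apply: le_trans (expR_ge1Dx x); lra. Qed.

Lemma factorial_le_exp (j : nat) : (j`!%:R : R) <= expR (j ^ 2)%:R.
Proof.
have h : (j`! <= j ^ j)%N.
  by elim: j => // j IH; rewrite factS expnS leq_mul2l /=; apply: leq_trans IH _;
     case: j => // j; rewrite leq_exp2r.
apply: le_trans (_ : (j ^ j)%:R <= _); first by rewrite ler_nat.
rewrite natrX -mulnn natrM expRM_natl; apply: lerXn2r; rewrite ?nnegrE ?expR_ge0 //.
exact: le_expR.
Qed.

(** The denominator 3840 is 2^5 5!: for L = log n the quintic is a term of the series of e^(L/2) =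
    sqrt n. It dominates beyond [mu], and [C] takes care of smaller L. *)
Lemma polynomial_le_quintic (al : R) : 0 <= al ->
  exists C : R, forall L : R, 0 <= L -> al * (3 * L + 1) ^+ 4 <= L ^+ 5 / 3840 + C.
Proof.
move=> al0; pose mu := 1 + 3840 * (al * 4 ^+ 4); pose C := al * (3 * mu + 1) ^+ 4.
have mu1 : 1 <= mu by rewrite /mu lerDl !mulr_ge0 // exprn_ge0.
have C0 : 0 <= C by rewrite /C mulr_ge0 // exprn_ge0 //; lra.
exists C => L L0; have [Lmu|Lmu] := leP L mu.
  apply: le_trans (_ : C <= _); last by rewrite lerDr divr_ge0 // exprn_ge0.
  by rewrite /C ler_wpM2l //; apply: lerXn2r; rewrite ?nnegrE; lra.
apply: le_trans (_ : L ^+ 5 / 3840 <= _); last by rewrite lerDl.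
apply: le_trans (_ : al * (4 * L) ^+ 4 <= _).
  by rewrite ler_wpM2l //; apply: lerXn2r; rewrite ?nnegrE; lra.
rewrite exprMn mulrA ler_pdivlMr // [L ^+ 5]exprS mulrAC.
apply: ler_wpM2r; first by rewrite exprn_ge0.
by rewrite mulrC; move: Lmu; rewrite /mu; lra.
Qed.

(** Truncation changes e^a by at most a e^a / J!, whereas e^a - N is at least 1/Q. With r = 4 a^2,
    r! >= (r/e)^r = (16/e)^r (a^2/4)^r outgrows twice the upper bound for the integral. Moreover Q
    <= e^(6 r^2), which J! >= e^J beats together with a e^a as soon as J >= 8 r^2. *)
Lemma exp_partial_precise a J N : (4 <= a)%N -> (9 <= J)%N -> (8 * (4 * a ^ 2) ^ 2 <= J)%N ->
  N%:R <= expR a%:R :> R -> N%:R <= exp_partial R J ^+ a.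
Proof.
move=> a4 J9 leJ leN; set r := (4 * a ^ 2)%N in leJ.
have ar : (a <= r)%N by rewrite /r; nia.
have a4' : (4 : R) <= a%:R by rewrite ler_nat.
have E0 : 0 < expR 1 :> R := expR_gt0 1.
have small : 2 * (a%:R * expR a%:R * (a%:R ^+ 2 / 4) ^+ r) <= r`!%:R :> R.
  apply: le_trans (factorial_ge R r).
  have -> : r%:R / expR 1 = (16 / expR 1) * (a%:R ^+ 2 / 4) :> R.
    by rewrite /r natrM natrX; field; rewrite gt_eqF.
  rewrite [leRHS]exprMn [leLHS]mulrA; apply: ler_wpM2r; first by rewrite exprn_ge0 // divr_ge0 // exprn_ge0.
  apply: le_trans (_ : expR r%:R <= _); last first.
    rewrite -[r%:R]mulr1 expRM_natl; apply: lerXn2r; rewrite ?nnegrE ?expR_ge0 ?divr_ge0 ?expR_ge0 //.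
    by rewrite ler_pdivlMr //; have := e_le3 R; have := e_ge1 R; nra.
  apply: le_trans (_ : expR (a%:R + 3 * a%:R) <= _); last first.
    rewrite ler_expR /r natrM natrX; nra.
  rewrite expRD mulrA mulrC ler_wpM2l ?expR_ge0 //.
  by apply: le_trans (expR_ge1Dx _); lra.
have sep := expR_nat_separation a4 (leq_trans (isT : 2 <= 4)%N (leq_trans a4 ar)) small leN.
set Q : R := r`!%:R * _ in sep.
have Q0 : 0 < Q by rewrite /Q !mulr_gt0 ?ltr0n ?fact_gt0 // exprn_gt0 // ltr0n.
have J0 : 0 < J`!%:R :> R by rewrite ltr0n fact_gt0.
have leQ : Q <= expR (6 * r ^ 2)%:R.
  have e1 : (6 * r ^ 2)%N = (r ^ 2 + ((2 * r) ^ 2 + r * r))%N by lia.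
  rewrite e1 !natrD !expRD /Q; apply: ler_pM; rewrite ?mulr_ge0 ?exprn_ge0 //.
    exact: factorial_le_exp.
  apply: ler_pM; rewrite ?exprn_ge0 //; first exact: factorial_le_exp.
  rewrite natrM expRM_natl; apply: lerXn2r; rewrite ?nnegrE ?expR_ge0 //.
  apply: le_trans (expR_ge1Dx _); rewrite -natr1 addrC lerD2l ler_nat; exact: ar.
have key : a%:R * expR a%:R * Q <= J`!%:R.
  apply: le_trans (factorial_ge_exp R J9).
  apply: le_trans (_ : expR a%:R * expR a%:R * expR (6 * r ^ 2)%:R <= _).
    apply: ler_pM; [by rewrite mulr_ge0 ?expR_ge0 | exact: ltW | | exact: leQ].
    by apply: ler_wpM2r; [exact: expR_ge0 | exact: le_expR].
  rewrite -!expRD ler_expR -!natrD ler_nat; apply: leq_trans leJ.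
  by rewrite -!mulnn; nia.
apply: le_trans (exp_partial_expn R a (leq_trans (isT : 0 < 9)%N J9)).
rewrite lerBrDr addrC -lerBrDr.
rewrite ler_pdivrMr //; move: sep key; set dl := expR a%:R - _ => sep key.
apply: le_trans (_ : dl * Q * (a%:R * expR a%:R) <= _).
  by rewrite ler_peMl // mulr_ge0 // expR_ge0.
have dl0 : 0 <= dl by rewrite subr_ge0.
by rewrite -mulrA; apply: ler_wpM2l => //; rewrite mulrC.
Qed.

Definition log_bound (n : nat) : nat := `|Num.ceil (242 / 100 * ln (n%:R : R))|%N.

Lemma log_boundP n : (1 < n)%N ->
  [/\ (log_bound n)%:R < 242 / 100 * ln n%:R + 1 :> R,
      242 / 100 * ln n%:R <= (log_bound n)%:R :> R &
      (log_bound n)%:Z = Num.ceil (242 / 100 * ln (n%:R : R))].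
Proof.
move=> n1; have ln0 : 0 < ln n%:R :> R by rewrite ln_gt0 // ltr1n.
set x := _ * _; have x0 : 0 < x by rewrite /x; lra.
have ez : (log_bound n)%:Z = Num.ceil x.
  by rewrite /log_bound gez0_abs // -(ler_int R); apply: le_trans (ltW x0) _; exact: ceil_ge.
have er : (log_bound n)%:R = (Num.ceil x)%:~R :> R by rewrite -ez.
rewrite er; split=> //; last exact: ceil_ge.
by rewrite -ltrBlDr; have := ceilB1_lt x; rewrite intrB.
Qed.

Lemma log_bound_test : exists c : nat, forall n, (1 < n)%N ->
  [/\ (0 < log_bound n)%N, (log_bound n <= 3 * n)%N,
      forall J, (n < (J - c).+1 * (J - c).+1)%N -> (c <= J)%N ->
        (n ^ 121 * J`! ^ (50 * log_bound n) <= exp_num J ^ (50 * log_bound n))%N &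
      forall J i, (i < log_bound n)%N ->
        (exp_num J ^ (50 * i) < n ^ 121 * J`! ^ (50 * i))%N].
Proof.
(* For a = 50 m, [exp_partial_precise] asks for J >= al m^4, and m <= 3 log n + 1. *)
pose al : R := (8 * (4 * 50 ^ 2) ^ 2)%:R.
have [C hC] := @polynomial_le_quintic al (ler0n _ _).
(* The 9 is required by [exp_partial_precise]; the rest absorbs the additive constant of the quintic
   estimate. *)
pose c := (9 + `|Num.ceil C|)%N.
have Cc : C <= c%:R.
  apply: le_trans (ceil_ge C) _; rewrite /c natrD; apply: le_trans (_ : (`|Num.ceil C|%N)%:R <= _).
    by rewrite natr_absz ler_int; exact: ler_norm.
  by rewrite lerDr.
exists c => n n1; have [up lo _] := log_boundP n1.
set m := log_bound n in up lo *; set L := ln (n%:R : R) in up lo.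
have n0 : 0 < n%:R :> R by rewrite ltr0n ltnW.
have L0 : 0 < L by rewrite ln_gt0 // ltr1n.
have nL : n%:R = expR L by rewrite lnK // posrE.
have m0 : (0 < m)%N by rewrite -(ltr_nat R); lra.
have n121 : (n ^ 121)%:R = expR (121 * L) :> R by rewrite natrX nL -expRM_natl.
split=> //.
- rewrite -ltnS -(ltr_nat R); apply: lt_le_trans up _.
  have : L <= n%:R by apply: ltW; apply: ln_sublinear.
  by move=> hL; rewrite -[leRHS]natr1 natrM; lra.
- move=> J hJ cJ.
  have f0 : 0 < (J`!%:R : R) by rewrite ltr0n fact_gt0.
  rewrite -(ler_nat R) natrM !natrX exp_numE exprMn mulrC ler_pM2l ?exprn_gt0 //.
  rewrite -natrX; apply: exp_partial_precise.
  + by apply: leq_trans (leq_pmulr _ m0).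
  + by apply: leq_trans cJ; rewrite /c leq_addr.
  + rewrite -(ler_nat R).
    have -> : (8 * (4 * (50 * m) ^ 2) ^ 2)%:R = al * m%:R ^+ 4 :> R.
      by rewrite /al -natrX -natrM; congr (_%:R); lia.
    apply: le_trans (_ : al * (3 * L + 1) ^+ 4 <= _).
      by rewrite ler_wpM2l //; apply: lerXn2r; rewrite ?nnegrE //; lra.
    apply: le_trans (hC L (ltW L0)) _.
    rewrite -(subnK cJ) natrD; apply: lerD => //.
    have h1 : expR (L / 2) < (J - c).+1%:R.
      have h2 : expR L < (J - c).+1%:R ^+ 2 by rewrite -nL -natrX ltr_nat -mulnn.
      have h3 : expR L = expR (L / 2) ^+ 2 by rewrite -expRM_natl; congr expR; lra.
      by rewrite ltNge; apply/negP => h4; move: h2; rewrite h3 ltNge; case/negP; apply: lerXn2r;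
         rewrite ?nnegrE ?expR_ge0.
    have h5 := @expR_ge1Dxn R (L / 2) 4 (divr_ge0 (ltW L0) (ler0n _ _)).
    have h6 : (L / 2) ^+ 5 / 5`!%:R = L ^+ 5 / 3840.
      rewrite (_ : 5`! = 120)%N // expr_div_n -mulrA; congr (_ * _).
      by rewrite -invfM; congr (_^-1); rewrite -natrX -natrM.
    by move: h1 h5; rewrite h6 -natr1; lra.
  + by rewrite n121 ler_expR natrM; lra.
(* A partial sum is at most e and i <= m - 1 < 2.42 log n, so a smaller exponent fails for every
   [J]. *)
- move=> J i im.
  have f0 : 0 < (J`!%:R : R) by rewrite ltr0n fact_gt0.
  rewrite -(ltr_nat R) natrM !natrX exp_numE exprMn [ltRHS]mulrC ltr_pM2l ?exprn_gt0 //.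
  rewrite -natrX n121; apply: le_lt_trans (_ : expR (50 * i)%:R < _).
    rewrite -[(50 * i)%:R]mulr1 expRM_natl; apply: lerXn2r; rewrite ?nnegrE ?expR_ge0 ?exp_partial_le_e //.
    by rewrite sumr_ge0 // => h _; rewrite invr_ge0.
  have hi : i%:R + 1 <= m%:R :> R by rewrite natr1 ler_nat.
  by rewrite ltr_expR natrM; lra.
Qed.

End Precision.

(** * Real estimates *)

Section RealBounds.

Variable R : realType.

Lemma expR_nat (a : nat) : expR a%:R = expR 1 ^+ a :> R.
Proof. by rewrite -[a%:R]mulr1 expRM_natl. Qed.

Lemma expn_step_e (q : nat) : (0 < q)%N ->
  (q.+1%:R : R) ^+ q <= expR 1 * q%:R ^+ q.
Proof.
move=> q0; have q0' : 0 < q%:R :> R by rewrite ltr0n.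
have h : (q.+1%:R : R) <= q%:R * expR q%:R^-1.
  rewrite -ler_pdivrMl // -natr1 mulrDr mulVf ?gt_eqF // mulr1.
  exact: expR_ge1Dx.
have h0 : 0 <= q%:R * expR q%:R^-1 :> R by rewrite mulr_ge0 // expR_ge0.
apply: le_trans (lerXn2r q _ _ h) _; rewrite ?nnegrE //.
by rewrite exprMn -expRM_natl divff ?gt_eqF // mulrC.
Qed.

(** With q = k + 2, the probability p = (q - 1)^(q - 1) / q^q is at least 1/(e q). Hence (1 - p)^(q
    m) <= e^(-m/e), which is at most n^(-2) once m >= 2 e log n. *)
Lemma shrinking_rate (k n m : nat) : (0 < n)%N -> 2 * expR 1 * ln (n%:R : R) <= m%:R ->
  (n ^ 2 * (k.+2 ^ k.+2 - k.+1 ^ k.+1) ^ (k.+2 * m) <= (k.+2 ^ k.+2) ^ (k.+2 * m))%N.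
Proof.
move=> n0 hm; have e0 : 0 < expR 1 :> R := expR_gt0 1.
set A := (k.+2 ^ k.+2)%N; set Q := (k.+1 ^ k.+1)%N.
have q0 : 0 < k.+2%:R :> R by rewrite ltr0n.
have hQ : A%:R <= expR 1 * k.+2%:R * Q%:R :> R.
  rewrite /A /Q !natrX exprS mulrAC mulrC ler_wpM2r ?ler0n //.
  exact: expn_step_e.
have QA : (Q <= A)%N.
  by apply: (@leq_trans (k.+2 ^ k.+1)); [rewrite /Q leq_exp2r | rewrite /A leq_exp2l].
have A0 : 0 < A%:R :> R by rewrite ltr0n expn_gt0.
have eq0 : 0 < expR 1 * k.+2%:R :> R by rewrite mulr_gt0.
pose x : R := - (expR 1 * k.+2%:R)^-1.
have hB : (A - Q)%:R <= A%:R * expR x :> R.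
  apply: le_trans (_ : A%:R * (1 + x) <= _); last first.
    by rewrite ler_wpM2l ?(ltW A0) // expR_ge1Dx.
  rewrite natrB // mulrDr mulr1 lerD2l /x mulrN lerN2 mulrC ler_pdivrMl //.
rewrite -(ler_nat R) natrM (natrX R n) (natrX R (A - Q)) (natrX R A).
apply: le_trans (_ : n%:R ^+ 2 * (A%:R * expR x) ^+ (k.+2 * m) <= _).
  by rewrite ler_wpM2l ?exprn_ge0 // lerXn2r ?nnegrE // mulr_ge0 ?expR_ge0 ?(ltW A0).
rewrite exprMn mulrCA ler_piMr ?exprn_ge0 //.
have -> : n%:R ^+ 2 = expR (2 * ln n%:R) :> R by rewrite expRM_natl lnK // posrE ltr0n.
have hx : (k.+2 * m)%:R * x = - (m%:R / expR 1).
  by rewrite /x natrM mulrN [expR 1 * _]mulrC invfM mulrACA divff ?gt_eqF // mul1r.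
rewrite -expRM_natl -expRD -[leRHS]expR0 ler_expR hx subr_le0 ler_pdivlMr //.
by rewrite mulrAC.
Qed.

(** Since 4 > e and 2.42 > 2, 4^(m + 1) >= e^(m + 1) > e^(2 log n). *)
Lemma four_pow_gt (n m : nat) : (1 < n)%N -> 242 / 100 * ln (n%:R : R) <= m%:R ->
  (n * n < 4 ^ m.+1)%N.
Proof.
move=> n1 hm; have ln0 : 0 < ln n%:R :> R by rewrite ln_gt0 // ltr1n.
rewrite -(ltr_nat R) natrX mulnn natrX.
have -> : n%:R ^+ 2 = expR (2 * ln n%:R) :> R.
  by rewrite expRM_natl lnK // posrE ltr0n ltnW.
apply: lt_le_trans (_ : expR m.+1%:R <= _).
  by rewrite ltr_expR -natr1; lra.
rewrite expR_nat; apply: lerXn2r; rewrite ?nnegrE ?expR_ge0 //.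
by have := e_le3 R; lra.
Qed.

Lemma order_dim_upper_bound (d : Order.disp_t) (P : finPOrderType d) (n k : nat) :
  #|P| = n -> degeneracy (@comparability d P) = k ->
  (order_dim P)%:Z <= 2 * (k%:Z + 2) * Num.ceil (2 * expR 1 * ln (n%:R : R)).
Proof.
move=> <- dk; have [n0|n0] := posnP #|P|.
  (* For the empty poset [ln] takes its default value 0, so the bound is 0, and the empty family is
     a realizer. *)
  rewrite n0 ln0 // mulr0 ceil0 mulr0 lez_nat leqn0 -leqn0.
  apply: (@order_dim_le _ P 0 [::]) => //; apply: realizerI => // x.
  by have := fintype0 x n0.
set c := Num.ceil _; have c_ge0 : 0 <= c.
  rewrite -(ler_int R) (le_trans _ (ceil_ge _)) // !mulr_ge0 ?expR_ge0 //.
  by rewrite ln_ge0 // ler1n.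
have cE : c = `|c|%N by rewrite gez0_abs.
have := @order_dim_bound _ P k (k.+2 * `|c|); rewrite -{1}dk => h.
have {h} : (order_dim P <= 2 * (k.+2 * `|c|))%N.
  apply: h => //; first exact: degeneracyP.
  apply: shrinking_rate => //; have : (c%:~R : R) = `|c|%:R by rewrite cE.
  by move=> <-; apply: ceil_ge.
by rewrite -lez_nat {2}cE; lia.
Qed.

Lemma realizer_program_exists : exists (prog : program) (C : nat),
   forall (d : Order.disp_t) (P : finPOrderType d) (n k : nat),
     #|P| = n ->
     degeneracy (@comparability d P) = k ->
     (1 <= k)%N ->
     exists ss : seq (seq P),
       [/\ computes_within prog (encode_poset P) (C * (n ^ 2 * k))%N
             (encode_orders ss),
           all (fun s => perm_eq s (enum P)) ss,
           realizer (mem (map (@listed_order d P) ss)) &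
           (size ss)%:Z =
             16 * k%:Z * (Num.ceil (242 / 100 * ln (n%:R : R)) + 1)].
Proof.
have [c test] := log_bound_test R.
(* The constant is the one of [main_comP] times the sixteen machine steps per unit of time. *)
exists (compile 0 0 (main_com c)), (16 * (320 * (50 * (c.+1 * c.+1)) + 60 * 100))%N.
move=> d P n k <- dk k1; have n1 : (1 < #|P|)%N by apply: card_gt1_degeneracy; rewrite dk.
have /card_gt0P[x0 _] := ltnW n1.
have [m0 m3 t1 t2] := test _ n1; have [_ le_m cE] := log_boundP R n1.
set m := log_bound R #|P| in m0 m3 t1 t2 le_m cE.
have [l [lE lP]] := encode_posetE x0.
have K1 f K : elimination #|P| (le_index x0) f #|P| K -> (1 < K)%N.
  by move=> ef; have := elimination_degeneracy ef; rewrite dk; lia.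
have [f [K [cols [ef [szc hc] bad so_E tm_E]]]] :=
  @main_comP c _ _ l m (Store (fun=> 0%N) (fun _ _ => 0%N) (encode_poset P) [::] 0)
    lE (ltnW n1) (fun _ _ => erefl) (fun _ => erefl) lP m3 t1 t2 K1.
have Kk : K.-1 = k by rewrite (elimination_degeneracy ef).
rewrite Kk in hc so_E tm_E.
have nil_bad : [seq p <- open_pairs #|P| (pos_le (le_index x0) f) | all (fun col =>
    bad_pair (pos_le (le_index x0) f) (base_order #|P| (le_index x0) f) col p) cols] = [::].
  (* A surviving pair would give 4^(m + 1) <= n^2. *)
  apply/eqP; rewrite -size_eq0 -leqn0 leqNgt; apply/negP => h.
  have := leq_trans (leq_pmulr _ h) bad.
  by rewrite leqNgt four_pow_gt.
have [|||ss [h1 h2 h3 h4]] := output_orders ef (cols := cols) (K8 := (8 * k)%N) _ _ _ nil_bad.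
- by rewrite szc.
- by rewrite muln_gt0.
- by rewrite szc.
exists ss; split=> //.
  rewrite h1 -[flatten (flatten _)]cat0s -[[::]]/(so (Store (fun=> 0%N) (fun _ _ => 0%N) (encode_poset P) [::] 0)).
  rewrite -so_E; apply: compile_computes; first exact: main_com_ok.
  rewrite -mulnA leq_mul2l /= -mulnn; exact: tm_E.
by rewrite h4 szc -cE; lia.
Qed.

End RealBounds.

Theorem mainTheorem9 (R : realType) :
  (forall (d : Order.disp_t) (P : finPOrderType d) (n k : nat),
     #|P| = n ->
     degeneracy (@comparability d P) = k ->
     (order_dim P)%:Z <= 2 * (k%:Z + 2) * Num.ceil (2 * expR 1 * ln (n%:R : R)))
  /\
  (exists (prog : program) (C : nat),
   forall (d : Order.disp_t) (P : finPOrderType d) (n k : nat),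
     #|P| = n ->
     degeneracy (@comparability d P) = k ->
     (1 <= k)%N ->
     exists ss : seq (seq P),
       [/\ computes_within prog (encode_poset P) (C * (n ^ 2 * k))%N
             (encode_orders ss),
           all (fun s => perm_eq s (enum P)) ss,
           realizer (mem (map (@listed_order d P) ss)) &
           (size ss)%:Z =
             16 * k%:Z * (Num.ceil (242 / 100 * ln (n%:R : R)) + 1)]).
Proof. by split; [exact: order_dim_upper_bound | exact: realizer_program_exists]. Qed.
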